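(* Let $(X_t)_{t \in \mathbb{Z}}$ be a strictly stationary process in $\mathbb{R}^d$, jointly regularly varying of index $\alpha \in (0,\infty)$ with respect to a norm $\|\cdot\|$, with tail process $(Y_t)_{t \in \mathbb{Z}}$. Let $(a_n)$ be a positive sequence with $n\Pr(\|X_0\| > a_n) \to 1$, write $M_r = \max_{i=1,\ldots,r}\|X_i\|$, and define \[ \theta = \Pr\Bigl(\sup_{i \geq 1}\|Y_i\| \leq 1\Bigr), \qquad E = \Bigl\{ \sup_{t<0}\|Y_t\| < \|Y_0\| = \sup_{t \in \mathbb{Z}}\|Y_t\| \Bigr\}. \] Assume that there exists a positive integer sequence $(r_n)$ with $r_n \to \infty$ and $r_n/n \to 0$ such that for every $u \in (0,\infty)$, \[ \lim_{m \to \infty}\limsup_{n\to\infty} \Pr\Bigl(\max_{m \leq |t| \leq r_n}\|X_t\| > a_n u \,\Big|\, \|X_0\| > a_n u\Bigr) = 0. \] Then $\Pr(\lim_{|t|\to\infty}\|Y_t\| = 0) = 1$ and $\theta = \Pr(E) > 0$. Moreover, for every $u \in (0,\infty)$, as $n \to \infty$, \[ \Pr(M_{r_n} \leq a_n u \mid \|X_0\| > a_n u) = \frac{\Pr(M_{r_n} > a_n u)}{r_n\Pr(\|X_0\| > a_n u)} + o(1) \to \theta, \] and, in the state space $\mathbb{E}$, the conditional law of the point process $\sum_{i=1}^{r_n}\delta_{X_i/(a_n u)}$ given $M_{r_n} > a_n u$ converges weakly to the law of a point process $\sum_{j=1}^\infty \delta_{Z_j}$ whose law equals the conditional law of $\sum_{t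 \in \mathbb{Z}}\delta_{Y_t}$ given $E$.
   Context: A random vector $X$ in $\mathbb{R}^k$ is regularly varying of index $\alpha$ if for some norm there is a random vector $\Theta$ on the unit sphere such that for each $u>0$, $\Pr(\|X\| > ux, X/\|X\| \in \cdot)/\Pr(\|X\|>x) \to u^{-\alpha}\Pr(\Theta \in \cdot)$ weakly as $x\to\infty$. A stationary process $(X_t)$ in $\mathbb{R}^d$ is jointly regularly varying of index $\alpha$ if every $(X_1,\ldots,X_k)$, $k\ge1$, is regularly varying of index $\alpha$. Its tail process $(Y_t)_{t\in\mathbb{Z}}$ is the process such that for all integers $s\le t$ the conditional law of $(x^{-1}X_s,\ldots,x^{-1}X_t)$ given $\|X_0\|>x$ converges weakly to the law of $(Y_s,\ldots,Y_t)$ as $x\to\infty$. $\mathbb{E} = [-\infty,\infty]^d \setminus \{0\}$; its compact sets are the closed subsets of $[-\infty,\infty]^d$ not containing $0$. Point processes on $\mathbb{E}$ are random Radon (locally finite) counting measures on $\mathbb{E}$ with the vague topology (convergence of integrals of nonnegative continuous compactly supported functions), and $\delta_x$ is the Dirac measure at $x$. *)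

(* Defs.v *)
From HB Require Import structures.
From mathcomp Require Import all_boot all_order all_algebra.
From mathcomp Require Import all_classical all_reals all_analysis.
Import Order.TTheory GRing.Theory Num.Theory.
Import numFieldNormedType.Exports.

Set Implicit Arguments.
Unset Strict Implicit.
Unset Printing Implicit Defensive.

Local Open Scope classical_set_scope.
Local Open Scope ring_scope.

Section Defs.
Context {R : realType}.

Definition is_norm (V : lmodType R) (N : V -> R) : Prop :=
  [/\ forall x, N x = 0 -> x = 0,
      forall (c : R) x, N (c *: x) = `|c| * N x &
      forall x y, N (x + y) <= N x + N y].

Definition Pr {dT} {T : measurableType dT} (P : probability T R) (A : set T) : R :=
  fine (P A).

Definition condPr {dT} {T : measurableType dT} (P : probability T R)
  (A B : set T) : R := Pr P (A `&` B) / Pr P B.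

Definition condE {dT} {T : measurableType dT} (P : probability T R)
  (B : set T) (f : T -> R) : R :=
  fine (\int[P]_(w in B) (f w)%:E) / Pr P B.

Definition Ex {dT} {T : measurableType dT} (P : probability T R) (f : T -> R) : R :=
  fine (\int[P]_(w in setT) (f w)%:E).

Definition bounded_continuous (S : topologicalType) (f : S -> R) : Prop :=
  continuous f /\ exists C : R, forall x, `|f x| <= C.

Definition block (d : nat) (Z : int -> 'rV[R]_d) (s : int) (k : nat) : 'M[R]_(k, d) :=
  \matrix_(i < k, j < d) Z (s + (i : nat)%:Z) 0 j.

Definition strictly_stationary {dT} {T : measurableType dT} (P : probability T R)
  (d : nat) (X : int -> T -> 'rV[R]_d) : Prop :=
  forall (s : int) (k : nat) (B : 'I_k -> 'I_d -> set R),
    (forall i j, measurable (B i j)) ->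
    P [set w | forall i j, B i j (block (fun t => X t w) s k i j)] =
    P [set w | forall i j, B i j (block (fun t => X t w) 0 k i j)].

(** A random vector V in R^{kd} (written as a k x d matrix) is regularly varying
    of index alpha: for some norm Nk there is a random vector Theta on the unit
    sphere of Nk such that, for every u > 0, the finite measures
    P(Nk(V) > u x, V/Nk(V) in .)/P(Nk(V) > x) converge weakly (tested against
    bounded continuous functions) to u^(-alpha) P(Theta in .) as x -> oo. *)
Definition regvar_vec {dT} {T : measurableType dT} (P : probability T R)
  (k d : nat) (V : T -> 'M[R]_(k, d)) (alpha : R) : Prop :=
  exists Nk : 'M[R]_(k, d) -> R, is_norm Nk /\
  exists (d' : measure_display) (T' : measurableType d') (Q : probability T' R)
         (Theta : T' -> 'M[R]_(k, d)),
    (forall i j, measurable_fun setT (fun w => Theta w i j)) /\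
    (forall w, Nk (Theta w) = 1) /\
    forall u : R, 0 < u ->
    forall f : 'M[R]_(k, d) -> R, bounded_continuous f ->
      (fun x : R =>
         fine (\int[P]_(w in [set w | u * x < Nk (V w)])
                 (f ((Nk (V w))^-1 *: V w))%:E)
         / Pr P [set w | x < Nk (V w)])
      @ +oo --> u `^ (- alpha) * Ex Q (fun w => f (Theta w)).

Definition jointly_regvar {dT} {T : measurableType dT} (P : probability T R)
  (d : nat) (X : int -> T -> 'rV[R]_d) (alpha : R) : Prop :=
  forall k : nat, (0 < k)%N ->
    regvar_vec P (fun w => block (fun t => X t w) 1 k) alpha.

Definition tail_process {dT} {T : measurableType dT} (P : probability T R)
  (d : nat) (X : int -> T -> 'rV[R]_d) (N : 'rV[R]_d -> R)
  {dY} {TY : measurableType dY} (Q : probability TY R)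
  (Y : int -> TY -> 'rV[R]_d) : Prop :=
  forall (s : int) (k : nat) (f : 'M[R]_(k, d) -> R), bounded_continuous f ->
    (fun x : R => condE P [set w | x < N (X 0 w)]
                    (fun w => f (x^-1 *: block (fun t => X t w) s k)))
    @ +oo --> Ex Q (fun w => f (block (fun t => Y t w) s k)).

Definition Mmax {dT} {T : measurableType dT} (d : nat)
  (X : int -> T -> 'rV[R]_d) (N : 'rV[R]_d -> R) (r : nat) (w : T) : R :=
  \big[Num.max/0]_(1 <= i < r.+1) N (X (i%:Z) w).

(** The state space E = [-oo,oo]^d \ {0}: points are rows of extended reals. *)
Definition Epoint (d : nat) := 'rV[\bar R]_d.
Definition Ezero (d : nat) : Epoint d := const_mx 0%E.
Definition emb (d : nat) (x : 'rV[R]_d) : Epoint d := map_mx (fun c => c%:E) x.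

(** A counting measure on E is given by its multiplicity function; it is Radon
    (finite on compact subsets of E, i.e. on sets bounded away from 0) iff only
    finitely many atoms lie outside every box around 0. *)
Definition pmeasure (d : nat) := Epoint d -> nat.

Definition is_radon (d : nat) (m : pmeasure d) : Prop :=
  m (Ezero d) = 0%N /\
  forall delta : R, 0 < delta ->
    finite_set [set x | (0 < m x)%N /\ exists j, (delta%:E <= `|x ord0 j|)%E].

(** C_K^+(E): nonnegative continuous functions on E with compact support in E,
    i.e. vanishing on a neighbourhood of 0 in [-oo,oo]^d. *)
Definition CKplus (d : nat) (g : Epoint d -> R) : Prop :=
  [/\ forall x, 0 <= g x,
      forall x : Epoint d, x <> Ezero d -> {for x, continuous g} &
      exists delta : R, 0 < delta /\
        forall x : Epoint d, (forall j, (`|x ord0 j| < delta%:E)%E) -> g x = 0].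

Definition pm_eval (d : nat) (m : pmeasure d) (g : Epoint d -> R) : R :=
  \sum_(x \in [set x | (0 < m x)%N]) (m x)%:R * g x.

(** Continuity at m for the vague topology on M_p(E) (the coarsest topology
    making m |-> m(g) continuous for all g in C_K^+(E)). *)
Definition vague_continuous_at (d : nat) (F : pmeasure d -> R) (m : pmeasure d) : Prop :=
  forall eps : R, 0 < eps ->
  exists (n : nat) (gs : 'I_n -> Epoint d -> R),
    (forall i, CKplus (gs i)) /\
    exists delta : R, 0 < delta /\
      forall m' : pmeasure d, is_radon m' ->
        (forall i, `|pm_eval m' (gs i) - pm_eval m (gs i)| < delta) ->
        `|F m' - F m| < eps.

Definition bounded_vague_continuous (d : nat) (F : pmeasure d -> R) : Prop :=
  (exists C : R, forall m, `|F m| <= C) /\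
  forall m, is_radon m -> vague_continuous_at F m.

(** The point process sum_{t in J} delta_{Z_t} on E (points at 0 are not in E). *)
Definition pp (d : nat) (J : set int) (Z : int -> 'rV[R]_d) : pmeasure d :=
  fun x => (\big[addn/0%N]_(t \in [set t | J t /\ x <> Ezero d /\ emb (Z t) = x]) 1)%N.

End Defs.

(* Main.v *)
(** Conditionally on [N (X 0) > x], bounded functionals of [X / x] that depend
    on finitely many times converge to their mean under [Y], and this extends to
    the indicator of [N y_t > 1] because [P(N (X 0) > (1 + delta) x)] is
    eventually close to [P(N (X 0) > x)] for small [delta].
    The anticlustering condition makes the times [m <= |t| <= r_n] negligible, so
    [Y] vanishes at infinity and functionals of the whole block converge as well.

    Splitting [M_{r_n} > a_n u] according to the first exceedance and moving it
    to time 0 by stationarity expresses the block mean of a shift-invariant [Phi]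
    as the average over [i < r_n] of conditional means given [N (X 0) > a_n u];
    all of them except boundedly many at either end are close to
    [E(Phi(Y); N Y_t <= 1 for t < 0)].

    The tail process satisfies [E(h(Y); N Y_s > 1) = E(h(shift Y); N Y_{-s} > 1)].
    Hence any two rules selecting exactly one exceedance time of a vanishing path
    in a shift-covariant way (first, last, first maximum) select time 0 with the
    same probability, also under a shift-invariant weight.  The last exceedance
    gives [theta], the first exceedance the limit of the block means, the first
    maximum [P(E)]; the probability is positive since [Y_0] is an exceedance. *)
Require Import Defs.
From HB Require Import structures.
From mathcomp Require Import all_boot all_order all_algebra.
From mathcomp Require Import all_classical all_reals all_analysis.
From mathcomp Require Import measurable_realfun.
From mathcomp Require Import ring lra zify.
Import Order.TTheory GRing.Theory Num.Theory.
Import numFieldNormedType.Exports.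
Set Implicit Arguments.
Unset Strict Implicit.
Unset Printing Implicit Defensive.
Local Open Scope classical_set_scope.
Local Open Scope ring_scope.

(** * Expectations *)

Section Indicator.
Context {R : realType}.

(** Three gaps between the hypotheses and their use shape the proof. Stationarity is given on
    product events and tail convergence for continuous functions of finite blocks, while the
    argument needs events about whole paths; hence the class [baire] of bounded limits of cylinder
    functions, on which identities propagate by dominated convergence. Regular variation holds for
    some norm, possibly different from [N], so the tail of [N] is at first known only up to constant
    factors. The existence of the limits defining the tail process supplies the rest: a drop below
    the power law over a factor close to 1 would compound along a geometric sequence and violate the
    lower bound. Finally, vague functionals of the cluster are continuous, but not uniformly so, and
    are not assumed measurable. Lipschitz minorants make the error of truncating a long window
    uniform over paths, the opposite bound coming from the negated functional; integrals are
    compared by squeezing between measurable functions that agree almost everywhere. *)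

Definition ind (A : Prop) : R := (`[< A >])%:R.

Lemma indT (A : Prop) : A -> ind A = 1.
Proof. by move=> hA; rewrite /ind (asboolT hA). Qed.

Lemma indF (A : Prop) : ~ A -> ind A = 0.
Proof. by move=> hA; rewrite /ind (asboolF hA). Qed.

Lemma ind_ge0 (A : Prop) : 0 <= ind A.
Proof. exact: ler0n. Qed.

Lemma ind_le1 (A : Prop) : ind A <= 1.
Proof. by rewrite /ind; case: asbool. Qed.

Lemma normr_ind_le1 (A : Prop) : `|ind A| <= 1.
Proof. by rewrite ger0_norm ?ind_ge0 ?ind_le1. Qed.

Lemma ind_le (A B : Prop) : (A -> B) -> ind A <= ind B.
Proof.
move=> AB; have [hA|hA] := pselect A; last by rewrite (indF hA) ind_ge0.
by rewrite (indT hA) (indT (AB hA)).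
Qed.

Lemma ind_eq (A B : Prop) : (A <-> B) -> ind A = ind B.
Proof. by move=> /propext ->. Qed.

Lemma ind_and (A B : Prop) : ind (A /\ B) = ind A * ind B.
Proof.
have [hA|hA] := pselect A; last by rewrite (indF hA) mul0r indF// => -[].
by rewrite (indT hA) mul1r; apply: ind_eq; split=> // -[].
Qed.

Lemma ind_not (A : Prop) : ind (~ A) = 1 - ind A.
Proof.
have [hA|hA] := pselect A; last by rewrite (indF hA) subr0 indT.
by rewrite (indT hA) subrr indF.
Qed.

Lemma ind_indic (T : Type) (A : set T) (w : T) : ind (A w) = \1_A w.
Proof. by rewrite indicE. Qed.

End Indicator.

Section Expectation.
Context {R : realType} {dT : measure_display} {T : measurableType dT}.
Variable P : probability T R.

Definition bounded_measurable (f : T -> R) : Prop :=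
  measurable_fun setT f /\ exists C : R, forall w, `|f w| <= C.

Lemma bounded_measurable_integrable (f : T -> R) :
  bounded_measurable f -> P.-integrable setT (EFin \o f).
Proof.
move=> [mf [C fC]]; apply: (@le_integrable _ _ _ _ _ _ _ (EFin \o cst C)) => //.
- exact/measurable_EFinP.
- move=> w _ /=; rewrite lee_fin (le_trans (fC w))// ler_norm//.
- exact: finite_measure_integrable_cst.
Qed.

Lemma bounded_measurable_cst (c : R) : bounded_measurable (fun=> c).
Proof. by split; [exact: measurable_cst|exists `|c|]. Qed.

Lemma bounded_measurableD (f g : T -> R) : bounded_measurable f ->
  bounded_measurable g -> bounded_measurable (fun w => f w + g w).
Proof.
move=> [mf [C fC]] [mg [D gD]]; split; first exact: measurable_funD.
by exists (C + D) => w; rewrite (le_trans (ler_normD _ _))// lerD.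
Qed.

Lemma bounded_measurableM (f g : T -> R) : bounded_measurable f ->
  bounded_measurable g -> bounded_measurable (fun w => f w * g w).
Proof.
move=> [mf [C fC]] [mg [D gD]]; split; first exact: measurable_funM.
by exists (C * D) => w; rewrite normrM ler_pM.
Qed.

Lemma bounded_measurableB (f g : T -> R) : bounded_measurable f ->
  bounded_measurable g -> bounded_measurable (fun w => f w - g w).
Proof.
move=> [mf [C fC]] [mg [D gD]]; split; first exact: measurable_funB.
by exists (C + D) => w; rewrite (le_trans (ler_normB _ _))// lerD.
Qed.

Lemma bounded_measurable_norm (f : T -> R) : bounded_measurable f ->
  bounded_measurable (fun w => `|f w|).
Proof.
move=> [mf [C fC]]; split; first exact: measurableT_comp.
by exists C => w; rewrite normr_id.
Qed.

Lemma bounded_measurable_ind (A : set T) : measurable A ->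
  bounded_measurable (fun w => ind (A w)).
Proof.
move=> mA; split; last by exists 1 => w; exact: normr_ind_le1.
rewrite (_ : (fun _ => _) = \1_A); last by apply/funext => w; rewrite ind_indic.
exact: measurable_indic.
Qed.

Lemma bounded_measurable_sum (I : Type) (s : seq I) (p : pred I)
    (f : I -> T -> R) : (forall i, bounded_measurable (f i)) ->
  bounded_measurable (fun w => \sum_(i <- s | p i) f i w).
Proof.
move=> bf; elim: s => [|i s ih].
  rewrite (_ : (fun _ => _) = fun=> 0); first exact: bounded_measurable_cst.
  by apply/funext => w; rewrite big_nil.
case pi : (p i); last first.
  rewrite (_ : (fun _ => _) = fun w => \sum_(i <- s | p i) f i w)//.
  by apply/funext => w; rewrite big_cons pi.
rewrite (_ : (fun _ => _) = fun w => f i w + \sum_(i <- s | p i) f i w)//.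
  exact: bounded_measurableD.
by apply/funext => w; rewrite big_cons pi.
Qed.

Lemma eq_Ex (f g : T -> R) : f =1 g -> Ex P f = Ex P g.
Proof. by move=> /funext ->. Qed.

Lemma ExD (f g : T -> R) : bounded_measurable f -> bounded_measurable g ->
  Ex P (fun w => f w + g w) = Ex P f + Ex P g.
Proof.
by move=> bf bg; apply: RintegralD => //; exact: bounded_measurable_integrable.
Qed.

Lemma ExB (f g : T -> R) : bounded_measurable f -> bounded_measurable g ->
  Ex P (fun w => f w - g w) = Ex P f - Ex P g.
Proof.
by move=> bf bg; apply: RintegralB => //; exact: bounded_measurable_integrable.
Qed.

Lemma ExZ (c : R) (f : T -> R) : bounded_measurable f ->
  Ex P (fun w => c * f w) = c * Ex P f.
Proof.
by move=> bf; apply: RintegralZl => //; exact: bounded_measurable_integrable.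
Qed.

Lemma Ex_cst (c : R) : Ex P (fun=> c) = c.
Proof.
rewrite /Ex integral_cst// [X in (_ * X)%E](_ : _ = 1%E) ?mule1//.
exact: probability_setT.
Qed.

Lemma Ex_le (f g : T -> R) : bounded_measurable f -> bounded_measurable g ->
  (forall w, f w <= g w) -> Ex P f <= Ex P g.
Proof.
move=> bf bg fg.
by apply: le_Rintegral => //; exact: bounded_measurable_integrable.
Qed.

Lemma Ex_ge0 (f : T -> R) : (forall w, 0 <= f w) -> 0 <= Ex P f.
Proof. by move=> f0; exact: Rintegral_ge0. Qed.

Lemma Ex_norm (f : T -> R) : bounded_measurable f ->
  `|Ex P f| <= Ex P (fun w => `|f w|).
Proof.
by move=> bf; apply: le_normr_Rintegral => //; exact: bounded_measurable_integrable.
Qed.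

Lemma Ex_norm_le (f : T -> R) (C : R) : bounded_measurable f ->
  (forall w, `|f w| <= C) -> `|Ex P f| <= C.
Proof.
move=> bf fC; rewrite (le_trans (Ex_norm bf))// -[leRHS]Ex_cst.
by apply: Ex_le => //; [exact: bounded_measurable_norm|exact: bounded_measurable_cst].
Qed.

Lemma Ex_sum (I : Type) (s : seq I) (p : pred I) (f : I -> T -> R) :
  (forall i, bounded_measurable (f i)) ->
  Ex P (fun w => \sum_(i <- s | p i) f i w) = \sum_(i <- s | p i) Ex P (f i).
Proof.
move=> bf; elim: s => [|i s ih].
  by rewrite big_nil -[RHS]Ex_cst; apply: eq_Ex => w; rewrite big_nil.
rewrite big_cons -ih; case pi : (p i); last first.
  by apply: eq_Ex => w; rewrite big_cons pi.
rewrite -ExD//; last exact: bounded_measurable_sum.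
by apply: eq_Ex => w; rewrite big_cons pi.
Qed.

Lemma Ex_ind (A : set T) : measurable A -> Ex P (fun w => ind (A w)) = Pr P A.
Proof.
move=> mA; rewrite /Ex /Pr; congr fine.
under eq_integral do rewrite ind_indic.
by rewrite integral_indic// setIT.
Qed.

Lemma Ex_cvg (f_ : nat -> T -> R) (f : T -> R) (C : R) :
  (forall n, measurable_fun setT (f_ n)) ->
  (forall n w, `|f_ n w| <= C) ->
  (forall w, f_ ^~ w @ \oo --> f w) ->
  (fun n => Ex P (f_ n)) @ \oo --> Ex P f.
Proof.
move=> mf fC ff.
have mlim : measurable_fun setT f by apply: (measurable_fun_cvg mf) => w _.
have [|||||h _ intf] := @dominated_convergence _ _ _ P setT measurableT
  (fun n => EFin \o f_ n) (EFin \o f) (EFin \o cst C).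
- by move=> n; exact/measurable_EFinP.
- exact/measurable_EFinP.
- apply: aeW => w _; apply/fine_cvgP; split; first exact: nearW.
  exact: ff.
- exact: finite_measure_integrable_cst.
- by apply: aeW => w n _ /=; rewrite lee_fin fC.
apply: fine_cvg; rewrite fineK//.
apply: integrable_fin_num => //.
Qed.

Lemma PrE (A : set T) : measurable A -> (Pr P A)%:E = P A.
Proof. by move=> mA; rewrite /Pr fineK// fin_num_measure. Qed.

(** The integral over [B] is that of the restricted function, so this also applies to functionals of
    a point process whose measurability is unknown. *)
Lemma condEE (B : set T) (f : T -> R) :
  condE P B f = Ex P (fun w => ind (B w) * f w) / Pr P B.
Proof.
rewrite /condE; congr (_ / _); rewrite /Ex -/(Rintegral P B f).
rewrite Rintegral_mkcond; apply: eq_Rintegral => w _; rewrite patchE /ind.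
case: ifPn => [|]; rewrite ?inE ?notin_setE => h; first by rewrite asboolT ?mul1r.
by rewrite asboolF ?mul0r.
Qed.

Lemma condPrE (A B : set T) : measurable A -> measurable B ->
  condPr P A B = Ex P (fun w => ind (B w) * ind (A w)) / Pr P B.
Proof.
move=> mA mB; rewrite /condPr -(Ex_ind (measurableI _ _ mA mB)); congr (_ / _).
by apply: eq_Ex => w; rewrite -ind_and; apply: ind_eq; split=> -[].
Qed.

End Expectation.

(** * Path space *)

Section Clamp.
Context {R : realType}.

(** The ramp of slope one from 0 to 1; its rescaled translates are the continuous substitutes for
    indicators. *)
Definition clamp (x : R) : R := Num.min 1 (Num.max 0 x).

Lemma clamp_ge0 x : 0 <= clamp x.
Proof. by rewrite /clamp le_min ler01 le_max lexx. Qed.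

Lemma clamp_le1 x : clamp x <= 1.
Proof. by rewrite /clamp ge_min lexx. Qed.

Lemma normr_clamp_le1 x : `|clamp x| <= 1.
Proof. by rewrite ger0_norm ?clamp_ge0// clamp_le1. Qed.

Lemma clamp1 x : 1 <= x -> clamp x = 1.
Proof. by move=> x1; rewrite /clamp min_l// le_max x1 orbT. Qed.

Lemma clamp0 x : x <= 0 -> clamp x = 0.
Proof. by move=> x0; rewrite /clamp max_l// min_r. Qed.

Lemma clamp_lipschitz x y : `|clamp x - clamp y| <= `|x - y|.
Proof.
rewrite /clamp; case: (leP 0 x) => hx; case: (leP 0 y) => hy;
  rewrite ?(min_r ler01); [|..];
  repeat match goal with |- context [Num.min 1 ?a] => case: (leP 1 a) => ? end;
  rewrite ler_norml; have := ler_norm (x - y); have := lerNnormlW (lexx `|x - y|); lra.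
Qed.

End Clamp.

(** * Cylinder functions of a path and their closure under bounded limits *)

Section Cylinder.
Context {R : realType} {d : nat}.
Notation path := (int -> 'rV[R]_d).
Implicit Types (f g : path -> R) (y z : path).

Definition cylcont_on (m : nat) f : Prop :=
  forall y eps, 0 < eps -> exists2 delta : R, 0 < delta &
    forall z, (forall t : int, `|t| <= m%:Z -> `|y t - z t| < delta) ->
      `|f y - f z| < eps.

(** Continuity depending on finitely many times only; agreement on the window
    [-m, m] already forces [f y = f z]. *)
Definition cylcont f : Prop := exists m, cylcont_on m f.

Definition bounded_path f : Prop := exists C : R, forall y, `|f y| <= C.

Lemma cylcont_on_eq m f y z : cylcont_on m f ->
  (forall t : int, `|t| <= m%:Z -> y t = z t) -> f y = f z.
Proof.
move=> fm yz; apply/eqP; rewrite -subr_eq0 -normr_le0; apply/ler_addgt0Pl => e e0.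
rewrite addr0; have [delta d0 h] := fm y _ e0.
by apply/ltW/h => t tm; rewrite yz// subrr normr0.
Qed.

Lemma cylcont_cst (c : R) : cylcont (fun=> c).
Proof. by exists 0%N => y e e0; exists 1 => // z _; rewrite subrr normr0. Qed.

Lemma cylcont_lip f (phi : R -> R) (L : R) :
  (forall a b, `|phi a - phi b| <= L * `|a - b|) ->
  cylcont f -> cylcont (fun y => phi (f y)).
Proof.
move=> hL [m fm]; exists m => y e e0.
have L0 : 0 < `|L| + 1 by rewrite ltr_wpDl.
have [delta d0 h] := fm y (e / (`|L| + 1)) (divr_gt0 e0 L0).
exists delta => // z /h; rewrite ltr_pdivlMr// mulrC; apply: le_lt_trans.
rewrite (le_trans (hL _ _))// ler_wpM2r// (le_trans (ler_norm _))//.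
by rewrite lerDl.
Qed.

Lemma cylcont_op2 (op : R -> R -> R) :
  (forall a b eps, 0 < eps -> exists2 delta, 0 < delta &
    forall a' b', `|a - a'| < delta -> `|b - b'| < delta ->
      `|op a b - op a' b'| < eps) ->
  forall f g, cylcont f -> cylcont g -> cylcont (fun y => op (f y) (g y)).
Proof.
move=> hop f g [m fm] [m' gm']; exists (maxn m m') => y e e0.
have [delta d0 h] := hop (f y) (g y) _ e0.
have [d1 d10 h1] := fm y _ d0; have [d2 d20 h2] := gm' y _ d0.
exists (Num.min d1 d2); first by rewrite lt_min d10.
move=> z yz; apply: h.
  apply: h1 => t tm; apply: (lt_le_trans (yz t _)); last by rewrite ge_min lexx.
  by rewrite (le_trans tm)// lez_nat leq_maxl.
apply: h2 => t tm; apply: (lt_le_trans (yz t _)); last by rewrite ge_min lexx orbT.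
by rewrite (le_trans tm)// lez_nat leq_maxr.
Qed.

Lemma cylcontD f g : cylcont f -> cylcont g -> cylcont (fun y => f y + g y).
Proof.
apply: (@cylcont_op2 +%R) => a b e e0; exists (e / 2); first by rewrite divr_gt0.
move=> a' b' ha hb; rewrite opprD addrACA (le_lt_trans (ler_normD _ _))//.
by rewrite [ltRHS]splitr ltrD.
Qed.

Lemma cylcontM f g : cylcont f -> cylcont g -> cylcont (fun y => f y * g y).
Proof.
apply: (@cylcont_op2 *%R) => a b e e0.
(* [K] exceeds [|a| + |b'|] once [|b - b'| < 1], hence the minimum with 1 below. *)
pose K := `|a| + `|b| + 2.
have K0 : 0 < K by rewrite /K; have := normr_ge0 a; have := normr_ge0 b; lra.
exists (Num.min 1 (e / K)); first by rewrite lt_min ltr01 divr_gt0.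
move=> a' b'; rewrite !lt_min => /andP[a1 a2] /andP[b1 b2].
have -> : a * b - a' * b' = a * (b - b') + (a - a') * b' by ring.
have hb' : `|b'| <= `|b| + 1.
  have -> : b' = b - (b - b') by ring.
  by rewrite (le_trans (ler_normB _ _))// lerD2l ltW.
rewrite (le_lt_trans (ler_normD _ _))// !normrM.
have eK : 0 < e / K by rewrite divr_gt0.
apply: (@le_lt_trans _ _ (`|a| * (e / K) + (e / K) * (`|b| + 1))).
  by rewrite lerD// ler_pM// ltW.
rewrite mulrC -mulrDr mulrAC ltr_pdivrMr// ltr_pM2l// /K; lra.
Qed.

Lemma cylcontZ (c : R) f : cylcont f -> cylcont (fun y => c * f y).
Proof. by move=> fc; apply: cylcontM => //; exact: cylcont_cst. Qed.

Lemma cylcontN f : cylcont f -> cylcont (fun y => - f y).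
Proof.
move=> fc; rewrite (_ : (fun _ => _) = fun y => -1 * f y); first exact: cylcontZ.
by apply/funext => y; rewrite mulN1r.
Qed.

Lemma cylcontB f g : cylcont f -> cylcont g -> cylcont (fun y => f y - g y).
Proof. by move=> fc gc; apply: cylcontD => //; exact: cylcontN. Qed.

Lemma cylcont_clamp f : cylcont f -> cylcont (fun y => clamp (f y)).
Proof.
by apply: (@cylcont_lip _ _ 1) => a b; rewrite mul1r clamp_lipschitz.
Qed.

Lemma cylcont_at (phi : 'rV[R]_d -> R) (L : R) (t : int) :
  (forall a b, `|phi a - phi b| <= L * `|a - b|) -> cylcont (fun y => phi (y t)).
Proof.
move=> hL; exists `|t|%N => y e e0.
have L0 : 0 < `|L| + 1 by rewrite ltr_wpDl.
exists (e / (`|L| + 1)); first by rewrite divr_gt0.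
move=> z /(_ t); rewrite -abszE lexx => /(_ isT).
rewrite ltr_pdivlMr// mulrC; apply: le_lt_trans.
by rewrite (le_trans (hL _ _))// ler_wpM2r// (le_trans (ler_norm _))// lerDl.
Qed.

(** Stated window by window, so that composition with [S] preserves dependence on finitely many
    times. *)
Definition local_lipschitz (S : path -> path) : Prop :=
  forall m : nat, exists (m' : nat) (L : R), 0 < L /\ forall y z delta,
    0 < delta ->
    (forall t : int, `|t| <= m'%:Z -> `|y t - z t| < delta) ->
    forall t : int, `|t| <= m%:Z -> `|S y t - S z t| < L * delta.

Lemma cylcont_comp (S : path -> path) f : local_lipschitz S -> cylcont f ->
  cylcont (fun y => f (S y)).
Proof.
move=> SL [m fm]; have [m' [L [L0 h]]] := SL m; exists m' => y e e0.
have [delta d0 hd] := fm (S y) _ e0.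
exists (delta / L); first by rewrite divr_gt0.
move=> z yz; apply: hd => t tm.
have := h y z _ (divr_gt0 d0 L0) yz t tm.
by rewrite mulrC divfK// gt_eqF.
Qed.

Definition tshift (s : int) y : path := fun t => y (t + s).
Definition scale (c : R) y : path := fun t => c *: y t.
Definition window (l h : int) y : path := fun t => if l <= t <= h then y t else 0.

Lemma local_lipschitz_tshift s : local_lipschitz (tshift s).
Proof.
move=> m; exists (m + `|s|)%N, 1; split=> // y z e e0 yz t tm.
by rewrite mul1r; apply: yz; rewrite PoszD (le_trans (ler_normD _ _))// lerD// abszE.
Qed.

Lemma local_lipschitz_scale c : local_lipschitz (scale c).
Proof.
move=> m; exists m, (`|c| + 1); split; first by rewrite ltr_wpDl.
move=> y z e e0 yz t tm; rewrite /scale -scalerBr normrZ.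
apply: (@le_lt_trans _ _ (`|c| * e)); first by rewrite ler_wpM2l// ltW// yz.
by rewrite ltr_pM2r// ltrDl.
Qed.

Lemma local_lipschitz_window l h : local_lipschitz (window l h).
Proof.
move=> m; exists m, 1; split=> // y z e e0 yz t tm.
rewrite mul1r /window; case: ifP => _; first exact: yz.
by rewrite subrr normr0.
Qed.

(** Induction on this class plays the part of the monotone class theorem: an identity between
    expectations is checked on cylinder functions and passes to limits by [Ex_cvg]. *)
Inductive baire : (path -> R) -> Prop :=
| baire_cyl f : cylcont f -> bounded_path f -> baire f
| baire_lim (f_ : nat -> path -> R) f (C : R) : (forall n, baire (f_ n)) ->
    (forall n y, `|f_ n y| <= C) -> (forall y, f_ ^~ y @ \oo --> f y) -> baire f.

Lemma baire_bounded f : baire f -> bounded_path f.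
Proof.
elim=> // f_ {}f C _ _ fC ff; exists C => y.
have : (fun n => `|f_ n y|) @ \oo --> `|f y| by exact: (cvg_norm (ff y)).
move=> h; rewrite -(cvg_lim _ h)//; apply: limr_le; last exact: nearW.
by apply/cvg_ex; eexists; exact: h.
Qed.

(** Induction on [f] with [g] fixed and, once [f] is a cylinder function, induction on [g]. The
    bound [D] of [g] is extracted beforehand to dominate the outer limit. *)
Lemma baire_op2 (op : R -> R -> R) :
  (forall f g, cylcont f -> cylcont g -> cylcont (fun y => op (f y) (g y))) ->
  (forall C D, exists E, forall a b, `|a| <= C -> `|b| <= D -> `|op a b| <= E) ->
  (forall (u v : nat -> R) a b, u @ \oo --> a -> v @ \oo --> b ->
    (fun n => op (u n) (v n)) @ \oo --> op a b) ->
  forall f g, baire f -> baire g -> baire (fun y => op (f y) (g y)).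
Proof.
move=> ocyl obnd ocvg f g bf bg; have [D gD] := baire_bounded bg.
elim: bf => [{}f fc [C fC]|f_ {}f C bf_ ih fC ff]; last first.
  have [E hE] := obnd C D.
  apply: (baire_lim ih (C := E)) => [n y|y]; first exact: hE.
  by apply: ocvg; [exact: ff|exact: cvg_cst].
elim: bg {D gD} => [{}g gc [D gD]|g_ {}g D bg_ ih gD gg].
  apply: baire_cyl; first exact: ocyl.
  by have [E hE] := obnd C D; exists E => y; exact: hE.
have [E hE] := obnd C D.
apply: (baire_lim ih (C := E)) => [n y|y]; first exact: hE.
by apply: ocvg; [exact: cvg_cst|exact: gg].
Qed.

Lemma baireD f g : baire f -> baire g -> baire (fun y => f y + g y).
Proof.
apply: (@baire_op2 +%R) => [|C D|u v a b]; first exact: cylcontD.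
  by exists (C + D) => a b aC bD; rewrite (le_trans (ler_normD _ _))// lerD.
exact: cvgD.
Qed.

Lemma baireM f g : baire f -> baire g -> baire (fun y => f y * g y).
Proof.
apply: (@baire_op2 *%R) => [|C D|u v a b]; first exact: cylcontM.
  by exists (C * D) => a b aC bD; rewrite normrM ler_pM.
exact: cvgM.
Qed.

Lemma baire_cst (c : R) : baire (fun=> c).
Proof. by apply: baire_cyl; [exact: cylcont_cst|exists `|c|]. Qed.

Lemma baireB f g : baire f -> baire g -> baire (fun y => f y - g y).
Proof.
move=> bf bg; rewrite (_ : (fun _ => _) = fun y => f y + -1 * g y).
  by apply: baireD => //; apply: baireM => //; exact: baire_cst.
by apply/funext => y; rewrite mulN1r.
Qed.

Lemma baire_comp (S : path -> path) f : local_lipschitz S -> baire f ->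
  baire (fun y => f (S y)).
Proof.
move=> SL; elim=> [{}f fc [C fC]|f_ {}f C _ ih fC ff].
  by apply: baire_cyl; [exact: cylcont_comp|exists C => y].
by apply: (baire_lim ih (C := C)) => [n y|y]; [exact: fC|exact: ff].
Qed.

Definition bset (A : path -> Prop) : Prop := baire (fun y => ind (A y)).

Lemma bset_iff (A B : path -> Prop) : (forall y, A y <-> B y) -> bset A -> bset B.
Proof.
move=> AB; rewrite /bset (_ : (fun y => ind (A y)) = fun y => ind (B y))//.
by apply/funext => y; exact: ind_eq.
Qed.

Lemma bset_cst (A : Prop) : bset (fun=> A).
Proof. exact: baire_cst. Qed.

Lemma bset_not (A : path -> Prop) : bset A -> bset (fun y => ~ A y).
Proof.
move=> bA; rewrite /bset (_ : (fun _ => _) = fun y => 1 - ind (A y)).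
  by apply: baireB => //; exact: baire_cst.
by apply/funext => y; rewrite ind_not.
Qed.

Lemma bset_and (A B : path -> Prop) : bset A -> bset B ->
  bset (fun y => A y /\ B y).
Proof.
move=> bA bB; rewrite /bset (_ : (fun _ => _) = fun y => ind (A y) * ind (B y)).
  exact: baireM.
by apply/funext => y; rewrite ind_and.
Qed.

Lemma bset_imp (A B : path -> Prop) : bset A -> bset B ->
  bset (fun y => A y -> B y).
Proof.
move=> bA bB; apply: (@bset_iff (fun y => ~ (A y /\ ~ B y))).
  move=> y; split=> [h hA|h [hA]]; last by apply; exact: h.
  by apply: contrapT => hB; exact: h.
by apply/bset_not/bset_and => //; exact: bset_not.
Qed.

(** The indicators of the finite intersections are eventually constant at each path. *)
Lemma bset_forall (A : nat -> path -> Prop) : (forall n, bset (A n)) ->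
  bset (fun y => forall n, A n y).
Proof.
move=> bA; pose B k y := forall i, (i < k)%N -> A i y.
have bB k : bset (B k).
  elim: k => [|k ih]; first by apply: (bset_iff _ (bset_cst True)) => y; split.
  apply: (bset_iff _ (bset_and ih (bA k))) => y; split=> [[h1 h2] i|h].
    by rewrite ltnS leq_eqVlt => /predU1P[->//|/h1].
  by split=> [i ik|]; apply: h => //; exact: leqW.
apply: (baire_lim bB (C := 1)) => [n y|y]; first exact: normr_ind_le1.
apply: cvg_near_cst; have [h|/existsNP[i hi]] := pselect (forall n, A n y).
  by apply: nearW => k; rewrite !indT// => i _.
exists i.+1 => // k /= ik.
have h1 : ~ B k y by move=> h; apply/hi/h.
have h2 : ~ (forall n, A n y) by move=> /(_ i).
by rewrite (indF h1) (indF h2).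
Qed.

Lemma bset_exists (A : nat -> path -> Prop) : (forall n, bset (A n)) ->
  bset (fun y => exists n, A n y).
Proof.
move=> bA; apply: (@bset_iff (fun y => ~ forall n, ~ A n y)).
  move=> y; split=> [/existsNP[n /contrapT hn]|[n hn] /(_ n)]; last exact.
  by exists n.
by apply/bset_not/bset_forall => n; exact: bset_not.
Qed.

Lemma bset_forall_int (A : int -> path -> Prop) : (forall t, bset (A t)) ->
  bset (fun y => forall t, A t y).
Proof.
move=> bA; apply: (@bset_iff (fun y => forall n : nat, A n%:Z y /\ A (- n%:Z) y)).
  move=> y; split=> [h [n|n]|h n]; last by split.
    by have [] := h n.
  by rewrite NegzE; have [] := h n.+1.
by apply: bset_forall => n; exact: bset_and.
Qed.

(** The ramps vanish where [g <= f] and equal 1 as soon as [n] reaches [1 / (g - f)]. *)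
Lemma bset_lt f g : cylcont f -> cylcont g -> bset (fun y => f y < g y).
Proof.
move=> fc gc; apply: (@baire_lim (fun n y => clamp (n%:R * (g y - f y))) _ 1).
- move=> n; apply: baire_cyl; last by exists 1 => y; exact: normr_clamp_le1.
  by apply/cylcont_clamp/cylcontZ/cylcontB.
- by move=> n y; exact: normr_clamp_le1.
- move=> y; apply: cvg_near_cst; have [fg|gf] := ltP (f y) (g y); last first.
    apply: nearW => n; rewrite (indF (A := false))// clamp0//.
    by rewrite mulr_ge0_le0// subr_le0.
  have e0 : 0 < g y - f y by rewrite subr_gt0.
  near=> n; rewrite (indT (A := true))// clamp1//.
  rewrite -ler_pdivrMr//; near: n; exact: nbhs_infty_ger.
Unshelve. all: by end_near.
Qed.

Lemma bset_le f g : cylcont f -> cylcont g -> bset (fun y => f y <= g y).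
Proof.
move=> fc gc; apply: (bset_iff _ (bset_not (bset_lt gc fc))) => y.
by rewrite leNgt; split=> /negP.
Qed.

End Cylinder.

Section RowNorm.
Context {R : realType} {d : nat}.

Lemma row_coord_le (x : 'rV[R]_d) j : `|x 0 j| <= `|x|.
Proof.
rewrite (_ : `|x| = mx_norm x)// mx_normrE.
exact: (@le_bigmax_cond _ _ _ 0 (0, j) xpredT (fun ij => `|x ij.1 ij.2|)).
Qed.

Lemma row_norm_lt (x : 'rV[R]_d) e : 0 < e -> (forall j, `|x 0 j| < e) -> `|x| < e.
Proof.
move=> e0 h; rewrite (_ : `|x| = mx_norm x)// mx_normrE; apply/bigmax_ltP; split=> // -[i j] _ /=.
by rewrite ord1.
Qed.

End RowNorm.

(** * Rounding a window of a path to a finite grid *)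

Section Grid.
Context {R : realType} {d : nat}.
Notation path := (int -> 'rV[R]_d).

(** Number of points of mesh 1/(n+1) in [-(n+1), n+1], both ends included. *)
Definition grid_size (n : nat) : nat := (n.+1 * n.+1).*2.+1.

Definition grid (n : nat) (k : 'I_(grid_size n)) : R :=
  ((k : nat)%:R - (n.+1 * n.+1)%:R) / n.+1%:R.

Definition cell (n : nat) (x : R) : {ffun 'I_(grid_size n) -> bool} :=
  [ffun k => grid k <= x].

(** The default value is the leftmost grid point. *)
Definition cell_point (n : nat) (b : {ffun 'I_(grid_size n) -> bool}) : R :=
  \big[Num.max/- n.+1%:R]_(k | b k) grid k.

Lemma cell_pointP n (x : R) : `|x| <= n%:R ->
  `|x - cell_point (cell n x)| <= n.+1%:R^-1.
Proof.
rewrite ler_norml => /andP[xl xh].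
have N0 : 0 < n.+1%:R :> R by rewrite ltr0n.
have nN : n.+1%:R = n%:R + 1 :> R by rewrite natr1.
have n0 : 0 <= n%:R :> R by rewrite ler0n.
have /andP[kl kh] := floor_itv (x * n.+1%:R).
(* The index sought is floor(x (n+1)) translated by (n+1)^2; it is in range because |x| <= n. *)
set k := Num.floor _ in kl kh.
have k1 : 0 <= k + (n.+1 * n.+1)%N%:Z.
  rewrite -(ler_int R) rmorphD/= -pmulrn natrM nN.
  move: kh; rewrite rmorphD/= nN => kh.
  have : - n%:R * (n%:R + 1) <= x * (n%:R + 1) by rewrite ler_wpM2r// addr_ge0.
  by nra.
have k2 : (absz (k + (n.+1 * n.+1)%N%:Z)%R < grid_size n)%N.
  rewrite -(ltr_nat R) natr_absz ger0_norm// rmorphD/= -pmulrn /grid_size -addnn.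
  rewrite -[X in _ < X]natr1 natrD natrM nN.
  have : x * n.+1%:R <= n%:R * (n%:R + 1) by rewrite nN ler_wpM2r// addr_ge0.
  by nra.
have gk : grid (Ordinal k2) = k%:~R / n.+1%:R.
  by rewrite /grid/= natr_absz ger0_norm// rmorphD/= -pmulrn addrK.
have glex : grid (Ordinal k2) <= x by rewrite gk ler_pdivrMr.
rewrite ger0_norm; last first.
  rewrite subr_ge0; apply/bigmax_leP; split; first by rewrite nN; lra.
  by move=> i; rewrite ffunE.
have : grid (Ordinal k2) <= cell_point (cell n x).
  by apply: le_bigmax_cond; rewrite ffunE.
suff : x - n.+1%:R^-1 <= grid (Ordinal k2).
  by move: (cell_point _) (grid _) (n.+1%:R^-1) => p q r'; lra.
rewrite gk ler_pdivlMr// mulrBl mulVf ?gt_eqF// lerBlDr ltW//.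
by move: kh; rewrite rmorphD.
Qed.

(** Rounding the coordinates of a window to a grid exhibits a cylinder function
    of a process as a limit of finite combinations of indicators of product
    events, the only events on which stationarity is assumed. *)
Definition code_type (m n : nat) :=
  {ffun 'I_(m.*2.+1) -> {ffun 'I_d -> {ffun 'I_(grid_size n) -> bool}}}.

Definition code (m n : nat) (y : path) : code_type m n :=
  [ffun i : 'I_(m.*2.+1) => [ffun j : 'I_d => cell n (y ((i : nat)%:Z - m%:Z) 0 j)]].

Definition decode (m n : nat) (c : code_type m n) : path :=
  fun t => \row_j cell_point (c (inord (absz (t + m%:Z))) j).

Lemma decode_codeE m n (y : path) (t : int) : `|t| <= m%:Z ->
  decode (code m n y) t = \row_j cell_point (cell n (y t 0 j)).
Proof.
move=> tm; apply/rowP => j; rewrite !mxE !ffunE inordK; last by lia.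
by congr (cell_point (cell n (y _ 0 j))); lia.
Qed.

Lemma code_expansion m n (f : path -> R) (y : path) :
  f (decode (code m n y)) =
  \sum_(c : code_type m n) ind (code m n y = c) * f (decode c).
Proof.
rewrite (bigD1 (code m n y))//= indT// mul1r big1 ?addr0// => c cy.
by rewrite indF ?mul0r// => yc; rewrite yc eqxx in cy.
Qed.

Lemma cylcont_decode_cvg m (f : path -> R) (y : path) : cylcont_on m f ->
  (fun n => f (decode (code m n y))) @ \oo --> f y.
Proof.
move=> fm; apply/cvgrPdist_lt => e e0.
have [delta d0 h] := fm y _ e0.
(* Finitely many values are rounded, so one bound serves them all once [n] exceeds it. *)
pose B := \sum_(i < m.*2.+1) `|y ((i : nat)%:Z - m%:Z)|.
have yB (t : int) : `|t| <= m%:Z -> `|y t| <= B.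
  move=> tm; have tk : (absz (t + m%:Z)%R < m.*2.+1)%N by lia.
  rewrite /B (bigD1 (Ordinal tk))//= (_ : (absz (t + m%:Z)%R)%:Z - m%:Z = t); last by lia.
  by rewrite lerDl sumr_ge0.
near=> n; apply: h => t tm; rewrite decode_codeE//.
apply: row_norm_lt => // j; rewrite !mxE.
apply: (@le_lt_trans _ _ n.+1%:R^-1).
  apply: cell_pointP; rewrite (le_trans (row_coord_le _ _))// (le_trans (yB _ tm))//.
  by near: n; exact: nbhs_infty_ger.
rewrite invf_plt ?posrE ?ltr0Sn//.
apply: (@lt_le_trans _ _ (delta^-1 + 1)); first by rewrite ltrDl.
by rewrite -natr1 lerD2r; near: n; exact: nbhs_infty_ger.
Unshelve. all: by end_near.
Qed.

End Grid.

(** * Measurability and stationarity for functions in [baire] *)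

Section Process.
Context {R : realType} {d : nat} {dT : measure_display} {T : measurableType dT}.
Notation path := (int -> 'rV[R]_d).
Variables (P : probability T R) (Z : int -> T -> 'rV[R]_d).
Hypothesis mZ : forall t j, measurable_fun setT (fun w => Z t w 0 j).

Definition sample (w : T) : path := fun t => Z t w.

Lemma measurable_forall_fin (I : finType) (A : I -> set T) :
  (forall i, measurable (A i)) -> measurable [set w | forall i, A i w].
Proof.
move=> mA; rewrite (_ : mkset _ = \bigcap_(i in [set: I]) A i).
  by apply: fin_bigcap_measurable.
by apply/seteqP; split=> [w h i _|w h i]; apply: h.
Qed.

Lemma measurable_cell n (b : {ffun 'I_(grid_size n) -> bool}) :
  measurable [set x : R | cell n x = b].
Proof.
pose A (k : 'I_(grid_size n)) := [set x : R | (grid k <= x) = b k].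
rewrite (_ : mkset _ = \bigcap_(k in [set: 'I_(grid_size n)]) A k).
  apply: fin_bigcap_measurable => // k _; rewrite /A; case: (b k).
    rewrite (_ : mkset _ = `[grid k, +oo[%classic) //.
    by apply/seteqP; split=> x /=; rewrite in_itv/= andbT.
  rewrite (_ : mkset _ = `]-oo, grid k[%classic) //.
  by apply/seteqP; split=> x /=; rewrite in_itv/= leNgt; case: (x < _).
apply/seteqP; split=> [x /= hx k _|x h]; first by rewrite /A/= -hx ffunE.
by apply/ffunP => k; rewrite ffunE h.
Qed.

Lemma code_eqE m n (s : int) (c : @code_type d m n) (w : T) :
  code m n (tshift s (sample w)) = c <->
  forall (i : 'I_(m.*2.+1)) (j : 'I_d), [set x | cell n x = c i j]
    (block (fun t => Z t w) (s - m%:Z) m.*2.+1 i j).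
Proof.
split=> [<- i j|h].
  by rewrite /= mxE !ffunE /tshift /sample; congr (cell n (Z _ w 0 j)); lia.
apply/ffunP => i; apply/ffunP => j; rewrite !ffunE -(h i j) mxE /tshift /sample.
by congr (cell n (Z _ w 0 j)); lia.
Qed.

Lemma measurable_code m n s (c : @code_type d m n) :
  measurable [set w | code m n (tshift s (sample w)) = c].
Proof.
rewrite (_ : mkset _ = [set w | forall i j, [set x | cell n x = c i j]
    (block (fun t => Z t w) (s - m%:Z) m.*2.+1 i j)]); last first.
  by apply/seteqP; split=> w /= /code_eqE.
apply: measurable_forall_fin => i; apply: measurable_forall_fin => j.
have := @mZ (s - m%:Z + (i : nat)%:Z) j measurableT _ (measurable_cell (c i j)).
rewrite setTI; congr measurable; apply/seteqP.
by split=> w /=; rewrite mxE.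
Qed.

Lemma bounded_measurable_code m n s (f : path -> R) :
  bounded_measurable (fun w => f (decode (code m n (tshift s (sample w))))).
Proof.
rewrite (_ : (fun _ => _) = fun w => \sum_(c : code_type m n)
    ind (code m n (tshift s (sample w)) = c) * f (decode c)); last first.
  by apply/funext => w; rewrite -code_expansion.
apply: bounded_measurable_sum => c; apply: bounded_measurableM.
  exact/bounded_measurable_ind/measurable_code.
exact: bounded_measurable_cst.
Qed.

Lemma tshift0 (y : path) : tshift 0 y = y.
Proof. by apply/funext => t; rewrite /tshift addr0. Qed.

Lemma measurable_cylcont (f : path -> R) : cylcont f ->
  measurable_fun setT (fun w => f (sample w)).
Proof.
move=> [m fm].
apply: (@measurable_fun_cvg _ _ _ _ (fun n w => f (decode (code m n (sample w))))).
  by move=> n; have [] := bounded_measurable_code m n 0 f; under eq_fun do rewrite tshift0.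
by move=> w _; exact: cylcont_decode_cvg.
Qed.

Lemma measurable_baire (f : path -> R) : baire f ->
  measurable_fun setT (fun w => f (sample w)).
Proof.
elim=> [{}f fc _|f_ {}f C _ ih _ ff]; first exact: measurable_cylcont.
by apply: (measurable_fun_cvg ih) => w _; exact: ff.
Qed.

Lemma bounded_measurable_baire (f : path -> R) : baire f ->
  bounded_measurable (fun w => f (sample w)).
Proof.
move=> bf; split; first exact: measurable_baire.
by have [C fC] := baire_bounded bf; exists C => w.
Qed.

Lemma measurable_bset (A : path -> Prop) : bset A ->
  measurable [set w | A (sample w)].
Proof.
move=> bA; have := measurable_baire bA measurableT (measurable_set1 (1 : R)).
rewrite setTI; congr measurable; apply/seteqP; split=> w /=; last exact: indT.
by have [//|nA] := pselect (A (sample w)); rewrite indF// => /eqP; rewrite eq_sym oner_eq0.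
Qed.

Lemma Ex_bset (A : path -> Prop) : bset A ->
  Ex P (fun w => ind (A (sample w))) = Pr P [set w | A (sample w)].
Proof. by move=> /measurable_bset mA; rewrite -Ex_ind. Qed.

Hypothesis statZ : strictly_stationary P Z.

Lemma Ex_code_stationary m n s (c : @code_type d m n) :
  Ex P (fun w => ind (code m n (tshift s (sample w)) = c)) =
  Ex P (fun w => ind (code m n (sample w) = c)).
Proof.
pose B (i : 'I_(m.*2.+1)) (j : 'I_d) := [set x : R | cell n x = c i j].
have mB i j : measurable (B i j) by exact: measurable_cell.
have E s' : [set w | code m n (tshift s' (sample w)) = c] =
    [set w | forall i j, B i j (block (fun t => Z t w) (s' - m%:Z) m.*2.+1 i j)].
  by apply/seteqP; split=> w /= /code_eqE.
transitivity (Pr P [set w | code m n (tshift s (sample w)) = c]).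
  exact/Ex_ind/measurable_code.
transitivity (Pr P [set w | code m n (tshift 0 (sample w)) = c]); last first.
  rewrite -Ex_ind; last exact: measurable_code.
  by apply: eq_Ex => w /=; rewrite tshift0.
(* [strictly_stationary] compares each block with the one starting at 0, so it is applied to the
   starts [s - m] and [- m]. *)
rewrite /Pr !E; congr fine; etransitivity; first exact: (statZ _ mB).
by apply: esym; exact: (statZ _ mB).
Qed.

Lemma Ex_cylcont_stationary s (f : path -> R) : cylcont f -> bounded_path f ->
  Ex P (fun w => f (tshift s (sample w))) = Ex P (fun w => f (sample w)).
Proof.
move=> [m fm] [C fC].
have lim s' : (fun n => Ex P (fun w => f (decode (code m n (tshift s' (sample w))))))
    @ \oo --> Ex P (fun w => f (tshift s' (sample w))).
  apply: (@Ex_cvg _ _ _ _ _ _ C) => [n|n w|w]; last exact: cylcont_decode_cvg.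
    by have [] := bounded_measurable_code m n s' f.
  exact: fC.
have := lim s; rewrite (_ : (fun n => _) =
  (fun n => Ex P (fun w => f (decode (code m n (tshift 0 (sample w))))))) => [h|].
  rewrite (cvg_unique _ h (lim 0))//.
  by apply: eq_Ex => w; rewrite tshift0.
apply/funext => n.
have bm s' c : bounded_measurable (fun w =>
    ind (code m n (tshift s' (sample w)) = c) * f (decode c)).
  apply: bounded_measurableM; last exact: bounded_measurable_cst.
  exact/bounded_measurable_ind/measurable_code.
have E s' : Ex P (fun w => f (decode (code m n (tshift s' (sample w))))) =
    \sum_(c : code_type m n) f (decode c) *
       Ex P (fun w => ind (code m n (sample w) = c)).
  rewrite (_ : (fun w => _) = fun w => \sum_(c : code_type m n)
    ind (code m n (tshift s' (sample w)) = c) * f (decode c)); last first.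
    by apply/funext => w; rewrite -code_expansion.
  rewrite Ex_sum//; apply: eq_bigr => c _.
  rewrite -(Ex_code_stationary s') -ExZ.
    by apply: eq_Ex => w; rewrite mulrC.
  exact/bounded_measurable_ind/measurable_code.
by rewrite !E.
Qed.

Lemma Ex_stationary s (f : path -> R) : baire f ->
  Ex P (fun w => f (tshift s (sample w))) = Ex P (fun w => f (sample w)).
Proof.
elim=> [{}f fc fb|f_ {}f C bf ih fC ff]; first exact: Ex_cylcont_stationary.
have l1 : (fun n => Ex P (fun w => f_ n (tshift s (sample w)))) @ \oo -->
    Ex P (fun w => f (tshift s (sample w))).
  apply: (@Ex_cvg _ _ _ _ _ _ C) => [n|n w|w]; [|exact: fC|exact: ff].
  by apply: (@measurable_baire (fun y => f_ n (tshift s y)));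
    apply: baire_comp (bf n); exact: local_lipschitz_tshift.
have l2 : (fun n => Ex P (fun w => f_ n (sample w))) @ \oo -->
    Ex P (fun w => f (sample w)).
  apply: (@Ex_cvg _ _ _ _ _ _ C) => [n|n w|w]; [|exact: fC|exact: ff].
  exact: measurable_baire.
have l1' : (fun n => Ex P (fun w => f_ n (tshift s (sample w)))) @ \oo -->
    Ex P (fun w => f (sample w)).
  rewrite (_ : (fun n => _) = (fun n => Ex P (fun w => f_ n (sample w))))//.
  by apply/funext => n; rewrite ih.
exact: (cvg_unique _ l1 l1').
Qed.

End Process.

(** * Regular variation and the tail process *)

Lemma cvg_ext {T : Type} {U : topologicalType} (f g : T -> U) (F : set_system T) (l : U) :
  f =1 g -> f @ F --> l -> g @ F --> l.
Proof. by move=> /funext ->. Qed.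

Lemma continuous_ball_at {R : realType} (U : pseudoMetricType R) (f : U -> R) (x : U) :
  (forall e : R, 0 < e -> exists2 delta : R, 0 < delta &
    forall y, ball x delta y -> `|f x - f y| < e) -> {for x, continuous f}.
Proof.
move=> h; apply/cvgrPdist_lt => e e0; have [delta d0 hd] := h e e0.
by apply/nbhs_ballP; exists delta.
Qed.

(** * Equivalence of norms in finite dimension *)

Section Norm.
Context {R : realType} {d : nat}.
Variable N : 'rV[R]_d -> R.
Hypothesis normN : is_norm N.

Lemma is_norm0 : N 0 = 0.
Proof. by have [_ hZ _] := normN; rewrite -(scale0r 0) hZ normr0 mul0r. Qed.

Lemma is_normN x : N (- x) = N x.
Proof. by have [_ hZ _] := normN; rewrite -scaleN1r hZ normrN1 mul1r. Qed.

Lemma is_normZ c x : 0 <= c -> N (c *: x) = c * N x.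
Proof. by have [_ hZ _] := normN => c0; rewrite hZ ger0_norm. Qed.

Lemma is_norm_ge0 x : 0 <= N x.
Proof.
have [_ _ hD] := normN; have := hD x (- x); rewrite subrr is_norm0 is_normN.
by rewrite -mulr2n pmulrn_lge0.
Qed.

Lemma is_norm_upper : exists2 L : R, 0 < L & forall x, N x <= L * `|x|.
Proof.
have [_ hZ hD] := normN.
pose S := \sum_(j < d) N (delta_mx 0 j).
have S0 : 0 <= S by apply: sumr_ge0 => j _; exact: is_norm_ge0.
exists (S + 1); first by rewrite ltr_wpDl.
move=> x; apply: (@le_trans _ _ (S * `|x|)); last by rewrite ler_wpM2r// lerDl.
rewrite {1}(row_sum_delta x) /S mulr_suml.
have : N (\sum_j x 0 j *: delta_mx 0 j) <= \sum_j N (x 0 j *: delta_mx 0 j).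
  elim/big_ind2: _ => [|a b c e ab ce|//]; first by rewrite is_norm0.
  by rewrite (le_trans (hD _ _))// lerD.
move=> /le_trans; apply; apply: ler_sum => j _.
by rewrite hZ mulrC ler_wpM2l ?is_norm_ge0// row_coord_le.
Qed.

Lemma is_norm_lipschitz : exists L : R, forall x y, `|N x - N y| <= L * `|x - y|.
Proof.
have [_ _ hD] := normN; have [L L0 hL] := is_norm_upper; exists L => x y.
rewrite ler_norml; apply/andP; split.
  have := hD (y - x) x; rewrite subrK => h.
  by have := hL (y - x); rewrite distrC; lra.
have := hD (x - y) y; rewrite subrK => h.
by have := hL (x - y); lra.
Qed.

(** The image of the unit sphere under [N] is compact, hence closed, and omits 0, so it omits a ball
    around 0; homogeneity does the rest. *)
Lemma is_norm_lower : exists2 c : R, 0 < c & forall x, c * `|x| <= N x.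
Proof.
have [h0 hZ hD] := normN; have [L hL] := is_norm_lipschitz.
pose S := [set x : 'rV[R]_d | `|x| = 1].
have Nc : continuous N.
  move=> x; apply: continuous_ball_at => e e0.
  have L0 : 0 < `|L| + 1 by rewrite ltr_wpDl.
  exists (e / (`|L| + 1)); first by rewrite divr_gt0.
  move=> y [eL xy].
  apply: (@le_lt_trans _ _ ((`|L| + 1) * `|x - y|)).
    by rewrite (le_trans (hL _ _))// ler_wpM2r// (le_trans (ler_norm _))// lerDl.
  rewrite mulrC -ltr_pdivlMr//; apply: row_norm_lt => // j.
  by rewrite !mxE; exact: xy.
have Sc : compact S.
  apply: bounded_closed_compact.
    by exists 1; split => // M M1 x /= ->; rewrite ltW.
  rewrite (_ : S = Num.norm @^-1` [set 1])//.
  by apply: closed_comp => [x _|]; [exact: norm_continuous|exact: closed_eq].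
have NSc : compact (N @` S).
  by apply: continuous_compact => //; exact: continuous_subspaceT.
have : open (~` (N @` S)) by rewrite openC; exact: compact_closed NSc.
rewrite openE => /(_ 0); case.
  move=> [x /= x1 /h0 x0]; have : `|x| = 0 by rewrite x0; exact: mx_norm0.
  by rewrite x1 => /eqP; rewrite oner_eq0.
move=> e /= e0 he; exists e => // x.
have [->|x0] := eqVneq x 0; first by rewrite normr0 mulr0 is_norm_ge0.
have nx : 0 < `|x| by rewrite normr_gt0.
have Nx : N (`|x|^-1 *: x) = `|x|^-1 * N x by rewrite hZ ger0_norm// invr_ge0.
rewrite -ler_pdivlMr// mulrC -Nx leNgt; apply/negP => lt.
apply: (he (N (`|x|^-1 *: x))).
  by rewrite /ball_/= sub0r normrN ger0_norm// is_norm_ge0.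
by exists (`|x|^-1 *: x) => //; rewrite /S/= normrZ normfV normr_id mulVf ?gt_eqF.
Qed.

Lemma cylcont_norm t : cylcont (fun y : int -> 'rV[R]_d => N (y t)).
Proof. by have [L hL] := is_norm_lipschitz; exact: cylcont_at hL. Qed.

End Norm.

Section Pinfty.
Context {R : realType}.

Lemma near_pinfty (A : R -> Prop) :
  (\forall x \near +oo, A x) <-> exists M, forall x, M < x -> A x.
Proof. by split=> [[M [_ h]]|[M h]]; exists M; [|split=> //; exact: num_real]. Qed.

Lemma cvg_pinfty_lt (f : R -> R) l e : f @ +oo --> l -> 0 < e ->
  exists M, forall x, M < x -> `|l - f x| < e.
Proof. by move=> /cvgrPdist_lt h /h /near_pinfty. Qed.

Lemma powR_expn (a b : R) n : 0 <= a -> (a ^+ n) `^ b = (a `^ b) ^+ n.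
Proof. by move=> a0; rewrite -powR_mulrn// -powRrM mulrC powRrM powR_mulrn// powR_ge0. Qed.

End Pinfty.

(** * The tail of the norm at time 0 *)

Section RegularVariation.
Context {R : realType} {d : nat} {dX : measure_display} {TX : measurableType dX}.
Context {dY : measure_display} {TY : measurableType dY}.
Notation path := (int -> 'rV[R]_d).
Variables (P : probability TX R) (X : int -> TX -> 'rV[R]_d).
Variables (Q : probability TY R) (Y : int -> TY -> 'rV[R]_d).
Variables (alpha : R) (N : 'rV[R]_d -> R).
Hypothesis mX : forall t j, measurable_fun setT (fun w => X t w 0 j).
Hypothesis statX : strictly_stationary P X.
Hypothesis normN : is_norm N.
Hypothesis rvX : jointly_regvar P X alpha.
Hypothesis tailXY : tail_process P X N Q Y.

Definition tail (M : 'rV[R]_d -> R) (x : R) : R := Pr P [set w | x < M (X 0 w)].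

Lemma measurable_exceed (M : 'rV[R]_d -> R) t x : is_norm M ->
  measurable [set w | x < M (X t w)].
Proof.
move=> nM; apply: (@measurable_bset _ _ _ _ _ mX (fun y => x < M (y t))).
by apply: bset_lt; [exact: cylcont_cst|exact: cylcont_norm].
Qed.

Lemma Pr_le (A B : set TX) : measurable A -> measurable B -> A `<=` B ->
  Pr P A <= Pr P B.
Proof.
move=> mA mB AB; rewrite -!Ex_ind//; apply: Ex_le; try exact: bounded_measurable_ind.
by move=> w; apply: ind_le => /AB.
Qed.

Lemma tail_le M x y : is_norm M -> x <= y -> tail M y <= tail M x.
Proof.
move=> nM xy; apply: Pr_le; try exact: measurable_exceed.
by move=> w /=; exact: le_lt_trans.
Qed.

Lemma tail_ge0 M x : 0 <= tail M x.
Proof. by rewrite /tail /Pr fine_ge0. Qed.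

Lemma Pr_exceed_stationary M t x : is_norm M ->
  Pr P [set w | x < M (X t w)] = tail M x.
Proof.
move=> nM.
have b : baire (fun y : path => ind (x < M (y 0))).
  by apply: bset_lt; [exact: cylcont_cst|exact: cylcont_norm].
have := Ex_stationary mX statX t b; rewrite /tail -!Ex_ind//;
  try exact: measurable_exceed.
by move=> <-; apply: eq_Ex => w; rewrite /tshift/= add0r.
Qed.

Lemma block1 (Z : path) s : block Z s 1 = Z s :> 'rV[R]_d.
Proof. by apply/rowP => j; rewrite mxE addr0. Qed.

(** Regular variation of a single time, tested against the constant 1; [M] is the norm that regular
    variation provides, which may differ from [N]. *)
Lemma tail_regvar : exists2 M, is_norm M & forall u, 0 < u ->
  (fun x => tail M (u * x) / tail M x) @ +oo --> u `^ (- alpha).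
Proof.
have [Nk [nNk [d' [T' [Q' [Th [_ [_ h]]]]]]]] := rvX (ltn0Sn 0).
exists Nk => // u u0.
have h1 : bounded_continuous (fun _ : 'M[R]_(1, d) => 1 : R).
  split; last by exists 1 => x; rewrite normr1.
  by move=> x; apply: continuous_ball_at => e e0; exists 1 => // y _; rewrite subrr normr0.
have := h u u0 _ h1; rewrite Ex_cst mulr1; apply: cvg_ext => x.
have E z : [set w | z < Nk (block (X^~ w) 1 1)] = [set w | z < Nk (X 1 w)].
  by apply/seteqP; split=> w /=; rewrite block1.
rewrite !E Pr_exceed_stationary//; congr (_ / _).
rewrite -(Pr_exceed_stationary 1)// /Pr; congr fine.
by rewrite integral_cst ?mul1e//; exact: measurable_exceed.
Qed.

Lemma tail_gt0 x : 0 < tail N x.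
Proof.
have [M nM h] := tail_regvar.
have [c c0 hc] := is_norm_lower nM; have [L L0 hL] := is_norm_upper nM.
have [c' c'0 hc'] := is_norm_lower normN; have [L' L'0 hL'] := is_norm_upper normN.
have M0 z : 0 < tail M z.
  rewrite lt_neqAle tail_ge0 andbT; apply/eqP => tz.
  have l0 : 0 < 2 `^ (- alpha) :> R by rewrite powR_gt0.
  have [B hB] := cvg_pinfty_lt (h 2 ltac:(lra)) l0.
  pose w := Num.max B z + 1.
  have Bw : B < w.
    by apply: (@le_lt_trans _ _ (Num.max B z)); [rewrite le_max lexx|rewrite /w ltrDl].
  have zw : z <= w.
    by apply: (@le_trans _ _ (Num.max B z)); [rewrite le_max lexx orbT|rewrite /w lerDl].
  have tw : tail M w = 0.
    apply/eqP; rewrite eq_le tail_ge0 andbT.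
    by rewrite (le_trans (tail_le nM zw))// -tz.
  (* With [tail M w = 0] the quotient is 0 by the convention on division by zero, which is too far
     from its limit [2 ^ (- alpha)]. *)
  by have := hB w Bw; rewrite tw invr0 mulr0 subr0 gtr0_norm// ltxx.
have x1 : 0 < Num.max x 0 + 1 by rewrite ltr_wpDl// le_max lexx orbT.
(* As [M <= L |.|] and [c' |.| <= N], exceeding this level by [M] forces [N] above [max x 0 + 1]. *)
apply: (lt_le_trans (M0 (L / c' * (Num.max x 0 + 1)))).
apply: Pr_le; try exact: measurable_exceed.
move=> w /= hw; have := hL (X 0 w); have := hc' (X 0 w).
set v := `|X 0 w| in hw *; move=> h1 h2.
have v1 : Num.max x 0 + 1 < c' * v.
  have := lt_le_trans hw h2; rewrite mulrAC -mulrA ltr_pM2l//.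
  by rewrite mulrC ltr_pdivrMl.
apply: (@lt_le_trans _ _ (c' * v)) => //; apply: lt_trans v1.
by apply: (@le_lt_trans _ _ (Num.max x 0)); [rewrite le_max lexx|rewrite ltrDl].
Qed.

(** Norm equivalence transfers regular variation from [M] to [N] at the price of a factor. What
    matters is that [c] does not depend on [u], so that large powers of a scaling lose no more than
    a single one. *)
Lemma tail_lower_bound : exists2 c : R, 0 < c & forall u, 0 < u ->
  exists B, forall x, B < x -> c * u `^ (- alpha) * tail N x <= tail N (u * x).
Proof.
have [M nM h] := tail_regvar.
have [c c0 hc] := is_norm_lower nM; have [L L0 hL] := is_norm_upper nM.
have [c' c'0 hc'] := is_norm_lower normN; have [L' L'0 hL'] := is_norm_upper normN.
pose a := c / L'; pose b := L / c'.
have a0 : 0 < a by rewrite divr_gt0.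
have b0 : 0 < b by rewrite divr_gt0.
have upper x : tail N x <= tail M (a * x).
  apply: Pr_le; try exact: measurable_exceed.
  move=> w /= xw; apply: lt_le_trans (hc _); rewrite /a mulrAC -mulrA ltr_pM2l//.
  by rewrite mulrC ltr_pdivrMl// (lt_le_trans xw).
have lower x : tail M (b * x) <= tail N x.
  apply: Pr_le; try exact: measurable_exceed.
  move=> w /= xw; have := lt_le_trans xw (hL _).
  rewrite /b mulrAC -mulrA ltr_pM2l// mulrC ltr_pdivrMl// => /lt_le_trans; exact.
(* [b / a] is the loss in passing from [N] to [M] and back; the half absorbs the error of the
   limit. *)
exists ((b / a) `^ (- alpha) / 2).
  by rewrite divr_gt0// powR_gt0// divr_gt0.
move=> u u0.
have k0 : 0 < b * u / a by rewrite !divr_gt0// mulr_gt0.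
have K0 : 0 < (b * u / a) `^ (- alpha) / 2 by rewrite divr_gt0// powR_gt0.
have [B hB] := cvg_pinfty_lt (h _ k0) K0.
exists (B / a) => x Bx; have {}Bx : B < a * x by rewrite mulrC -ltr_pdivrMr.
have := hB _ Bx; rewrite (_ : b * u / a * (a * x) = b * (u * x)); last first.
  by rewrite mulrA divfK ?gt_eqF// mulrA.
rewrite ltr_norml => /andP[_ hlt].
have ratio : (b * u / a) `^ (- alpha) / 2 <= tail M (b * (u * x)) / tail M (a * x).
  by move: hlt; lra.
apply: le_trans (lower _).
have ta : 0 < tail M (a * x) by apply: lt_le_trans (upper _); exact: tail_gt0.
move: ratio; rewrite ler_pdivlMr//; apply: le_trans.
have -> : (b * u / a) `^ (- alpha) = (b / a) `^ (- alpha) * u `^ (- alpha).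
  by rewrite -powRM ?ltW ?divr_gt0// mulrAC.
have w0 : 0 <= (b / a) `^ (- alpha) * u `^ (- alpha) / 2.
  by rewrite divr_ge0// mulr_ge0// powR_ge0.
rewrite (mulrAC ((b / a) `^ (- alpha)) 2^-1); exact: ler_wpM2l.
Qed.

(** Conditional mean of [g] of the path rescaled by [x], given an exceedance of [x] at time 0, with
    numerator taken over the whole space. *)
Definition cond_exp (x : R) (g : path -> R) : R :=
  Ex P (fun w => ind (x < N (X 0 w)) * g (scale x^-1 (sample X w))) / tail N x.

Lemma cond_expE x g :
  cond_exp x g = Ex P (fun w => ind (x < N (X 0 w)) * g (scale x^-1 (sample X w))) / tail N x.
Proof. by []. Qed.

Lemma cond_exp_cvg f : cylcont f -> bounded_path f ->
  (fun x => cond_exp x f) @ +oo --> Ex Q (fun w => f (sample Y w)).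
Proof.
move=> [m fm] [C fC].
(* [ext] reads a matrix as a path on [-m, m] padded with 0, which turns [f] into a function of a
   block. *)
pose ext (M : 'M[R]_(m.*2.+1, d)) : path := fun t =>
  if `|t| <= m%:Z then row (inord (absz (t + m%:Z))) M else 0.
have extE (Z : path) : f (ext (block Z (- m%:Z) m.*2.+1)) = f Z.
  apply: cylcont_on_eq fm _ => t tm; rewrite /ext tm; apply/rowP => j.
  by rewrite !mxE inordK; [congr (Z _ 0 j); lia|lia].
have bc : bounded_continuous (f \o ext).
  split; last by exists C => M; exact: fC.
  move=> M; apply: continuous_ball_at => e e0; have [delta d0 h] := fm (ext M) _ e0.
  exists delta => // M' MM' /=; apply: h => t tm.
  rewrite /ext tm; apply: row_norm_lt => // j; rewrite !mxE.
  by case: MM' => _ /(_ (inord (absz (t + m%:Z))) j).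
have := tailXY (s := - m%:Z) bc.
rewrite (_ : Ex Q _ = Ex Q (fun w => f (sample Y w))); last first.
  by apply: eq_Ex => w /=; rewrite extE.
apply: cvg_ext => x; rewrite condEE /cond_exp; congr (_ / _).
apply: eq_Ex => w /=; congr (_ * _).
rewrite -(extE (scale _ _)); congr (f (ext _)).
by apply/matrixP => i j; rewrite !mxE.
Qed.

End RegularVariation.

(** * A portmanteau theorem for the tail process, and its time change formula *)

Section TailConvergence.
Context {R : realType} {d : nat} {dX : measure_display} {TX : measurableType dX}.
Context {dY : measure_display} {TY : measurableType dY}.
Notation path := (int -> 'rV[R]_d).
Variables (P : probability TX R) (X : int -> TX -> 'rV[R]_d).
Variables (Q : probability TY R) (Y : int -> TY -> 'rV[R]_d).
Variables (alpha : R) (N : 'rV[R]_d -> R).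
Hypothesis mX : forall t j, measurable_fun setT (fun w => X t w 0 j).
Hypothesis mY : forall t j, measurable_fun setT (fun w => Y t w 0 j).
Hypothesis statX : strictly_stationary P X.
Hypothesis alpha_gt0 : 0 < alpha.
Hypothesis normN : is_norm N.
Hypothesis rvX : jointly_regvar P X alpha.
Hypothesis tailXY : tail_process P X N Q Y.

Local Notation tail := (tail P X).
Local Notation cond_exp := (cond_exp P X N).
Local Notation EQ f := (Ex Q (fun w => f (sample Y w))).

Let tailN_gt0 x : 0 < tail N x := tail_gt0 mX statX normN rvX x.

Let mEx t x : measurable [set w | x < N (X t w)] := measurable_exceed mX t x normN.

Lemma cvg_pinfty_le (f : R -> R) l c : f @ +oo --> l ->
  (exists B, forall x, B < x -> f x <= c) -> l <= c.
Proof.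
move=> fl [B hB]; apply/ler_addgt0Pl => e e0.
have [B' hB'] := cvg_pinfty_lt fl e0.
pose x := Num.max B B' + 1.
have xB : B < x by rewrite /x ltr_pwDr// le_max lexx.
have xB' : B' < x by rewrite /x ltr_pwDr// le_max lexx orbT.
have := hB x xB; have := hB' x xB'; rewrite ltr_norml => /andP[_]; lra.
Qed.

Lemma baire_exceed t c : baire (fun y : path => ind (c < N (y t))).
Proof. by apply: bset_lt; [exact: cylcont_cst|exact: cylcont_norm]. Qed.

Lemma baire_scale c (g : path -> R) : baire g -> baire (fun y => g (scale c y)).
Proof. by apply: baire_comp; exact: local_lipschitz_scale. Qed.

Lemma bounded_measurable_cond x (g : path -> R) : baire g -> bounded_measurable
  (fun w => ind (x < N (X 0 w)) * g (scale x^-1 (sample X w))).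
Proof.
move=> bg; apply: (@bounded_measurable_baire _ _ _ _ X mX
  (fun y => ind (x < N (y 0)) * g (scale x^-1 y))).
by apply: baireM; [exact: baire_exceed|exact: baire_scale].
Qed.

Lemma cond_exp_le x (f g : path -> R) : baire f -> baire g ->
  (forall y, f y <= g y) -> cond_exp x f <= cond_exp x g.
Proof.
move=> bf bg fg; rewrite /cond_exp ler_pM2r ?invr_gt0//.
apply: Ex_le; try exact: bounded_measurable_cond.
by move=> w; rewrite ler_wpM2l ?ind_ge0.
Qed.

Lemma cond_expD x (f g : path -> R) : baire f -> baire g ->
  cond_exp x (fun y => f y + g y) = cond_exp x f + cond_exp x g.
Proof.
move=> bf bg; rewrite /cond_exp -mulrDl -ExD; try exact: bounded_measurable_cond.
by congr (_ / _); apply: eq_Ex => w; rewrite mulrDr.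
Qed.

Lemma cond_expB x (f g : path -> R) : baire f -> baire g ->
  cond_exp x (fun y => f y - g y) = cond_exp x f - cond_exp x g.
Proof.
move=> bf bg; rewrite /cond_exp -mulrBl -ExB; try exact: bounded_measurable_cond.
by congr (_ / _); apply: eq_Ex => w; rewrite mulrBr.
Qed.

Lemma cond_expZ x c (f : path -> R) : baire f ->
  cond_exp x (fun y => c * f y) = c * cond_exp x f.
Proof.
move=> bf; rewrite /cond_exp mulrA -ExZ; try exact: bounded_measurable_cond.
by congr (_ / _); apply: eq_Ex => w; rewrite mulrCA.
Qed.

Lemma cond_exp_cst x c : cond_exp x (fun=> c) = c.
Proof.
rewrite /cond_exp; have mA := measurable_exceed mX 0 x normN.
rewrite (_ : Ex P _ = c * Ex P (fun w => ind (x < N (X 0 w)))); last first.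
  rewrite -ExZ; first by apply: eq_Ex => w; rewrite mulrC.
  exact: (bounded_measurable_ind mA).
by rewrite (Ex_ind P mA) mulfK// gt_eqF// tailN_gt0.
Qed.

Lemma EQ_le (f g : path -> R) : baire f -> baire g ->
  (forall y, f y <= g y) -> EQ f <= EQ g.
Proof. by move=> bf bg fg; apply: Ex_le => //; exact: bounded_measurable_baire. Qed.

Lemma baire_cylb (f : path -> R) C : cylcont f -> (forall y, `|f y| <= C) -> baire f.
Proof. by move=> fc fC; apply: baire_cyl => //; exists C. Qed.

(** The ramp [phi] lies between the indicators of exceeding [1 + 2 delta] and [1 + delta], and its
    conditional means have a limit. If the limit were below [u' ^ (- alpha)], each factor [u'] would
    eventually shrink the tail by a fixed ratio [s < s0], and [tail_lower_bound] at [u' ^ n] would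
    bound [(s / s0) ^ n] away from 0. *)
Lemma tail_sharp e : 0 < e -> exists2 delta, 0 < delta &
  exists B, forall x, B < x -> (1 - e) * tail N x <= tail N ((1 + delta) * x).
Proof.
(* With this choice [alpha ln (1 + 2 delta) <= e / 2], hence [s0 >= 1 - e / 2]. *)
move=> e0; pose delta := e / (4 * alpha); have d0 : 0 < delta by rewrite divr_gt0// mulr_gt0.
exists delta => //; pose u' := 1 + 2 * delta; have u'1 : 1 < u' by rewrite ltrDl mulr_gt0.
have u'0 : 0 < u' by apply: lt_trans u'1.
pose s0 := u' `^ (- alpha); have s00 : 0 < s0 by rewrite powR_gt0.
have s0e : 1 - e / 2 <= s0.
  rewrite /s0 /powR gt_eqF//; apply: le_trans (expR_ge1Dx _).
  have lnu : ln u' <= 2 * delta by apply: le_ln1Dx; rewrite (lt_trans _ (mulr_gt0 _ d0)).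
  have : alpha * ln u' <= alpha * (2 * delta) by rewrite ler_pM2l.
  have -> : alpha * (2 * delta) = e / 2 by rewrite /delta; field; rewrite gt_eqF.
  by rewrite mulNr; lra.
pose phi (y : path) := clamp (delta^-1 * (N (y 0) - (1 + delta))).
have phic : cylcont phi.
  apply/cylcont_clamp/cylcontZ/cylcontB; [exact: cylcont_norm|exact: cylcont_cst].
have phi1 y : `|phi y| <= 1 by exact: normr_clamp_le1.
have bphi := baire_cylb phic phi1.
have cvphi : (fun x => cond_exp x phi) @ +oo --> EQ phi.
  by apply: (cond_exp_cvg tailXY) => //; exists 1.
have exceedE c x : 0 < c -> 0 < x ->
    Ex P (fun w => ind (c * x < N (X 0 w))) = tail N (c * x).
  by move=> c0 x0; rewrite Ex_ind//; exact: mEx.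
have scaleN x w : 0 < x -> N (scale x^-1 (sample X w) 0) = N (X 0 w) / x.
  by move=> x0; rewrite /scale is_normZ ?invr_ge0 ?ltW// mulrC.
have upper x : 0 < x -> tail N (u' * x) <= cond_exp x phi * tail N x.
  move=> x0; rewrite /cond_exp divfK ?gt_eqF// -exceedE//.
  apply: Ex_le; first by apply: bounded_measurable_ind; exact: mEx.
    exact: bounded_measurable_cond.
  move=> w; have [h|h] := ltP (u' * x) (N (X 0 w)); last first.
    by rewrite indF// mulr_ge0 ?ind_ge0// clamp_ge0.
  rewrite indT// indT; last by apply: le_lt_trans h; rewrite ler_peMl// ltW.
  rewrite mul1r /phi scaleN// clamp1// mulrC ler_pdivlMr// mul1r.
  rewrite lerBrDr ler_pdivlMr//; apply: le_trans (ltW h).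
  by rewrite ler_pM2r// /u'; lra.
have lower x : 0 < x -> cond_exp x phi * tail N x <= tail N ((1 + delta) * x).
  move=> x0; rewrite /cond_exp divfK ?gt_eqF// -exceedE//; last by rewrite addr_gt0.
  apply: Ex_le; first exact: bounded_measurable_cond.
    by apply: bounded_measurable_ind; exact: mEx.
  move=> w; have [h|h] := ltP ((1 + delta) * x) (N (X 0 w)).
    rewrite (indT (A := true))// -[leRHS]mulr1.
    by rewrite ler_pM ?ind_ge0 ?clamp_ge0 ?ind_le1 ?clamp_le1.
  rewrite /phi scaleN// clamp0 ?mulr0 ?ind_ge0// pmulr_rle0 ?invr_gt0//.
  by rewrite subr_le0 ler_pdivrMr.
have ell : s0 <= EQ phi.
  rewrite leNgt; apply/negP => lt; pose s := (EQ phi + s0) / 2.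
  have phi0 : 0 <= EQ phi by apply: Ex_ge0 => w; exact: clamp_ge0.
  have s_gt : 0 < s - EQ phi by rewrite /s; lra.
  have [B0 hB0] := cvg_pinfty_lt cvphi s_gt.
  have step x : Num.max B0 0 < x -> tail N (u' * x) <= s * tail N x.
    rewrite gt_max => /andP[xB x0]; apply: le_trans (upper x x0) _.
    rewrite ler_pM2r//; have := hB0 x xB; rewrite ltr_norml => /andP[h _]; lra.
  have iter n x : Num.max B0 0 < x -> tail N (u' ^+ n * x) <= s ^+ n * tail N x.
    move=> xB; elim: n => [|n ih]; first by rewrite !expr0 !mul1r.
    rewrite exprS -mulrA; apply: le_trans (step _ _) _; last first.
      by rewrite exprS -mulrA ler_wpM2l// /s; lra.
    apply: (lt_le_trans xB); rewrite ler_peMl//; last exact/exprn_ege1/ltW.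
    by move: xB; rewrite gt_max => /andP[_ /ltW].
  have [c c0 hc] := tail_lower_bound mX statX normN rvX.
  have cn n : c <= (s / s0) ^+ n.
    have [B hB] := hc _ (exprn_gt0 n u'0).
    pose x := Num.max B (Num.max B0 0) + 1.
    have xB : B < x by rewrite /x ltr_pwDr// le_max lexx.
    have xB0 : Num.max B0 0 < x by rewrite /x ltr_pwDr// le_max lexx orbT.
    have := le_trans (hB x xB) (iter n x xB0).
    rewrite ler_pM2r// powR_expn ?(ltW u'0)// -/s0 => h.
    by rewrite expr_div_n ler_pdivlMr// exprn_gt0.
  have q1 : `|s / s0| < 1.
    rewrite ger0_norm ?divr_ge0 ?(ltW s00)//; last by rewrite /s; lra.
    by rewrite ltr_pdivrMr// mul1r /s; lra.
  have := cvg_expr q1 => /cvgrPdist_lt /(_ c c0) [n _ /(_ n (leqnn n))] /=.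
  rewrite sub0r normrN ger0_norm; last by apply: le_trans (cn n); exact: ltW.
  by rewrite ltNge cn.
have [B hB] := cvg_pinfty_lt cvphi (divr_gt0 e0 (ltr0n _ 2 : 0 < 2)).
exists (Num.max B 0) => x; rewrite gt_max => /andP[xB x0].
apply: le_trans (lower x x0); rewrite ler_pM2r//.
by have := hB x xB; rewrite ltr_norml => /andP[_ h]; lra.
Qed.

(** [g] is squeezed, up to small mean error under the tail process, between
    bounded continuous functions of finitely many coordinates; this plays the
    role of Riemann integrability in the portmanteau theorem. *)
Definition jordan (C : R) (g : path -> R) : Prop :=
  [/\ baire g, forall y, `|g y| <= C &
  forall e, 0 < e -> exists f h, [/\ cylcont f, forall y, `|f y| <= C, cylcont h,
    bounded_path h & (forall y, `|g y - f y| <= h y) /\ EQ h <= e]].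

Lemma jordan_cvg C g : jordan C g -> (fun x => cond_exp x g) @ +oo --> EQ g.
Proof.
move=> [bg gC hg]; apply/cvgrPdist_lt => e e0.
(* The four quarters: the limit errors of [f] and of [h], and [EQ h] twice, once under the tail
   process and once inside the bound on [cond_exp x h]. *)
have e4 : 0 < e / 4 by rewrite divr_gt0.
have [f [h [fc fC hc hb [gfh hE]]]] := hg _ e4.
have bf := baire_cylb fc fC; have bh := baire_cyl hc hb.
have [B1 hB1] := cvg_pinfty_lt (cond_exp_cvg tailXY fc (ex_intro _ C fC)) e4.
have [B2 hB2] := cvg_pinfty_lt (cond_exp_cvg tailXY hc hb) e4.
(* Stated for any monotone functional compatible with differences, to serve for both [cond_exp x]
   and [EQ]. *)
have close (E : (path -> R) -> R) :
    (forall u v, baire u -> baire v -> E (fun y => u y - v y) = E u - E v) ->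
    (forall u v, baire u -> baire v -> (forall y, u y <= v y) -> E u <= E v) ->
    `|E g - E f| <= E h.
  move=> EB Ele; rewrite ler_norml; apply/andP; split.
    rewrite lerNl opprB -EB//; apply: Ele => //; first exact: baireB.
    by move=> y; rewrite (le_trans (ler_norm _))// distrC.
  rewrite -EB//; apply: Ele => //; first exact: baireB.
  by move=> y; rewrite (le_trans (ler_norm _)).
apply/near_pinfty; exists (Num.max B1 B2) => x; rewrite gt_max => /andP[x1 x2].
have c1 := close (cond_exp x) (fun u v => @cond_expB x u v) (fun u v => @cond_exp_le x u v).
have c2 : `|EQ g - EQ f| <= EQ h.
  apply: (close (fun f => EQ f)) => [u v bu bv|]; last exact: EQ_le.
  by rewrite -ExB//; exact: bounded_measurable_baire.
have := hB1 x x1; have := hB2 x x2; rewrite !ltr_norml => /andP[h1 h2] /andP[h3 h4].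
move: c1 c2; rewrite !ler_norml => /andP[c1 c1'] /andP[c2 c2'].
by apply/andP; split; lra.
Qed.

Lemma jordan_cyl C f : cylcont f -> (forall y, `|f y| <= C) -> jordan C f.
Proof.
move=> fc fC; split=> //; first exact: baire_cylb fC.
move=> e e0; exists f, (fun=> 0); split=> //; first exact: cylcont_cst.
  by exists 0 => y; rewrite normr0.
by split=> [y|]; [rewrite subrr normr0|rewrite Ex_cst ltW].
Qed.

Lemma jordanM C C' g g' : 0 <= C -> 0 <= C' -> jordan C g -> jordan C' g' ->
  jordan (C * C') (fun y => g y * g' y).
Proof.
move=> C0 C'0 [bg gC hg] [bg' gC' hg']; split; first exact: baireM.
  by move=> y; rewrite normrM ler_pM.
move=> e e0.
(* The added 1 covers a bound equal to 0. *)
have K0 : 0 < 2 * (C + 1) by rewrite mulr_gt0// ltr_wpDl.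
have K'0 : 0 < 2 * (C' + 1) by rewrite mulr_gt0// ltr_wpDl.
have [f [h [fc fC hc hb [gfh hE]]]] := hg _ (divr_gt0 e0 K'0).
have [f' [h' [fc' fC' hc' hb' [gfh' hE']]]] := hg' _ (divr_gt0 e0 K0).
have bh := bounded_measurable_baire mY (baire_cyl hc hb).
have bh' := bounded_measurable_baire mY (baire_cyl hc' hb').
exists (fun y => f y * f' y), (fun y => C * h' y + C' * h y); split.
- exact: cylcontM.
- by move=> y; rewrite normrM ler_pM.
- by apply: cylcontD; exact: cylcontZ.
- have [D hD] := hb; have [D' hD'] := hb'; exists (C * D' + C' * D) => y.
  by rewrite (le_trans (ler_normD _ _))// !normrM (ger0_norm C0) (ger0_norm C'0) lerD// ler_wpM2l.
- split=> [y|].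
    have -> : g y * g' y - f y * f' y = g y * (g' y - f' y) + (g y - f y) * f' y.
      by ring.
    rewrite (le_trans (ler_normD _ _))// !normrM lerD//; first by rewrite ler_pM.
    by rewrite mulrC ler_pM.
  rewrite ExD; try (apply: bounded_measurableM => //; exact: bounded_measurable_cst).
  rewrite !ExZ//.
  have h1 : C * EQ h' <= C * (e / (2 * (C + 1))) by rewrite ler_wpM2l.
  have h2 : C' * EQ h <= C' * (e / (2 * (C' + 1))) by rewrite ler_wpM2l.
  have k1 c : 0 <= c -> c * (e / (2 * (c + 1))) <= e / 2.
    move=> c0; have c1 : 0 < c + 1 by rewrite ltr_wpDl.
    have -> : c * (e / (2 * (c + 1))) = (c / (c + 1)) * (e / 2).
      by field; rewrite gt_eqF.
    by rewrite ger_pMl ?divr_gt0// ler_pdivrMr// mul1r lerDl.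
  by have := k1 _ C0; have := k1 _ C'0; lra.
Qed.

(** Forgetting the exceedance at 0 and moving time [t] to 0 by stationarity bounds the mass near
    level 1 by a difference of tails. It is small relative to [tail N ((1 - delta) * x)] by
    [tail_sharp], hence relative to [tail N x] by [tail_lower_bound] at 2. *)
Lemma exceed_band t e : 0 < e -> exists2 delta, 0 < delta &
  EQ (fun y => clamp (delta^-1 * (N (y t) - (1 - delta))) -
               clamp (delta^-1 * (N (y t) - (1 + delta)))) <= e.
Proof.
move=> e0; have [c c0 hc] := tail_lower_bound mX statX normN rvX.
have [Bc hBc] := hc 2 ltac:(lra); set k := c * 2 `^ (- alpha) in hBc.
have k0 : 0 < k by rewrite mulr_gt0// powR_gt0.
have [d0 d00 [B hB]] := tail_sharp (mulr_gt0 e0 k0).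
(* The first bound puts [(1 - delta) x] above [x / 2]; the second amounts to
   [1 + 2 delta <= (1 + d0) (1 - delta)]. *)
pose delta := Num.min (2^-1) (d0 / (3 + d0)).
have D0 : 0 < delta by rewrite lt_min invr_gt0 divr_gt0//= ?ltr0n// addr_gt0.
have D1 : delta <= 2^-1 by rewrite ge_min lexx.
have D2 : delta * (3 + d0) <= d0.
  by rewrite -ler_pdivlMr ?addr_gt0// ge_min lexx orbT.
exists delta => //.
pose h (y : path) := clamp (delta^-1 * (N (y t) - (1 - delta))) -
               clamp (delta^-1 * (N (y t) - (1 + delta))).
rewrite (_ : Ex Q _ = EQ h)//.
have hcyl : cylcont h.
  by apply: cylcontB; apply/cylcont_clamp/cylcontZ/cylcontB;
    [exact: cylcont_norm|exact: cylcont_cst|exact: cylcont_norm|exact: cylcont_cst].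
have hb : bounded_path h.
  exists 2 => y; rewrite (le_trans (ler_normB _ _))//.
  by have := normr_clamp_le1 (delta^-1 * (N (y t) - (1 - delta)));
     have := normr_clamp_le1 (delta^-1 * (N (y t) - (1 + delta))); lra.
apply: (cvg_pinfty_le (cond_exp_cvg tailXY hcyl hb)).
exists (Num.max 0 (2 * Num.max (Num.max B Bc) 0)) => x; rewrite gt_max => /andP[x0 xB].
have xB1 : Num.max (Num.max B Bc) 0 < x / 2 by rewrite ltr_pdivlMr// mulrC.
move: xB1; rewrite !gt_max => /andP[/andP[xB1 xBc] _].
have xB2 : B < (1 - delta) * x.
  by apply: (lt_le_trans xB1); rewrite mulrC ler_pM2r//; lra.
have mE z : measurable [set w | z < N (X t w)] by exact: mEx.
have le1 : cond_exp x h * tail N x <=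
    tail N ((1 - delta) * x) - tail N ((1 + 2 * delta) * x).
  rewrite /cond_exp divfK ?gt_eqF//.
  rewrite -!(Pr_exceed_stationary mX statX t)// -!Ex_ind// -ExB;
    try exact: bounded_measurable_ind.
  apply: Ex_le; first exact/bounded_measurable_cond/baire_cyl.
    by apply: bounded_measurableB; exact: bounded_measurable_ind.
  move=> w /=; rewrite /h /scale /sample is_normZ ?invr_ge0 ?(ltW x0)//.
  set z := N (X t w).
  have d1 : (1 - delta) * x <= (1 + 2 * delta) * x by rewrite ler_pM2r//; lra.
  have [z1|z1] := pselect ((1 - delta) * x < z); last first.
    have z1' : z <= (1 - delta) * x by rewrite leNgt; apply/negP.
    have z2 : x^-1 * z <= 1 - delta by rewrite mulrC ler_pdivrMr.
    have h2 : ~ ((1 + 2 * delta) * x < z).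
      by apply/negP; rewrite -leNgt (le_trans z1').
    have c1 : clamp (delta^-1 * (x^-1 * z - (1 - delta))) = 0.
      by apply: clamp0; rewrite pmulr_rle0 ?invr_gt0//; lra.
    have c2 : clamp (delta^-1 * (x^-1 * z - (1 + delta))) = 0.
      by apply: clamp0; rewrite pmulr_rle0 ?invr_gt0//; lra.
    by rewrite (indF z1) (indF h2) c1 c2 subrr mulr0.
  rewrite (indT z1).
  have [z2|z2] := pselect ((1 + 2 * delta) * x < z); last first.
    rewrite (indF z2) subr0 -[leRHS]mulr1 ler_pM ?ind_ge0 ?ind_le1//.
      rewrite subr_ge0 /clamp le_min ge_min lexx/= ge_min; apply/orP; right.
      rewrite ge_max !le_max lexx/=; apply/orP; right; rewrite ler_pM2l ?invr_gt0//; lra.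
    by rewrite lerBlDr (le_trans (clamp_le1 _))// lerDl clamp_ge0.
  have z3 : 1 + 2 * delta <= x^-1 * z by rewrite (mulrC x^-1) ler_pdivlMr// ltW.
  rewrite (indT z2) !clamp1 ?subrr ?mulr0//.
    by rewrite mulrC ler_pdivlMr// mul1r; lra.
  by rewrite mulrC ler_pdivlMr// mul1r; lra.
have t1 : tail N ((1 - delta) * x) <= tail N (x / 2).
  by apply: tail_le => //; rewrite mulrC ler_pM2r//; lra.
have t2 : k * tail N (x / 2) <= tail N x.
  by have := hBc _ xBc; rewrite (_ : 2 * (x / 2) = x)//; field.
have t3 : (1 - e * k) * tail N ((1 - delta) * x) <= tail N ((1 + 2 * delta) * x).
  apply: le_trans (hB _ xB2) _; apply: tail_le => //.
  by rewrite mulrA ler_pM2r//; nra.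
rewrite -(ler_pM2r (tailN_gt0 x)); apply: le_trans le1 _.
have t4 : e * k * tail N ((1 - delta) * x) <= e * (k * tail N (x / 2)).
  by rewrite -mulrA ler_pM2l// ler_pM2l.
have t5 : e * (k * tail N (x / 2)) <= e * tail N x by rewrite ler_pM2l.
by move: t3; rewrite mulrBl mul1r; lra.
Qed.

(** A ramp starting at level 1 differs from the indicator only in the band of [exceed_band]: in
    effect the event is a continuity set of the tail process. *)
Lemma jordan_exceed t : jordan 1 (fun y => ind (1 < N (y t))).
Proof.
split; [exact: baire_exceed|by move=> y; exact: normr_ind_le1|move=> e e0].
have [delta d0 hd] := exceed_band t e0.
pose f (y : path) := clamp (delta^-1 * (N (y t) - 1)).
pose h (y : path) := clamp (delta^-1 * (N (y t) - (1 - delta))) -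
               clamp (delta^-1 * (N (y t) - (1 + delta))).
exists f, h; split.
- by apply/cylcont_clamp/cylcontZ/cylcontB; [exact: cylcont_norm|exact: cylcont_cst].
- by move=> y; exact: normr_clamp_le1.
- by apply: cylcontB; apply/cylcont_clamp/cylcontZ/cylcontB;
    [exact: cylcont_norm|exact: cylcont_cst|exact: cylcont_norm|exact: cylcont_cst].
- exists 2 => y; rewrite (le_trans (ler_normB _ _))//.
  by have := normr_clamp_le1 (delta^-1 * (N (y t) - (1 - delta)));
     have := normr_clamp_le1 (delta^-1 * (N (y t) - (1 + delta))); lra.
- split=> // y; rewrite /f /h; set z := N (y t).
  have [z1|z1] := leP z 1.
    rewrite (indF (A := false))// [X in `|_ - X|]clamp0 ?subrr ?normr0; last first.
      by rewrite pmulr_rle0 ?invr_gt0//; lra.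
    rewrite [X in _ - X]clamp0 ?subr0 ?clamp_ge0//.
    by rewrite pmulr_rle0 ?invr_gt0//; lra.
  rewrite (indT (A := true))// [X in _ <= X - _]clamp1; last first.
    by rewrite mulrC ler_pdivlMr// mul1r; lra.
  rewrite ger0_norm ?subr_ge0 ?clamp_le1// lerD2l lerN2.
  rewrite /clamp le_min ge_min lexx/= ge_min; apply/orP; right.
  by rewrite ge_max !le_max lexx/=; apply/orP; right; rewrite ler_pM2l ?invr_gt0//; lra.
Qed.

Lemma jordan_not_exceed t : jordan 1 (fun y => ind (N (y t) <= 1)).
Proof.
have E y : ind (N (y t) <= 1) = 1 - ind (1 < N (y t)) :> R.
  by rewrite -ind_not; apply: ind_eq; rewrite leNgt; split=> /negP.
have [b1 _ h1] := jordan_exceed t; split.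
- rewrite (_ : (fun _ => _) = fun y => 1 - ind (1 < N (y t))); last exact/funext.
  by apply: baireB => //; exact: baire_cst.
- by move=> y; exact: normr_ind_le1.
move=> e /h1[f [h [fc f1 hc hb [fh hE]]]].
(* [f] may be negative; clamping it keeps the bound 1 for the complement. *)
exists (fun y => 1 - clamp (f y)), h; split=> //.
- by apply: cylcontB; [exact: cylcont_cst|exact: cylcont_clamp].
- by move=> y; rewrite ger0_norm ?subr_ge0 ?clamp_le1// lerBlDr lerDl clamp_ge0.
- split=> // y; rewrite E opprB addrC addrA subrK distrC.
  apply: le_trans (fh y); apply: le_trans (clamp_lipschitz _ _).
  rewrite (_ : clamp (ind _) = ind (1 < N (y t)))//.
  by have [h'|h'] := pselect (1 < N (y t)); [rewrite indT// clamp1|rewrite indF// clamp0].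
Qed.

(** For positive [x] the conditional means are exactly 1, the event being the conditioning event
    itself. *)
Lemma tail_process_exceed0 : EQ (fun y => ind (1 < N (y 0))) = 1.
Proof.
have := jordan_cvg (jordan_exceed 0).
move=> h.
suff h1 : (fun x => cond_exp x (fun y => ind (1 < N (y 0)))) @ +oo --> (1 : R).
  exact: (cvg_unique _ h h1).
apply: cvg_near_cst; apply/near_pinfty; exists 0 => x x0.
rewrite -[RHS](cond_exp_cst x) /cond_exp; congr (_ / _).
apply: eq_Ex => w; rewrite /scale is_normZ ?invr_ge0 ?ltW// mulr1.
rewrite -ind_and; apply: ind_eq; rewrite mulrC ltr_pdivlMr// mul1r.
by split=> [[]|].
Qed.

(** Before the limit the left side carries exceedances at times 0 and [s], which stationarity moves
    to [- s] and 0: the conditioning event and the indicator trade places. Both limits exist because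
    [jordan_exceed] admits the indicator as a factor. *)
Lemma time_change s (f : path -> R) : baire f ->
  EQ (fun y => f y * ind (1 < N (y s))) =
  EQ (fun y => f (tshift (- s) y) * ind (1 < N (y (- s)))).
Proof.
elim=> [{}f fc [C fC]|f_ {}f C bf ih fC ff]; last first.
  have cv (S : path -> path) t : local_lipschitz S ->
    (fun n => EQ (fun y => f_ n (S y) * ind (1 < N (y t)))) @ \oo -->
    EQ (fun y => f (S y) * ind (1 < N (y t))).
    move=> SL; apply: (@Ex_cvg _ _ _ _ _ _ C) => [n|n w|w].
    - apply: (measurable_baire mY (f := fun y => f_ n (S y) * ind (1 < N (y t)))).
      by apply: baireM; [exact: baire_comp|exact: baire_exceed].
    - by rewrite normrM -[leRHS]mulr1 ler_pM// normr_ind_le1.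
    - by apply: cvgM; [exact: ff|exact: cvg_cst].
  have idL : local_lipschitz (@id path).
    by move=> m; exists m, 1; split=> // y z e e0 yz t tm; rewrite mul1r yz.
  have h1 := cv _ s idL; have h2 := cv _ (- s) (@local_lipschitz_tshift R d (- s)).
  have h3 := cvg_ext (fun n => esym (ih n)) h2.
  exact: (cvg_unique _ h1 h3).
have C0 : 0 <= C by apply: le_trans (fC (fun=> 0)).
have j1 := jordanM C0 ler01 (jordan_cyl fc fC) (jordan_exceed s).
have fc' : cylcont (fun y => f (tshift (- s) y)).
  by apply: cylcont_comp => //; exact: local_lipschitz_tshift.
have j2 := jordanM C0 ler01 (jordan_cyl fc' (fun y => fC (tshift (- s) y)))
  (jordan_exceed (- s)).
suff E : {near +oo, (fun x => cond_exp x (fun y => f (tshift (- s) y) * ind (1 < N (y (- s))))) =1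
    (fun x => cond_exp x (fun y => f y * ind (1 < N (y s))))}.
  have h : (fun x => cond_exp x (fun y => f y * ind (1 < N (y s)))) @ +oo -->
      EQ (fun y => f (tshift (- s) y) * ind (1 < N (y (- s)))).
    by apply: cvg_trans (jordan_cvg j2); exact: near_eq_cvg.
  exact: (cvg_unique _ (jordan_cvg j1) h).
apply/near_pinfty; exists 0 => x x0; rewrite /cond_exp; congr (_ / _).
pose G (y : path) := ind (x < N (y 0)) *
  (f (scale x^-1 y) * ind (1 < N (scale x^-1 y s))).
have bG : baire G.
  apply: baireM; first exact: baire_exceed.
  apply: (@baire_scale _ (fun y => f y * ind (1 < N (y s)))).
  by apply: baireM; [exact: baire_cylb fC|exact: baire_exceed].
rewrite -[RHS](Ex_stationary mX statX (- s) bG); apply: eq_Ex => w.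
have E t : ind (1 < N (scale x^-1 (sample X w) t)) = ind (x < N (X t w)) :> R.
  apply: ind_eq; rewrite /scale is_normZ ?invr_ge0 ?ltW//.
  by rewrite mulrC ltr_pdivlMr// mul1r.
rewrite /G E.
rewrite (_ : ind (1 < N (scale x^-1 (tshift (- s) (sample X w)) s)) =
  ind (x < N (X 0 w))); last first.
  by rewrite -(E 0) /scale /tshift subrr.
rewrite (_ : tshift (- s) (sample X w) 0 = X (- s) w); last by rewrite /tshift add0r.
rewrite (_ : scale _ (tshift _ _) = tshift (- s) (scale x^-1 (sample X w)))//.
by ring.
Qed.

End TailConvergence.

(** * Vanishing paths and anchors *)

Section VanishingPaths.
Context {R : realType} {d : nat}.
Notation path := (int -> 'rV[R]_d).
Variable N : 'rV[R]_d -> R.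
Hypothesis normN : is_norm N.

Definition vanishing (y : path) : Prop := forall e : R, 0 < e ->
  exists T : nat, forall t : int, T%:Z <= `|t| -> N (y t) < e.

Lemma bset_vanishing : bset vanishing.
Proof.
apply: (@bset_iff _ _ (fun y => forall k : nat, exists T : nat, forall t : int,
    T%:Z <= `|t| -> N (y t) < k.+1%:R^-1)).
  move=> y; split=> [h e e0|h k]; last by apply: h; rewrite invr_gt0.
  have [k _ /(_ k (leqnn k)) hk] := nbhs_infty_ger e^-1.
  have [T hT] := h k; exists T => t tT; apply: lt_le_trans (hT t tT) _.
  rewrite invf_ple ?posrE ?ltr0Sn//; apply: le_trans hk _.
  by rewrite ler_nat.
apply: bset_forall => k; apply: bset_exists => T; apply: bset_forall_int => t.
apply: bset_imp; first exact: bset_cst.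
by apply: bset_lt; [exact: cylcont_norm|exact: cylcont_cst].
Qed.

Lemma vanishing_window l h y : vanishing (window l h y).
Proof.
move=> e e0; exists (`|l| + `|h|).+1%N => t tT; rewrite /window ifF ?is_norm0//.
by apply/negP => /andP[h1 h2]; lia.
Qed.

Lemma vanishing_tshift s y : vanishing y -> vanishing (tshift s y).
Proof.
move=> vy e /vy[T hT]; exists (T + `|s|)%N => t tT; apply: hT; lia.
Qed.

Lemma vanishing_rev y : vanishing y -> vanishing (fun t => y (- t)).
Proof. by move=> vy e /vy[T hT]; exists T => t tT; apply: hT; rewrite normrN. Qed.

Lemma window_close y e : vanishing y -> 0 < e -> exists m : nat,
  forall l h : int, l <= - m%:Z -> m%:Z <= h ->
  forall t, `|y t - window l h y t| <= e.
Proof.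
move=> vy e0; have [c c0 hc] := is_norm_lower normN.
have [m hm] := vy _ (mulr_gt0 c0 e0); exists m => l h lm mh t.
rewrite /window; case: ifPn => [_|]; first by rewrite subrr normr0 ltW.
rewrite subr0 => lth; rewrite -(ler_pM2l c0) (le_trans (hc _))// ltW// hm//.
by move: lth; rewrite negb_and -!ltNge => /orP[]; lia.
Qed.

(** Continuity for the uniform distance on vanishing paths, in which the point measure of a path
    depends continuously on the path. *)
Definition vanishing_continuous (Phi : path -> R) : Prop :=
  forall y, vanishing y -> forall e, 0 < e -> exists2 delta : R, 0 < delta &
    forall z, vanishing z -> (forall t, `|y t - z t| <= delta) ->
      `|Phi y - Phi z| < e.

(** A truncated path vanishes, and the uniform distance of two truncations involves finitely many
    times. *)
Lemma cylcont_window (Phi : path -> R) l h : vanishing_continuous Phi ->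
  cylcont (fun y => Phi (window l h y)).
Proof.
move=> Phic; exists (`|l| + `|h|)%N => y e e0.
have [delta d0 hd] := Phic _ (vanishing_window l h y) _ e0.
exists delta => // z yz; apply: hd; first exact: vanishing_window.
move=> t; rewrite /window; case: ifPn => [/andP[lt th]|_]; last first.
  by rewrite subrr normr0 ltW.
by apply/ltW/yz; lia.
Qed.

Lemma window_cvg (Phi : path -> R) y : vanishing_continuous Phi -> vanishing y ->
  (fun m : nat => Phi (window (- m%:Z) m%:Z y)) @ \oo --> Phi y.
Proof.
move=> Phic vy; apply/cvgrPdist_lt => e e0.
have [delta d0 hd] := Phic y vy e e0.
have [m0 hm] := window_close vy d0.
exists m0 => // m /= m0m; apply: hd; first exact: vanishing_window.
by apply: hm; lia.
Qed.

(** Truncations converge to a path uniformly only if it vanishes, hence the factor. *)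
Lemma baire_vanishing (Phi : path -> R) C : vanishing_continuous Phi ->
  (forall y, vanishing y -> `|Phi y| <= C) -> baire (fun y => Phi y * ind (vanishing y)).
Proof.
move=> Phic PhiC.
apply: (@baire_lim _ _ (fun m y => Phi (window (- m%:Z) m%:Z y) * ind (vanishing y)) _ C).
- move=> m; apply: baireM; last exact: bset_vanishing.
  apply: baire_cyl; first exact: cylcont_window.
  by exists C => y; apply/PhiC/vanishing_window.
- move=> m y; rewrite normrM -[leRHS]mulr1 ler_pM// ?normr_ind_le1//.
  exact/PhiC/vanishing_window.
- move=> y; have [vy|vy] := pselect (vanishing y); last first.
    by rewrite (indF vy) mulr0; apply: cvg_near_cst; apply: nearW => m; rewrite mulr0.
  by rewrite (indT vy); apply: cvgMl; exact: window_cvg.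
Qed.

Section Regularization.
Variables (Phi : path -> R) (C : R).
Hypothesis Phic : vanishing_continuous Phi.
Hypothesis PhiC : forall y, `|Phi y| <= C.

Let costs (k : R) (y : path) : set R := [set v | exists z e,
  [/\ vanishing z, 0 <= e, forall t, `|y t - z t| <= e & v = Phi z + k * e]].

(** Pasch-Hausdorff regularization: the greatest [k]-Lipschitz minorant of
    [Phi] for the uniform distance on vanishing paths. *)
Definition regularize (k : R) (y : path) : R := inf (costs k y).

Let costs_self k y : vanishing y -> costs k y (Phi y).
Proof.
move=> vy; exists y, 0; split=> //; last by rewrite mulr0 addr0.
by move=> t; rewrite subrr normr0.
Qed.

Let Phi_ge y : - C <= Phi y.
Proof. by have := PhiC y; rewrite ler_norml => /andP[]. Qed.

Let costs_lb k y : 0 <= k -> lbound (costs k y) (- C).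
Proof.
move=> k0 v [z [e [vz e0 _ ->]]]; rewrite -[leLHS]addr0 lerD//.
by rewrite mulr_ge0.
Qed.

Lemma regularize_le k y : 0 <= k -> vanishing y -> regularize k y <= Phi y.
Proof.
move=> k0 vy; apply: ge_inf; last exact: costs_self.
by exists (- C); exact: costs_lb.
Qed.

Lemma regularize_ge k y : 0 <= k -> vanishing y -> - C <= regularize k y.
Proof.
move=> k0 vy; apply: lb_le_inf; first by exists (Phi y); exact: costs_self.
exact: costs_lb.
Qed.

Lemma normr_regularize k y : 0 <= k -> vanishing y -> `|regularize k y| <= C.
Proof.
move=> k0 vy; rewrite ler_norml regularize_ge//=.
by rewrite (le_trans (regularize_le k0 vy))// (le_trans (ler_norm _)).
Qed.

(** A competitor for [y] is one for [z] at the additional cost [k e]. The resulting modulus of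
    continuity is uniform over vanishing paths, which that of [Phi] need not be. *)
Lemma regularize_lipschitz k y z e : 0 <= k -> vanishing y -> vanishing z ->
  0 <= e -> (forall t, `|y t - z t| <= e) ->
  regularize k z <= regularize k y + k * e.
Proof.
move=> k0 vy vz e0 yz; rewrite -lerBlDr.
apply: lb_le_inf; first by exists (Phi y); exact: costs_self.
move=> v [z' [e' [vz' e'0 yz' ->]]]; rewrite lerBlDr -addrA -mulrDr.
apply: ge_inf; first by exists (- C); exact: costs_lb.
exists z', (e' + e); split=> //; first by rewrite addr_ge0.
move=> t; rewrite (_ : z t - z' t = (y t - z' t) - (y t - z t)).
  by rewrite (le_trans (ler_normB _ _))// lerD.
by rewrite opprB addrACA [- z' t + _]addrC addrACA subrr add0r [LHS]addrC addrC.
Qed.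

Lemma regularize_continuous k : 0 <= k -> vanishing_continuous (regularize k).
Proof.
move=> k0 y vy e e0; have k1 : 0 < k + 1 by rewrite ltr_wpDl.
exists (e / (k + 1)); first by rewrite divr_gt0.
move=> z vz yz; have h0 : 0 <= e / (k + 1) by rewrite divr_ge0 ?ltW.
have h1 := regularize_lipschitz k0 vy vz h0 yz.
have h2 : regularize k y <= regularize k z + k * (e / (k + 1)).
  by apply: regularize_lipschitz => // t; rewrite distrC.
have h3 : k * (e / (k + 1)) < e.
  by rewrite mulrA ltr_pdivrMr// mulrC ltr_pM2l// ltrDl.
by rewrite ltr_norml; apply/andP; split; lra.
Qed.

(** Competitors beyond distance [delta] are too costly once the slope reaches [2 C / delta]; nearer
    ones are controlled by the continuity of [Phi] at [y]. *)
Lemma regularize_cvg y : vanishing y ->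
  (fun n : nat => regularize n%:R y) @ \oo --> Phi y.
Proof.
move=> vy; apply/cvgrPdist_le => e e0.
have [delta d0 hd] := Phic vy e0.
near=> n; have n0 : 0 <= n%:R :> R by [].
rewrite ger0_norm ?subr_ge0 ?regularize_le//.
rewrite lerBlDr addrC -lerBlDr.
apply: lb_le_inf; first by exists (Phi y); exact: costs_self.
move=> v [z [e' [vz e'0 yz ->]]].
have [lt|ge] := leP e' delta.
  have := hd z vz (fun t => le_trans (yz t) lt); rewrite ltr_norml => /andP[_ h].
  have : 0 <= n%:R * e' by rewrite mulr_ge0.
  by lra.
have h1 : 2 * C / delta <= n%:R by near: n; exact: nbhs_infty_ger.
have h2 : 2 * C <= n%:R * e'.
  move: h1; rewrite ler_pdivrMr// => /le_trans; apply.
  by rewrite ler_wpM2l// ltW.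
have h3 := Phi_ge z; have : Phi y <= C by rewrite (le_trans (ler_norm _)).
by lra.
Unshelve. all: by end_near.
Qed.

End Regularization.

(** [A (tshift s y)] means that the rule [A] selects time [s] of the path [y]. *)
Definition anchor (A : path -> Prop) : Prop :=
  [/\ bset A, forall y, A y -> vanishing y /\ 1 < N (y 0),
     forall y s s', A (tshift s y) -> A (tshift s' y) -> s = s' &
     forall y, vanishing y -> 1 < N (y 0) -> exists s, A (tshift s y)].

Definition first_exceed (y : path) : Prop :=
  [/\ vanishing y, 1 < N (y 0) & forall t : int, t < 0 -> N (y t) <= 1].
Definition last_exceed (y : path) : Prop :=
  [/\ vanishing y, 1 < N (y 0) & forall t : int, 0 < t -> N (y t) <= 1].
Definition first_max (y : path) : Prop :=
  [/\ vanishing y, 1 < N (y 0), forall t : int, t < 0 -> N (y t) < N (y 0) &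
    forall t : int, N (y t) <= N (y 0)].

Let bset_v1 : bset (fun y => vanishing y /\ 1 < N (y 0)).
Proof.
apply: bset_and; first exact: bset_vanishing.
by apply: bset_lt; [exact: cylcont_cst|exact: cylcont_norm].
Qed.

Let bset_le_int (p : int -> bool) : bset (fun y => forall t, p t -> N (y t) <= 1).
Proof.
apply: bset_forall_int => t; apply: bset_imp; first exact: bset_cst.
by apply: bset_le; [exact: cylcont_norm|exact: cylcont_cst].
Qed.

Let first_exceed_exists y : vanishing y -> 1 < N (y 0) ->
  exists s, first_exceed (tshift s y).
Proof.
move=> vy y0; have [T hT] := vy 1 ltr01.
(* Exceedances occur only where |t| < T, so the search may start at [- T]; the offset [T] is time
   0. *)
have ex : exists n : nat, 1 < N (y (n%:Z - T%:Z)) by exists T; rewrite subrr.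
exists ((ex_minn ex)%:Z - T%:Z); case: ex_minnP => n hn nmin.
split; [exact: vanishing_tshift|by rewrite /tshift add0r|move=> t t0].
rewrite /tshift leNgt; apply/negP => h.
have [tT|tT] := leP (T%:Z) `|t + (n%:Z - T%:Z)|.
  by have := hT _ tT; lra.
have := nmin (absz (t + n%:Z)); rewrite (_ : (absz _)%:Z - T%:Z = t + (n%:Z - T%:Z)).
  by move=> /(_ h); lia.
by lia.
Qed.

Lemma anchor_first_exceed : anchor first_exceed.
Proof.
split.
- apply: (bset_iff _ (bset_and bset_v1 (bset_le_int (fun t => t < 0)))) => y.
  by split=> [[[? ?] ?]|[]].
- by move=> y [].
- have H y s s' : s < s' -> first_exceed (tshift s y) -> ~ first_exceed (tshift s' y).
    move=> ss' [_ h1 _] [_ _ /(_ (s - s'))]; rewrite subr_lt0 => /(_ ss').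
    by move: h1; rewrite /tshift add0r subrK; lra.
  move=> y s s' h h'; have [lt|lt|//] := ltgtP s s'.
    by case: (H _ _ _ lt h h').
  by case: (H _ _ _ lt h' h).
- exact: first_exceed_exists.
Qed.

Lemma anchor_last_exceed : anchor last_exceed.
Proof.
split.
- apply: (bset_iff _ (bset_and bset_v1 (bset_le_int (fun t => 0 < t)))) => y.
  by split=> [[[? ?] ?]|[]].
- by move=> y [].
- have H y s s' : s < s' -> last_exceed (tshift s y) -> ~ last_exceed (tshift s' y).
    move=> ss' [_ _ /(_ (s' - s))]; rewrite subr_gt0 => /(_ ss') h1 [_ h2 _].
    by move: h1 h2; rewrite /tshift add0r subrK; lra.
  move=> y s s' h h'; have [lt|lt|//] := ltgtP s s'.
    by case: (H _ _ _ lt h h').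
  by case: (H _ _ _ lt h' h).
- move=> y vy y0.
  (* The last exceedance is the first one of the reversed path. *)
  have y0' : 1 < N ((fun t => y (- t)) 0) by rewrite /= oppr0.
  have [s [_ h1 h2]] := first_exceed_exists (vanishing_rev vy) y0'.
  exists (- s); split; [exact: vanishing_tshift| |move=> t t0].
    by move: h1; rewrite /tshift !add0r.
  have := h2 (- t); rewrite oppr_lt0 => /(_ t0).
  by rewrite /tshift opprD opprK.
Qed.

Lemma anchor_first_max : anchor first_max.
Proof.
split.
- have b1 : bset (fun y : path => forall t : int, t < 0 -> N (y t) < N (y 0)).
    apply: bset_forall_int => t; apply: bset_imp; first exact: bset_cst.
    by apply: bset_lt; exact: cylcont_norm.
  have b2 : bset (fun y : path => forall t : int, N (y t) <= N (y 0)).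
    by apply: bset_forall_int => t; apply: bset_le; exact: cylcont_norm.
  apply: (bset_iff _ (bset_and bset_v1 (bset_and b1 b2))) => y.
  by split=> [[[? ?] []]|[]].
- by move=> y [].
- have H y s s' : s < s' -> first_max (tshift s y) -> ~ first_max (tshift s' y).
    move=> ss' [_ _ _ /(_ (s' - s)) h1] [_ _ /(_ (s - s'))].
    by rewrite subr_lt0 => /(_ ss') h2 _; move: h1 h2; rewrite /tshift !add0r !subrK; lra.
  move=> y s s' h h'; have [lt|lt|//] := ltgtP s s'.
    by case: (H _ _ _ lt h h').
  by case: (H _ _ _ lt h' h).
- move=> y vy y0; have [T hT] := vy 1 ltr01.
  (* The maximum over [-T, T] is global, as the values from [T] on are below 1 and [N (y 0)] is
     above. *)
  pose F (i : 'I_(T.*2.+1)) := N (y ((i : nat)%:Z - T%:Z)).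
  have T0 : (T < T.*2.+1)%N by lia.
  case: (@Order.TotalTheory.arg_maxP _ _ _ (Ordinal T0) xpredT F isT) => i _ imax.
  have le_i t : N (y t) <= F i.
    have [tT|tT] := leP (T%:Z) `|t|.
      apply: le_trans (ltW (hT _ tT)) _; apply: le_trans (ltW y0) _.
      by have := imax (Ordinal T0) isT; rewrite /F/= subrr.
    have tk : (absz (t + T%:Z)%R < T.*2.+1)%N by lia.
    have := imax (Ordinal tk) isT; rewrite /F/=.
    by rewrite (_ : (absz (t + T%:Z)%R)%:Z - T%:Z = t)//; lia.
  have ex : exists n : nat, N (y (n%:Z - T%:Z)) == F i by exists i; rewrite /F.
  exists ((ex_minn ex)%:Z - T%:Z); case: ex_minnP => n /eqP hn nmin.
  have Fi1 : 1 < F i by rewrite (lt_le_trans y0).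
  split; [exact: vanishing_tshift|by rewrite /tshift add0r hn| |].
    move=> t t0; rewrite /tshift add0r hn lt_neqAle le_i andbT; apply/negP => h.
    have [tT|tT] := leP (T%:Z) `|t + (n%:Z - T%:Z)|.
      by have := hT _ tT; rewrite (eqP h); lra.
    have := nmin (absz (t + n%:Z)); rewrite (_ : (absz _)%:Z - T%:Z = t + (n%:Z - T%:Z)).
      by move=> /(_ h); lia.
    by lia.
  by move=> t; rewrite /tshift add0r hn.
Qed.

End VanishingPaths.

(** * Mass transport between anchors *)

Section AnchorExchange.
Context {R : realType} {d : nat} {dX : measure_display} {TX : measurableType dX}.
Context {dY : measure_display} {TY : measurableType dY}.
Notation path := (int -> 'rV[R]_d).
Variables (P : probability TX R) (X : int -> TX -> 'rV[R]_d).
Variables (Q : probability TY R) (Y : int -> TY -> 'rV[R]_d).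
Variables (alpha : R) (N : 'rV[R]_d -> R).
Hypothesis mX : forall t j, measurable_fun setT (fun w => X t w 0 j).
Hypothesis mY : forall t j, measurable_fun setT (fun w => Y t w 0 j).
Hypothesis statX : strictly_stationary P X.
Hypothesis alpha_gt0 : 0 < alpha.
Hypothesis normN : is_norm N.
Hypothesis rvX : jointly_regvar P X alpha.
Hypothesis tailXY : tail_process P X N Q Y.
Local Notation EQ f := (Ex Q (fun w => f (sample Y w))).
Hypothesis tail_vanishing : EQ (fun y => ind (vanishing N y)) = 1.

Let TC := time_change mX mY statX alpha_gt0 normN rvX tailXY.

(** Counts the times of [-n, n] selected by [A]: at most one for an anchor, and exactly one for
    large [n] if the path vanishes and exceeds at 0. *)
Definition hits (A : path -> Prop) (n : nat) (y : path) : R :=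
  \sum_(i < n.*2.+1) ind (A (tshift ((i : nat)%:Z - n%:Z) y)).

Let bm f : baire f -> bounded_measurable (fun w => f (sample Y w)).
Proof. exact: bounded_measurable_baire. Qed.

Let baire_hit A s : anchor N A -> baire (fun y => ind (A (tshift s y))).
Proof. by move=> [bA _ _ _]; exact: (baire_comp (@local_lipschitz_tshift R d s) bA). Qed.

Let hits_ind A n y : anchor N A ->
  hits A n y = ind (exists i : 'I_(n.*2.+1), A (tshift ((i : nat)%:Z - n%:Z) y)).
Proof.
move=> [_ _ uA _]; rewrite /hits.
have [[i hi]|h] := pselect (exists i : 'I_(n.*2.+1), A (tshift ((i : nat)%:Z - n%:Z) y)).
  rewrite (indT (ex_intro _ i hi)) (bigD1 i)//= indT// big1 ?addr0// => j /eqP ji.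
  rewrite indF// => hj; apply: ji; apply/val_inj => /=.
  by have := uA _ _ _ hi hj; lia.
by rewrite (indF h) big1// => i _; rewrite indF// => hi; apply: h; exists i.
Qed.

Let hits_cvg A y : anchor N A -> vanishing N y -> 1 < N (y 0) ->
  hits A ^~ y @ \oo --> (1 : R).
Proof.
move=> hA vy y0; have [_ _ _ /(_ y vy y0) [s hs]] := hA.
apply: cvg_near_cst; exists (`|s|)%N => // n /= sn; rewrite hits_ind// indT//.
have k : (absz (s + n%:Z)%R < n.*2.+1)%N by lia.
by exists (Ordinal k) => /=; rewrite (_ : _ - _ = s)//; lia.
Qed.

Let hits_norm A n y : anchor N A -> `|hits A n y| <= 1.
Proof. by move=> hA; rewrite hits_ind// normr_ind_le1. Qed.

Let baire_hits A n : anchor N A -> baire (hits A n).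
Proof.
move=> hA; rewrite /hits; elim: (index_enum _) => [|i s ih].
  rewrite (_ : (fun y => _) = fun=> 0); first exact: baire_cst.
  by apply/funext => y; rewrite big_nil.
rewrite (_ : (fun y => _) = fun y => ind (A (tshift ((i : nat)%:Z - n%:Z) y)) +
  \sum_(i <- s) ind (A (tshift ((i : nat)%:Z - n%:Z) y))); last first.
  by apply/funext => y; rewrite big_cons.
by apply: baireD => //; exact: baire_hit.
Qed.

(** Selection of [s] by [B] implies the exceedance at [s] that [time_change] asks for; after the
    shift, selection of [- s] by [A] implies the one at [- s]. *)
Let exchange_one (G : path -> R) A B s : baire G ->
  (forall s y, G (tshift s y) = G y) -> anchor N A -> anchor N B ->
  EQ (fun y => G y * ind (A y) * ind (B (tshift s y))) =
  EQ (fun y => G y * ind (B y) * ind (A (tshift (- s) y))).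
Proof.
move=> bG Gs hA hB; have [bA A1 _ _] := hA; have [bB B1 _ _] := hB.
pose f y := G y * ind (A y) * ind (B (tshift s y)).
have bf : baire f.
  by apply: baireM; [exact: baireM|exact: baire_hit].
have := TC s bf; rewrite (_ : (fun w => f _ * _) = (fun w => f (sample Y w))); last first.
  apply/funext => w; rewrite /f.
  have [h|h] := pselect (B (tshift s (sample Y w))); last by rewrite (indF h) !mulr0 mul0r.
  have [_] := B1 _ h; rewrite {1}/tshift add0r => h1.
  by rewrite (indT h1) mulr1.
move=> ->; apply: eq_Ex => w; rewrite /f Gs.
rewrite (_ : tshift s (tshift (- s) (sample Y w)) = sample Y w); last first.
  by apply/funext => t; rewrite /tshift addrK.
have [h|h] := pselect (A (tshift (- s) (sample Y w))); last first.
  by rewrite (indF h) !mulr0 !mul0r.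
have [_] := A1 _ h; rewrite {1}/tshift add0r => h1.
by rewrite (indT h1) mulr1 mulrAC.
Qed.

(** A mass transport argument: the weight of the paths where [A] selects 0 is distributed according
    to the time selected by [B], and each piece equals one with the two rules exchanged. *)
Lemma anchor_exchange (G : path -> R) A B : baire G ->
  (forall s y, G (tshift s y) = G y) -> anchor N A -> anchor N B ->
  EQ (fun y => G y * ind (A y)) = EQ (fun y => G y * ind (B y)).
Proof.
move=> bG Gs hA hB.
have lim A' B' : anchor N A' -> anchor N B' ->
    (fun n => EQ (fun y => G y * ind (A' y) * hits B' n y)) @ \oo -->
    EQ (fun y => G y * ind (A' y)).
  move=> hA' hB'; have [bA' A1 _ _] := hA'; have [C GC] := baire_bounded bG.
  apply: (@Ex_cvg _ _ _ _ _ _ C) => [n|n w|w].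
  - have [] // : bounded_measurable (fun w =>
      (fun y => G y * ind (A' y) * hits B' n y) (sample Y w)).
    apply: (bm (f := fun y => G y * ind (A' y) * hits B' n y)).
    by apply: baireM; [exact: baireM|exact: baire_hits].
  - rewrite -mulrA normrM -[leRHS]mulr1 ler_pM// normrM.
    by rewrite -[leRHS]mulr1 ler_pM ?normr_ind_le1 ?hits_norm.
  - have [h|h] := pselect (A' (sample Y w)); last first.
      by rewrite (indF h) mulr0; apply: cvg_near_cst; apply: nearW => n; rewrite mul0r.
    have [v h1] := A1 _ h.
    by rewrite -[X in _ --> X]mulr1; apply: cvgMr; exact: hits_cvg.
have expand A' B' n : anchor N A' -> anchor N B' ->
    EQ (fun y => G y * ind (A' y) * hits B' n y) =
    \sum_(i < n.*2.+1) EQ (fun y =>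
       G y * ind (A' y) * ind (B' (tshift ((i : nat)%:Z - n%:Z) y))).
  move=> hA' hB'; have [bA' _ _ _] := hA'; rewrite -Ex_sum.
    by apply: eq_Ex => w; rewrite /hits mulr_sumr.
  move=> i; apply: (bm (f := fun y =>
    G y * ind (A' y) * ind (B' (tshift ((i : nat)%:Z - n%:Z) y)))).
  by apply: baireM; [exact: baireM|exact: baire_hit].
suff E n : EQ (fun y => G y * ind (B y) * hits A n y) =
    EQ (fun y => G y * ind (A y) * hits B n y).
  exact: (cvg_unique _ (lim A B hA hB) (cvg_ext E (lim B A hB hA))).
(* The exchange turns [s] into [- s], so one of the sums over [-n, n] is reversed. *)
rewrite !expand// [RHS](reindex_inj rev_ord_inj)/=; apply: eq_bigr => i _.
rewrite [LHS](exchange_one _ bG Gs hB hA); apply: eq_Ex => w.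
have -> // : (n.*2.+1 - i.+1)%N%:Z - n%:Z = - ((i : nat)%:Z - n%:Z).
by have := ltn_ord i; lia.
Qed.

(** If selection of 0 had probability 0, so would, by [time_change], selection of any [s] together
    with an exceedance at 0. These events cover the vanishing paths exceeding at 0, which have
    probability 1. *)
Lemma anchor_gt0 A : anchor N A -> 0 < EQ (fun y => ind (A y)).
Proof.
move=> hA; have [bA A1 _ _] := hA.
rewrite lt_neqAle Ex_ge0 ?andbT; last by move=> w; exact: ind_ge0.
apply/eqP => A0.
have b1 : baire (fun y : path => ind (1 < N (y 0))) by exact: baire_exceed.
have bv := bset_vanishing normN.
have hit0 s : EQ (fun y => ind (1 < N (y 0)) * ind (A (tshift s y))) = 0.
  apply/eqP; rewrite eq_le Ex_ge0 ?andbT; last by move=> w; rewrite mulr_ge0 ?ind_ge0.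
  pose f (y : path) : R := ind (1 < N (y 0)) * ind (A (tshift s y)).
  have bf : baire f by apply: baireM => //; exact: baire_hit.
  have := TC s bf; rewrite (_ : (fun w => f _ * _) = (fun w => f (sample Y w))); last first.
    apply/funext => w; rewrite /f.
    have [h|h] := pselect (A (tshift s (sample Y w))); last by rewrite (indF h) mulr0 mul0r.
    have [_] := A1 _ h; rewrite {1}/tshift add0r => h1.
    by rewrite (indT h1) mulr1.
  rewrite /f => ->; rewrite A0; apply: Ex_le.
  - apply: (bm (f := fun y => f (tshift (- s) y) * ind (1 < N (y (- s))))).
    by apply: baireM; [apply: baire_comp bf; exact: local_lipschitz_tshift|exact: baire_exceed].
  - exact: (bm (f := fun y => ind (A y))).
  - move=> w; rewrite (_ : tshift s (tshift (- s) (sample Y w)) = sample Y w); last first.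
      by apply/funext => t; rewrite /tshift addrK.
    by rewrite mulrAC ler_piMl ?ind_ge0// mulr_ile1 ?ind_ge0 ?ind_le1.
have lim : (fun n => EQ (fun y => ind (1 < N (y 0)) * ind (vanishing N y) * hits A n y))
    @ \oo --> EQ (fun y => ind (1 < N (y 0)) * ind (vanishing N y)).
  apply: (@Ex_cvg _ _ _ _ _ _ 1) => [n|n w|w].
  - have [] // : bounded_measurable (fun w => (fun y =>
       ind (1 < N (y 0)) * ind (vanishing N y) * hits A n y) (sample Y w)).
    apply: (bm (f := fun y => ind (1 < N (y 0)) * ind (vanishing N y) * hits A n y)).
    by apply: baireM; [exact: baireM|exact: baire_hits].
  - rewrite !normrM -[leRHS]mulr1 ler_pM ?mulr_ge0 ?hits_norm//.
    by rewrite -[leRHS]mulr1 ler_pM ?normr_ind_le1.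
  - have [h|h] := pselect (1 < N (sample Y w 0)); last first.
      by rewrite (indF h) mul0r; apply: cvg_near_cst; apply: nearW => n; rewrite mul0r.
    have [v|v] := pselect (vanishing N (sample Y w)); last first.
      by rewrite (indF v) mulr0; apply: cvg_near_cst; apply: nearW => n; rewrite mul0r.
    by rewrite -[X in _ --> X]mulr1; apply: cvgMr; exact: hits_cvg.
have z n : EQ (fun y => ind (1 < N (y 0)) * ind (vanishing N y) * hits A n y) = 0.
  transitivity (\sum_(i < n.*2.+1) EQ (fun y =>
     ind (1 < N (y 0)) * ind (A (tshift ((i : nat)%:Z - n%:Z) y)))).
    rewrite -Ex_sum; last first.
      move=> i; apply: (bm (f := fun y => ind (1 < N (y 0)) *
        ind (A (tshift ((i : nat)%:Z - n%:Z) y)))).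
      by apply: baireM => //; exact: baire_hit.
    apply: eq_Ex => w; rewrite /hits -mulrA !mulr_sumr; apply: eq_bigr => i _.
    have [h|h] := pselect (A (tshift ((i : nat)%:Z - n%:Z) (sample Y w))); last first.
      by rewrite (indF h) !mulr0.
    rewrite (@indT _ (vanishing _ _)) ?mul1r//.
    have [v _] := A1 _ h; have := vanishing_tshift (- ((i : nat)%:Z - n%:Z)) v.
    by congr (vanishing N _); apply/funext => t; rewrite /tshift subrK.
  by rewrite big1// => i _; exact: hit0.
have lim0 : (fun n => EQ (fun y => ind (1 < N (y 0)) * ind (vanishing N y) * hits A n y))
    @ \oo --> (0 : R).
  by apply: cvg_ext (fun n => esym (z n)) _; exact: cvg_cst.
have e1 : EQ (fun y => ind (1 < N (y 0)) * ind (vanishing N y)) = 0.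
  exact: (cvg_unique _ lim lim0).
have e2 := tail_process_exceed0 mX mY statX alpha_gt0 normN rvX tailXY.
have bmv := bm bv; have bm1 := bm b1.
(* Two events of probability 1 intersect with probability 1, by [p + q - 1 <= p q] on [0, 1]. *)
have : EQ (fun y => ind (1 < N (y 0)) + ind (vanishing N y) - 1) <=
    EQ (fun y => ind (1 < N (y 0)) * ind (vanishing N y)).
  apply: Ex_le.
  - by apply: bounded_measurableB; [exact: bounded_measurableD|exact: bounded_measurable_cst].
  - exact: bounded_measurableM.
  - move=> w; have := @ind_le1 R (1 < N (sample Y w 0)).
    have := @ind_le1 R (vanishing N (sample Y w)).
    by move: (ind _) (ind _) => p q hp hq; nra.
rewrite e1 ExB ?ExD ?Ex_cst ?e2 ?tail_vanishing//; first lra.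
  exact: bounded_measurableD.
exact: bounded_measurable_cst.
Qed.

End AnchorExchange.

(** * Anticlustering and clusters *)

Section Averages.
Context {R : realType}.

(** Boundedness makes the real-valued upper limit the infimum of the suprema of the tails, one of
    which is then below [c]. *)
Lemma limn_sup_lt_near (v : nat -> R) (c : R) : (forall n, 0 <= v n <= 1) ->
  limn_sup v < c -> \forall n \near \oo, v n < c.
Proof.
move=> v01; have bv : bounded_fun v.
  exists 1; split; first exact: num_real.
  by move=> x x1 n _ /=; have /andP[v0 v1] := v01 n; rewrite ger0_norm// (le_trans v1)// ltW.
rewrite limn_supE// => h.
have hi : has_inf (range (sups v)).
  split; first by exists (sups v 0%N); exists 0%N.
  exists 0 => _ [n _ <-]; have /andP[v0 _] := v01 n; apply: le_trans v0 _.
  by apply: ub_le_sup; [exists 1 => _ [k _ <-]; have /andP[] := v01 k|exists n => /=].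
have e0 : 0 < c - inf (range (sups v)) by rewrite subr_gt0.
have [_ [n _ <-]] := inf_adherent e0 hi; rewrite addrC subrK => hn.
exists n => // k /= nk; apply: le_lt_trans hn.
by apply: ub_le_sup; [exists 1 => _ [j _ <-]; have /andP[] := v01 j|exists k].
Qed.

Lemma sum_small m r : \sum_(i < r) ((i < m)%N%:R : R) <= m%:R.
Proof.
elim: r => [|r ih]; first by rewrite big_ord0.
rewrite big_ord_recr/=; case: (ltnP r m) => h; last by rewrite addr0.
rewrite (le_trans (lerD (_ : _ <= r%:R) (lexx _)))//; last first.
  by rewrite natr1 ler_nat.
rewrite (le_trans (ler_sum _ (fun i _ => (_ : _ <= 1 :> R))))//.
  by move=> i _; case: ltnP.
by rewrite sumr_const card_ord.
Qed.

(** Only the first and last [m] terms may be far from [L], and together they weigh at most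
    [2 m B / r]. *)
Lemma average_close (c : nat -> R) (L B e : R) (m r : nat) : (0 < r)%N -> 0 <= B ->
  (forall i, (i < r)%N -> `|c i - L| <= B) ->
  (forall i, (m <= i)%N -> (m + i < r)%N -> `|c i - L| <= e) -> 0 <= e ->
  `|(\sum_(i < r) c i) / r%:R - L| <= e + B * (2 * m%:R) / r%:R.
Proof.
move=> r0 B0 hB he e0; have r0' : 0 < r%:R :> R by rewrite ltr0n.
have -> : (\sum_(i < r) c i) / r%:R - L = (\sum_(i < r) (c i - L)) / r%:R.
  rewrite sumrB sumr_const card_ord mulrBl; congr (_ - _).
  by rewrite -[L *+ r]mulr_natr mulfK// gt_eqF.
rewrite normrM normfV (ger0_norm (ltW r0')).
have -> : e + B * (2 * m%:R) / r%:R = (e * r%:R + B * (2 * m%:R)) / r%:R.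
  by rewrite [RHS]mulrDl mulfK// gt_eqF.
rewrite ler_pM2r ?invr_gt0// (le_trans (ler_norm_sum _ _ _))//.
apply: (@le_trans _ _ (\sum_(i < r) (e + B * ((i < m)%N%:R + ((rev_ord i : nat) < m)%N%:R)))).
  apply: ler_sum => i _; have [im|im] := ltnP i m.
    apply: le_trans (hB i (ltn_ord i)) _; rewrite -[leLHS]add0r lerD//.
    by rewrite -[leLHS]mulr1 ler_wpM2l// lerDl.
  have [rm|rm] := ltnP (rev_ord i) m.
    apply: le_trans (hB i (ltn_ord i)) _; rewrite -[leLHS]add0r lerD//.
    by rewrite add0r mulr1.
  rewrite addr0 mulr0 addr0; apply: he => //; move: rm => /=; have := ltn_ord i; lia.
rewrite big_split/= sumr_const card_ord mulr_natr lerD2l -mulr_sumr ler_wpM2l//.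
rewrite big_split/= mulrDl mul1r lerD ?sum_small//.
rewrite (reindex_inj rev_ord_inj)/= (le_trans _ (sum_small m r))//.
by apply: ler_sum => i _; rewrite (_ : (r - (r - i.+1).+1)%N = i)//; have := ltn_ord i; lia.
Qed.

End Averages.

(** * Anticlustering and the decay of the tail process *)

Section Anticlustering.
Context {R : realType} {d : nat} {dX : measure_display} {TX : measurableType dX}.
Context {dY : measure_display} {TY : measurableType dY}.
Notation path := (int -> 'rV[R]_d).
Variables (P : probability TX R) (X : int -> TX -> 'rV[R]_d).
Variables (Q : probability TY R) (Y : int -> TY -> 'rV[R]_d).
Variables (alpha : R) (N : 'rV[R]_d -> R).
Hypothesis mX : forall t j, measurable_fun setT (fun w => X t w 0 j).
Hypothesis mY : forall t j, measurable_fun setT (fun w => Y t w 0 j).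
Hypothesis statX : strictly_stationary P X.
Hypothesis alpha_gt0 : 0 < alpha.
Hypothesis normN : is_norm N.
Hypothesis rvX : jointly_regvar P X alpha.
Hypothesis tailXY : tail_process P X N Q Y.
Variables (a : nat -> R) (r : nat -> nat).
Hypothesis a_gt0 : forall n, 0 < a n.
Hypothesis a_tail : (fun n => n%:R * Pr P [set w | a n < N (X 0 w)]) @ \oo --> (1 : R).
Hypothesis r_cvg : (fun n => (r n)%:R : R) @ \oo --> +oo.
Hypothesis anticluster : forall u : R, 0 < u ->
  (fun m : nat => limn_sup (fun n =>
     condPr P [set w | exists t : int, m%:Z <= `|t| <= (r n)%:Z /\ a n * u < N (X t w)]
              [set w | a n * u < N (X 0 w)])) @ \oo --> (0 : R).

Local Notation tail := (tail P X).
Local Notation cond_exp := (cond_exp P X N).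
Local Notation EQ f := (Ex Q (fun w => f (sample Y w))).
Local Notation vanishing := (vanishing N).

Let tailN_gt0 x : 0 < tail N x := tail_gt0 mX statX normN rvX x.
Let mEx t x : measurable [set w | x < N (X t w)] := measurable_exceed mX t x normN.
Let ce_le x f g := @cond_exp_le _ _ _ _ P X alpha N mX statX normN rvX x f g.
Let bm f : baire f -> bounded_measurable (fun w => f (sample Y w)).
Proof. exact: bounded_measurable_baire. Qed.

(** The levels tend to infinity: where [a n <= B / u] the tail at [a n] is at least [p > 0], while
    [n] times that tail stays below 2. *)
Lemma near_level u (A : R -> Prop) : 0 < u -> (exists B, forall x, B < x -> A x) ->
  \forall n \near \oo, A (a n * u).
Proof.
move=> u0 [B hB]; pose p := tail N (B / u); have p0 : 0 < p by exact: tailN_gt0.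
have h1 : \forall n \near \oo, n%:R * tail N (a n) < 2.
  move/cvgrPdist_lt : a_tail => /(_ 1 ltr01); apply: filterS => n.
  by rewrite ltr_norml /tail => /andP[]; lra.
near=> n; apply: hB; rewrite -ltr_pdivrMr// ltNge; apply/negP => le.
have : p <= tail N (a n) by exact: tail_le.
have : n%:R * tail N (a n) < 2 by near: n.
have : 2 / p < n%:R by near: n; exact: nbhs_infty_gtr.
rewrite ltr_pdivrMr// => k1 k2 k3.
have n0 : 0 <= n%:R :> R by [].
by have := ler_wpM2l n0 k3; lra.
Unshelve. all: by end_near.
Qed.

Lemma cvg_level u (f : R -> R) (l : R) : 0 < u -> f @ +oo --> l ->
  (fun n => f (a n * u)) @ \oo --> l.
Proof.
move=> u0 fl; apply/cvgrPdist_lt => e e0.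
by apply: (near_level (A := fun x => `|l - f x| < e)) => //; exact: cvg_pinfty_lt.
Qed.

Lemma near_r (m : nat) : \forall n \near \oo, (m <= r n)%N.
Proof.
have /cvgryPge /(_ m%:R) := r_cvg; apply: filterS => n.
by rewrite ler_nat.
Qed.

Definition far (m k : nat) (e : R) (y : path) : Prop :=
  exists t : int, m%:Z <= `|t| <= k%:Z /\ e < N (y t).

Lemma bset_far m k e : bset (far m k e).
Proof.
apply: (@bset_iff _ _ (fun y => ~ forall t : int, m%:Z <= `|t| <= k%:Z -> ~ e < N (y t))).
  move=> y; split=> [/existsNP[t /not_implyP[h1 /contrapT h2]]|[t [h1 h2]] /(_ t h1)].
    by exists t.
  exact.
apply/bset_not/bset_forall_int => t; apply: bset_imp; first exact: bset_cst.
by apply: bset_not; apply: bset_lt; [exact: cylcont_cst|exact: cylcont_norm].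
Qed.

(** Anticlustering is used at the lower level [u e], whose conditioning event contains the one at
    level [u]; [tail_lower_bound] at [1 / e] pays for the change of denominator. *)
Lemma far_small u e eta : 0 < u -> 0 < e <= 1 -> 0 < eta ->
  exists m0, forall m, (m0 <= m)%N -> \forall n \near \oo,
    cond_exp (a n * u) (fun y => ind (far m (r n) e y)) <= eta.
Proof.
move=> u0 /andP[e0 e1] eta0.
have [c c0 hc] := tail_lower_bound mX statX normN rvX.
have [B hB] := hc e^-1 ltac:(by rewrite invr_gt0).
set k := c * e^-1 `^ (- alpha) in hB.
have k0 : 0 < k by rewrite mulr_gt0// powR_gt0// invr_gt0.
have ue0 : 0 < u * e by rewrite mulr_gt0.
have ke : 0 < eta * k by rewrite mulr_gt0.
have /cvgrPdist_lt /(_ _ ke) [m0 _ hm0] := anticluster ue0.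
exists m0 => m m0m; have := hm0 m m0m; rewrite /= sub0r normrN => /(le_lt_trans (ler_norm _)).
have mA n : measurable [set w | exists t : int,
    m%:Z <= `|t| <= (r n)%:Z /\ a n * (u * e) < N (X t w)].
  exact: (measurable_bset mX (bset_far m (r n) (a n * (u * e)))).
have E n := condPrE P (mA n) (mEx 0 (a n * (u * e))).
have bmi n : bounded_measurable (fun w => ind (a n * (u * e) < N (X 0 w)) *
    ind (exists t : int, m%:Z <= `|t| <= (r n)%:Z /\ a n * (u * e) < N (X t w)) : R).
  apply: bounded_measurableM; first exact: (bounded_measurable_ind (mEx _ _)).
  exact: (bounded_measurable_ind (mA n)).
move=> /limn_sup_lt_near h.
have {}h : \forall n \near \oo, condPr P
   [set w | exists t : int, m%:Z <= `|t| <= (r n)%:Z /\ a n * (u * e) < N (X t w)]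
   [set w | a n * (u * e) < N (X 0 w)] < eta * k.
  apply: h => n; rewrite E divr_ge0 ?(ltW (tailN_gt0 _))//=; last first.
    by apply: Ex_ge0 => w; rewrite mulr_ge0 ?ind_ge0.
  rewrite ler_pdivrMr ?tailN_gt0// mul1r -(Ex_ind P (mEx _ _)).
  apply: Ex_le => //; first exact: (bounded_measurable_ind (mEx _ _)).
  by move=> w; rewrite ler_piMr ?ind_ge0 ?ind_le1.
have h2 := near_level ue0 (ex_intro _ B hB).
near=> n.
have k1 : condPr P
   [set w | exists t : int, m%:Z <= `|t| <= (r n)%:Z /\ a n * (u * e) < N (X t w)]
   [set w | a n * (u * e) < N (X 0 w)] < eta * k by near: n.
have k2 : k * tail N (a n * (u * e)) <= tail N (e^-1 * (a n * (u * e))) by near: n.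
have au0 : 0 < a n * u by rewrite mulr_gt0.
rewrite (_ : e^-1 * (a n * (u * e)) = a n * u) in k2; last by field; rewrite gt_eqF.
rewrite /cond_exp ler_pdivrMr//.
move: k1; rewrite E ltr_pdivrMr ?tailN_gt0// => k1.
have k3 : Ex P (fun w => ind (a n * u < N (X 0 w)) *
    ind (far m (r n) e (scale (a n * u)^-1 (sample X w)))) <=
  Ex P (fun w => ind (a n * (u * e) < N (X 0 w)) *
    ind (exists t : int, m%:Z <= `|t| <= (r n)%:Z /\ a n * (u * e) < N (X t w))).
  apply: Ex_le => //.
    exact: (bounded_measurable_cond mX normN (a n * u) (bset_far m (r n) e)).
  move=> w; rewrite -!ind_and; apply: ind_le => -[h0 [t [t1 t2]]]; split.
    by apply: le_lt_trans h0; rewrite mulrA ler_piMr// ltW.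
  exists t; split=> //; move: t2; rewrite /scale is_normZ ?invr_ge0 ?(ltW au0)//.
  by rewrite mulrC ltr_pdivlMr// mulrC mulrA.
apply: (le_trans k3); apply: (le_trans (ltW k1)).
by rewrite -mulrA ler_pM2l.
Unshelve. all: by end_near.
Qed.

Lemma cylcont_prod (I : Type) (s : seq I) (p : pred I) (f : I -> path -> R) :
  (forall i, cylcont (f i)) -> cylcont (fun y => \prod_(i <- s | p i) f i y).
Proof.
move=> fc; elim: s => [|i s ih].
  rewrite (_ : (fun y => _) = fun=> 1); first exact: cylcont_cst.
  by apply/funext => y; rewrite big_nil.
rewrite (_ : (fun y => _) = fun y => if p i then f i y * \prod_(i <- s | p i) f i y
   else \prod_(i <- s | p i) f i y).
  by case: (p i) => //; exact: cylcontM.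
by apply/funext => y; rewrite big_cons.
Qed.

Let one_sub_far x m k e :
  cond_exp x (fun y => ind (~ far m k e y)) =
  1 - cond_exp x (fun y => ind (far m k e y)).
Proof.
rewrite -(cond_exp_cst mX statX normN rvX x 1) -(cond_expB P mX normN)//;
  try exact: baire_cst; last exact: bset_far.
by congr cond_exp; apply/funext => y; rewrite ind_not.
Qed.

(** A product of ramps from [e] to [2 e] is a cylinder function separating the two thresholds. Its
    mean is bounded below for each fixed [M], as [r n] eventually exceeds [M]; then [M] grows with
    [m] fixed. *)
Lemma tail_far_small e eta : 0 < e <= 1 -> 0 < eta -> exists m : nat,
  1 - eta <= EQ (fun y => ind (forall t : int, m%:Z <= `|t| -> N (y t) < 2 * e)).
Proof.
move=> e01 eta0; have /andP[e0 e1] := e01.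
have [m /(_ m (leqnn m)) hm] := far_small ltr01 e01 eta0; exists m.
have bA M : bset (fun y : path => forall t : int, m%:Z <= `|t| <= M%:Z -> N (y t) < 2 * e).
  apply: bset_forall_int => t; apply: bset_imp; first exact: bset_cst.
  by apply: bset_lt; [exact: cylcont_norm|exact: cylcont_cst].
have stepM M : 1 - eta <=
    EQ (fun y => ind (forall t : int, m%:Z <= `|t| <= M%:Z -> N (y t) < 2 * e)).
  pose ti (i : 'I_(M.*2.+1)) : int := (i : nat)%:Z - M%:Z.
  pose f (y : path) := \prod_(i < M.*2.+1 | m%:Z <= `|ti i|)
      (1 - clamp (e^-1 * (N (y (ti i)) - e))).
  have f01 (y : path) i : 0 <= 1 - clamp (e^-1 * (N (y (ti i)) - e)) <= 1.
    by rewrite subr_ge0 clamp_le1 lerBlDr lerDl clamp_ge0.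
  have f0 y : 0 <= f y by apply: prodr_ge0 => i _; have /andP[] := f01 y i.
  have f1 y : f y <= 1.
    by apply: (le_trans (ler_prod _ (fun i _ => f01 y i))); rewrite big1_eq.
  have fc : cylcont f.
    apply: cylcont_prod => i; apply: cylcontB; first exact: cylcont_cst.
    by apply/cylcont_clamp/cylcontZ/cylcontB; [exact: cylcont_norm|exact: cylcont_cst].
  have fC y : `|f y| <= 1 by rewrite ger0_norm.
  have bf := baire_cylb fc fC.
  apply: (@le_trans _ _ (EQ f)); last first.
    apply: Ex_le; [exact: bm|exact: (bm (bA M))|move=> w].
    have [h|/existsNP[t /not_implyP[/andP[t1 t2] t3]]] := pselect (forall t : int,
      m%:Z <= `|t| <= M%:Z -> N (sample Y w t) < 2 * e); first by rewrite indT.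
    have tk : (absz (t + M%:Z)%R < M.*2.+1)%N by lia.
    rewrite /f (bigD1 (Ordinal tk))//=; last by rewrite /ti/= (_ : _ - _ = t)//; lia.
    rewrite (_ : ti (Ordinal tk) = t) ?clamp1 ?subrr ?mul0r ?ind_ge0//; last by rewrite /ti/=; lia.
    rewrite mulrC ler_pdivlMr// mul1r; move/negP: t3; rewrite -leNgt; lra.
  have cv := cvg_level ltr01 (cond_exp_cvg tailXY fc (ex_intro _ 1 fC)).
  rewrite -(cvg_lim _ cv)//; apply: limr_ge; first by apply/cvg_ex; eexists; exact: cv.
  have hr := near_r M.
  near=> n.
  have k1 : cond_exp (a n * 1) (fun y => ind (far m (r n) e y)) <= eta by near: n.
  have k2 : (M <= r n)%N by near: n.
  apply: (@le_trans _ _ (cond_exp (a n * 1) (fun y => ind (~ far m (r n) e y)))).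
    by rewrite one_sub_far lerB.
  apply: ce_le => //; first by apply: bset_not; exact: bset_far.
  move=> y; have [h|h] := pselect (far m (r n) e y); first by rewrite indF//.
  rewrite indT// /f big1// => i hi; rewrite clamp0 ?subr0//.
  rewrite pmulr_rle0 ?invr_gt0// subr_le0 leNgt; apply/negP => hN.
  apply: h; exists (ti i); split=> //; rewrite hi/= /ti; have := ltn_ord i; lia.
have cv : (fun M : nat => EQ (fun y => ind (forall t : int, m%:Z <= `|t| <= M%:Z -> N (y t) < 2 * e)))
   @ \oo --> EQ (fun y => ind (forall t : int, m%:Z <= `|t| -> N (y t) < 2 * e)).
  apply: (@Ex_cvg _ _ _ _ _ _ 1) => [n|n w|w]; [|exact: normr_ind_le1|].
    exact: (measurable_baire mY (bA n)).
  apply: cvg_near_cst.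
  have [h|/existsNP[t /not_implyP[t1 t3]]] := pselect (forall t : int,
      m%:Z <= `|t| -> N (sample Y w t) < 2 * e).
    by apply: nearW => M; rewrite !indT// => t /andP[t1 _]; exact: h.
  exists (absz t) => // M /= tM; rewrite !indF//; first by move=> /(_ t t1).
  by move=> h; apply: t3; apply: h; rewrite t1/=; lia.
rewrite -(cvg_lim _ cv)//; apply: limr_ge; first by apply/cvg_ex; eexists; exact: cv.
exact: nearW.
Unshelve. all: by end_near.
Qed.

Lemma tail_vanishing : EQ (fun y => ind (vanishing y)) = 1.
Proof.
pose V (k : nat) (y : path) := exists T : nat, forall t : int, T%:Z <= `|t| -> N (y t) < k.+1%:R^-1.
have bV0 T k : bset (fun y : path => forall t : int, T%:Z <= `|t| -> N (y t) < k.+1%:R^-1).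
  apply: bset_forall_int => t; apply: bset_imp; first exact: bset_cst.
  by apply: bset_lt; [exact: cylcont_norm|exact: cylcont_cst].
have bV k : bset (V k) by apply: bset_exists => T; exact: bV0.
have V1 k : EQ (fun y => ind (V k y)) = 1.
  apply/eqP; rewrite eq_le; apply/andP; split.
    rewrite -[leRHS](Ex_cst Q); apply: Ex_le; [exact: (bm (bV k))|exact: bounded_measurable_cst|].
    by move=> w; exact: ind_le1.
  apply/ler_addgt0Pr => eta eta0.
  (* Half of the threshold, to offset the factor 2 in [tail_far_small]. *)
  have e01 : 0 < ((2 * k.+1%:R)^-1 : R) <= 1.
    rewrite invr_gt0 mulr_gt0//=; rewrite invf_le1 ?mulr_gt0//.
    by rewrite -natrM ler1n.
  have [m hm] := tail_far_small e01 eta0; rewrite -lerBlDr; apply: (le_trans hm).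
  rewrite invfM mulVKf//.
  apply: Ex_le; [exact: (bm (bV0 m k))|exact: (bm (bV k))|].
  by move=> w; apply: ind_le => h; exists m.
pose W K (y : path) := forall k, (k < K)%N -> V k y.
have bW K : bset (W K).
  apply: bset_forall => k; apply: bset_imp; first exact: bset_cst.
  exact: bV.
have W1 K : EQ (fun y => ind (W K y)) = 1.
  elim: K => [|K ih].
    by rewrite -[RHS](Ex_cst Q); apply: eq_Ex => w; rewrite indT.
  apply/eqP; rewrite eq_le; apply/andP; split.
    rewrite -[leRHS](Ex_cst Q); apply: Ex_le; [exact: (bm (bW _))|exact: bounded_measurable_cst|].
    by move=> w; exact: ind_le1.
  have -> : 1 = EQ (fun y => ind (W K y) + ind (V K y) - 1) :> R.
    rewrite ExB ?ExD ?ih ?V1 ?Ex_cst ?addrK//; try exact: bounded_measurable_cst.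
    - exact: (bm (bW K)).
    - exact: (bm (bV K)).
    - by apply: bounded_measurableD; [exact: (bm (bW K))|exact: (bm (bV K))].
  apply: Ex_le; last 1 first.
  - move=> w; rewrite (_ : ind (W K.+1 _) = ind (W K (sample Y w)) * ind (V K (sample Y w))).
      have := @ind_le1 R (W K (sample Y w)); have := @ind_le1 R (V K (sample Y w)).
      by move: (ind _) (ind _) => p q hp hq; nra.
    rewrite -ind_and; apply: ind_eq; split=> [h|[h1 h2] k].
      by split=> [k kK|]; apply: h => //; exact: leqW.
    by rewrite ltnS leq_eqVlt => /predU1P[->//|/h1].
  - apply: bounded_measurableB; last exact: bounded_measurable_cst.
    by apply: bounded_measurableD; [exact: (bm (bW K))|exact: (bm (bV K))].
  - exact: (bm (bW K.+1)).
have cv : (fun K => EQ (fun y => ind (W K y))) @ \oo --> EQ (fun y => ind (vanishing y)).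
  apply: (@Ex_cvg _ _ _ _ _ _ 1) => [n|n w|w]; [|exact: normr_ind_le1|].
    exact: (measurable_baire mY (bW n)).
  apply: cvg_near_cst.
  have [h|h] := pselect (vanishing (sample Y w)).
    apply: nearW => K; rewrite !indT// => k _; apply: h.
    by rewrite invr_gt0.
  have [k hk] : exists k, ~ V k (sample Y w).
    apply/existsNP => hV; apply: h => e e0.
    have [k _ /(_ k (leqnn k)) hk] := nbhs_infty_ger e^-1.
    have [T hT] := hV k; exists T => t tT; apply: lt_le_trans (hT t tT) _.
    by rewrite invf_ple ?posrE ?ltr0Sn//; apply: le_trans hk _; rewrite ler_nat.
  exists k.+1 => // K /= kK; rewrite !indF// => hW; exact/hk/hW.
have cv1 := cvg_ext W1 cv.
by rewrite -(cvg_lim _ cv1)// lim_cst.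
Qed.

End Anticlustering.

Section BlockMaximum.
Context {R : realType} {d : nat} {dT : measure_display} {T : measurableType dT}.
Variables (X : int -> T -> 'rV[R]_d) (N : 'rV[R]_d -> R).

(** The maximum starts from the default 0, hence the nonnegative level. *)
Lemma Mmax_leP (k : nat) (x : R) w : 0 <= x -> Mmax X N k w <= x <->
  forall t : int, 1 <= t <= k%:Z -> N (X t w) <= x.
Proof.
move=> x0; rewrite /Mmax big_add1/= big_mkord; split=> [/bigmax_leP[_ h] t tk|h].
  have tk' : ((absz t).-1 < k)%N by lia.
  have := h (Ordinal tk') isT; rewrite /= (_ : (absz t).-1.+1%:Z = t)//; lia.
by apply/bigmax_leP; split=> // i _; apply: h; have := ltn_ord i; lia.
Qed.

Lemma Mmax_gtP (k : nat) (x : R) w : 0 <= x -> x < Mmax X N k w <->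
  exists i : 'I_k, x < N (X (i.+1)%:Z w) /\
    forall t : int, 1 <= t < (i.+1)%:Z -> N (X t w) <= x.
Proof.
move=> x0; split=> [xM|[i [xi _]]]; last first.
  rewrite ltNge; apply/negP => /(Mmax_leP _ _ x0) /(_ i.+1%:Z).
  by have := ltn_ord i => ik /(_ ltac:(lia)); lra.
have /existsNP[t /not_implyP[tk /negP]] :
    ~ (forall t : int, 1 <= t <= k%:Z -> N (X t w) <= x).
  by move=> /(Mmax_leP _ _ x0); lra.
rewrite -ltNge => xt.
have ex : exists n : nat, x < N (X n.+1%:Z w).
  by exists (absz t).-1; rewrite (_ : (absz t).-1.+1%:Z = t)//; lia.
have [n xn nmin] := ex_minnP ex.
have nt := nmin (absz t).-1 ltac:(by rewrite (_ : (absz t).-1.+1%:Z = t)//; lia).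
have nk : (n < k)%N by lia.
exists (Ordinal nk); split=> //= s s1; rewrite leNgt; apply/negP => xs.
have := nmin (absz s).-1 ltac:(by rewrite (_ : (absz s).-1.+1%:Z = s)//; lia).
by lia.
Qed.

End BlockMaximum.

(** * Limits of conditional means over windows and of block means *)

Section ClusterConvergence.
Context {R : realType} {d : nat} {dX : measure_display} {TX : measurableType dX}.
Context {dY : measure_display} {TY : measurableType dY}.
Notation path := (int -> 'rV[R]_d).
Variables (P : probability TX R) (X : int -> TX -> 'rV[R]_d).
Variables (Q : probability TY R) (Y : int -> TY -> 'rV[R]_d).
Variables (alpha : R) (N : 'rV[R]_d -> R).
Hypothesis mX : forall t j, measurable_fun setT (fun w => X t w 0 j).
Hypothesis mY : forall t j, measurable_fun setT (fun w => Y t w 0 j).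
Hypothesis statX : strictly_stationary P X.
Hypothesis alpha_gt0 : 0 < alpha.
Hypothesis normN : is_norm N.
Hypothesis rvX : jointly_regvar P X alpha.
Hypothesis tailXY : tail_process P X N Q Y.
Variables (a : nat -> R) (r : nat -> nat).
Hypothesis a_gt0 : forall n, 0 < a n.
Hypothesis a_tail : (fun n => n%:R * Pr P [set w | a n < N (X 0 w)]) @ \oo --> (1 : R).
Hypothesis r_gt0 : forall n, (0 < r n)%N.
Hypothesis r_cvg : (fun n => (r n)%:R : R) @ \oo --> +oo.
Hypothesis anticluster : forall u : R, 0 < u ->
  (fun m : nat => limn_sup (fun n =>
     condPr P [set w | exists t : int, m%:Z <= `|t| <= (r n)%:Z /\ a n * u < N (X t w)]
              [set w | a n * u < N (X 0 w)])) @ \oo --> (0 : R).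

Local Notation tail := (tail P X).
Local Notation cond_exp := (cond_exp P X N).
Local Notation EQ f := (Ex Q (fun w => f (sample Y w))).
Local Notation vanishing := (vanishing N).
Local Notation far := (far N).

Let bm f : baire f -> bounded_measurable (fun w => f (sample Y w)).
Proof. exact: bounded_measurable_baire. Qed.
Let tailN_gt0 x : 0 < tail N x := tail_gt0 mX statX normN rvX x.
Let vanish1 : EQ (fun y => ind (vanishing y)) = 1.
Proof.
exact: (tail_vanishing mX mY statX alpha_gt0 normN rvX tailXY a_gt0 a_tail r_cvg anticluster).
Qed.

Lemma EQ_almost_sure (f : path -> R) (A : path -> Prop) : baire f -> bset A ->
  EQ (fun y => ind (A y)) = 1 -> EQ (fun y => f y * ind (A y)) = EQ f.
Proof.
move=> bf bA A1; have [C fC] := baire_bounded bf.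
have bfA := bm (baireM bf bA); have bf' := bm bf; have bA' := bm bA.
have bAc : baire (fun y : path => 1 - ind (A y)) by apply: baireB => //; exact: baire_cst.
apply/eqP; rewrite -subr_eq0 -ExB// -normr_le0.
apply: (le_trans (Ex_norm Q (bounded_measurableB bfA bf'))).
have C0 : 0 <= C by apply: le_trans (fC (fun=> 0)).
apply: (@le_trans _ _ (EQ (fun y => C * (1 - ind (A y))))).
  apply: Ex_le.
  - exact/bounded_measurable_norm/bounded_measurableB.
  - by apply: bounded_measurableM; [exact: bounded_measurable_cst|exact: (bm bAc)].
  - move=> w; rewrite (_ : _ - _ = - (f (sample Y w) * (1 - ind (A (sample Y w))))); last by ring.
    rewrite normrN normrM [X in _ * X]ger0_norm ?subr_ge0 ?ind_le1//.
    by rewrite ler_wpM2r ?subr_ge0 ?ind_le1.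
rewrite ExZ; last exact: (bm bAc).
by rewrite ExB ?Ex_cst ?A1 ?subrr ?mulr0//; exact: bounded_measurable_cst.
Qed.

(** Used with the past [t < 0] for the first exceedance and with the future [1 <= t] for [theta]. *)
Definition no_exceed (D : int -> bool) (y : path) : Prop :=
  forall t : int, D t -> N (y t) <= 1.

Lemma bset_no_exceed D : bset (no_exceed D).
Proof.
apply: bset_forall_int => t; apply: bset_imp; first exact: bset_cst.
by apply: bset_le; [exact: cylcont_norm|exact: cylcont_cst].
Qed.

Lemma no_exceed_window D l h y :
  no_exceed D (window l h y) <-> forall t : int, l <= t <= h -> D t -> N (y t) <= 1.
Proof.
split=> [H t lth /H|H t Dt]; first by rewrite /window lth.
rewrite /window; case: ifPn => [lth|_]; first exact: H.
by rewrite is_norm0.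
Qed.

Lemma no_exceed_window_eq D (l h : int) (m k : nat) y :
  - k%:Z <= l <= - m%:Z -> m%:Z <= h <= k%:Z ->
  (forall t : int, m%:Z <= `|t| <= k%:Z -> N (y t) <= 1) ->
  no_exceed D (window (- m%:Z) m%:Z y) <-> no_exceed D (window l h y).
Proof.
move=> /andP[l1 l2] /andP[h1 h2] hy; rewrite !no_exceed_window.
split=> H t lt Dt; last by apply: H => //; clear - lt l2 h1; lia.
have [tm|tm] := leP `|t| m%:Z; first by apply: H => //; clear - tm; lia.
by apply: hy; clear - tm lt l1 h2; lia.
Qed.

Lemma window_window_close (l h : int) (m k : nat) (e : R) (y : path) t :
  - k%:Z <= l <= - m%:Z -> m%:Z <= h <= k%:Z -> 0 <= e ->
  (forall t : int, m%:Z <= `|t| <= k%:Z -> `|y t| <= e) ->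
  `|window l h y t - window (- m%:Z) m%:Z y t| <= e.
Proof.
move=> /andP[l1 l2] /andP[h1 h2] e0 hy; rewrite /window distrC; case: ifPn => [tm|tm].
  by rewrite ifT ?subrr ?normr0//; clear - tm l2 h1; lia.
rewrite sub0r normrN; case: ifPn => lth; last by rewrite normr0.
by apply: hy; clear - tm lth l1 h2; lia.
Qed.

Lemma jordan_no_exceed D m :
  jordan Q Y 1 (fun y => ind (no_exceed D (window (- m%:Z) m%:Z y))).
Proof.
pose A j (y : path) := forall i : nat, (i < j)%N -> D (i%:Z - m%:Z) -> N (y (i%:Z - m%:Z)) <= 1.
have jA j : jordan Q Y 1 (fun y => ind (A j y)).
  elim: j => [|j ih].
    rewrite (_ : (fun y => _) = fun=> 1); last by apply/funext => y; rewrite indT.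
    by apply: jordan_cyl; [exact: cylcont_cst|move=> y; rewrite normr1].
  have jD : jordan Q Y 1 (fun y => ind (D (j%:Z - m%:Z) -> N (y (j%:Z - m%:Z)) <= 1)).
    case: (D _).
      rewrite (_ : (fun y => _) = fun y => ind (N (y (j%:Z - m%:Z)) <= 1)).
        exact: (jordan_not_exceed mX statX alpha_gt0 normN rvX tailXY).
      by apply/funext => y; apply: ind_eq; split=> // /(_ isT).
    rewrite (_ : (fun y => _) = fun=> 1); last by apply/funext => y; rewrite indT.
    by apply: jordan_cyl; [exact: cylcont_cst|move=> y; rewrite normr1].
  rewrite (_ : (fun y => _) = fun y => ind (A j y) *
    ind (D (j%:Z - m%:Z) -> N (y (j%:Z - m%:Z)) <= 1)).
    by rewrite -[X in jordan _ _ X]mulr1; exact: (jordanM mY).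
  apply/funext => y; rewrite -ind_and; apply: ind_eq; split=> [h|[h1 h2] i].
    by split=> [i ij|]; apply: h => //; exact: leqW.
  by rewrite ltnS leq_eqVlt => /predU1P[->//|/h1].
have := jA m.*2.+1; congr jordan; apply/funext => y; apply: ind_eq.
rewrite no_exceed_window; split=> h; last first.
  by move=> i im; apply: h; lia.
move=> t /andP[t1 t2]; have := h (absz (t + m%:Z)).
rewrite (_ : (absz (t + m%:Z))%:Z - m%:Z = t); last by lia.
by apply; lia.
Qed.

Lemma no_exceed_cvg D y :
  (fun m : nat => ind (no_exceed D (window (- m%:Z) m%:Z y))) @ \oo -->
  (ind (no_exceed D y) : R).
Proof.
apply: cvg_near_cst.
have [h|/existsNP[t /not_implyP[Dt h]]] := pselect (no_exceed D y).
  by apply: nearW => m; rewrite !indT//; apply/no_exceed_window => t _; exact: h.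
exists (absz t) => // m /= tm; rewrite !indF//; first by move=> /(_ t Dt).
by move=> /no_exceed_window H; apply: h; apply: H => //; lia.
Qed.

(** The vanishing indicator has mean 1 and makes the integrand a [baire] function for bounded,
    vanishing-continuous [Phi]. *)
Definition cluster_value (Phi : path -> R) (D : int -> bool) : R :=
  EQ (fun y => Phi y * ind (vanishing y) * ind (no_exceed D y)).

(** One-sided because [Phi] is replaced by a Lipschitz minorant. If nothing beyond [m] exceeds [e],
    passing from [l, h] to [-m, m] costs [k e / c], whatever the path; otherwise it costs at most
    [2 C], on an event made rare by [far_small]. *)
Lemma cluster_lower (Phi : path -> R) C D u eta : vanishing_continuous N Phi ->
  0 <= C -> (forall y, `|Phi y| <= C) -> 0 < u -> 0 < eta ->
  exists m : nat, \forall n \near \oo, forall l h : int,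
    - (r n)%:Z <= l <= - m%:Z -> m%:Z <= h <= (r n)%:Z ->
    cluster_value Phi D - eta <= cond_exp (a n * u)
      (fun y => Phi (window l h y) * ind (no_exceed D (window l h y))).
Proof.
move=> Phic C0 PhiC u0 eta0.
have PhiC' y : vanishing y -> `|Phi y| <= C by [].
have [c c0 hc] := is_norm_lower normN.
have bv := bset_vanishing normN; have bD := bset_no_exceed D.
have k0 (k : nat) : 0 <= k%:R :> R by [].
pose g (k : nat) (y : path) := regularize N Phi k%:R y.
have gC k y : vanishing y -> `|g k y| <= C by exact: (normr_regularize PhiC).
have gcont k : vanishing_continuous N (g k) := regularize_continuous PhiC (k0 k).
have bgv k : baire (fun y => g k y * ind (vanishing y)).
  exact: (baire_vanishing normN (gcont k) (gC k)).
have cvk : (fun k => cluster_value (g k) D) @ \oo --> cluster_value Phi D.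
  apply: (@Ex_cvg _ _ _ _ _ _ C) => [k|k w|w].
  - apply: (measurable_baire mY (f := fun y => g k y * ind (vanishing y) * ind (no_exceed D y))).
    exact: baireM.
  - have [v|v] := pselect (vanishing (sample Y w)); last by rewrite (indF v) mulr0 mul0r normr0.
    by rewrite (indT v) mulr1 normrM -[leRHS]mulr1 ler_pM ?normr_ind_le1//; exact: gC.
  - have [v|v] := pselect (vanishing (sample Y w)); last first.
      by rewrite (indF v) mulr0 mul0r; apply: cvg_near_cst; apply: nearW => k; rewrite mulr0 mul0r.
    by rewrite (indT v); apply: cvgMl; apply: cvgMl; exact: (regularize_cvg Phic PhiC).
(* Five errors of at most [eta / 8] arise: regularization, truncation under [Y], convergence at
   level [a n u], the Lipschitz step and the far exceedances. *)
have e8 : 0 < eta / 8 by rewrite divr_gt0.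
have /cvgrPdist_lt /(_ _ e8) [k _ /(_ k (leqnn k)) /= hk] := cvk.
pose gm m (y : path) := g k (window (- m%:Z) m%:Z y) * ind (no_exceed D (window (- m%:Z) m%:Z y)).
have jg m : jordan Q Y (C * 1) (gm m).
  apply: (jordanM mY) => //; last exact: jordan_no_exceed.
  apply: jordan_cyl; first exact: (cylcont_window normN).
  by move=> y; apply: gC; exact: vanishing_window.
have bgm m : baire (gm m) by case: (jg m).
have cvm : (fun m => EQ (fun y => gm m y * ind (vanishing y))) @ \oo --> cluster_value (g k) D.
  apply: (@Ex_cvg _ _ _ _ _ _ C) => [m|m w|w].
  - apply: (measurable_baire mY (f := fun y => gm m y * ind (vanishing y))).
    exact: baireM.
  - rewrite normrM -[leRHS]mulr1 ler_pM ?normr_ind_le1//.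
    rewrite normrM -[leRHS]mulr1 ler_pM ?normr_ind_le1//.
    by apply: gC; exact: vanishing_window.
  - have [v|v] := pselect (vanishing (sample Y w)); last first.
      by rewrite (indF v) mulr0 mul0r; apply: cvg_near_cst; apply: nearW => m; rewrite mulr0.
    rewrite (indT v) mulr1; under eq_fun do rewrite mulr1.
    by apply: cvgM; [exact: (window_cvg normN)|exact: no_exceed_cvg].
have /cvgrPdist_lt /(_ _ e8) [m1 _ hm1] := cvm.
(* [e <= 1] lets the same event rule out far exceedances of level 1; the other bound gives
   [k e / c <= eta / 8], where [c] converts [N] into the maximum norm. *)
pose e := Num.min 1 (c * eta / (8 * (k%:R + 1))).
have K0 : 0 < 8 * (k%:R + 1) :> R by rewrite mulr_gt0// ltr_wpDl.
have e0 : 0 < e by rewrite lt_min ltr01 divr_gt0// mulr_gt0.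
have e1 : e <= 1 by rewrite ge_min lexx.
have ke : k%:R * (e / c) <= eta / 8.
  have : e <= c * eta / (8 * (k%:R + 1)) by rewrite ge_min lexx orbT.
  rewrite ler_pdivlMr// => h1; rewrite mulrA ler_pdivrMr//.
  have : 0 <= e by exact: ltW.
  by have := k0 k; nra.
have C1 : 0 < 8 * (2 * C + 1) by rewrite mulr_gt0// ltr_wpDl// mulr_ge0.
have f0 : 0 < eta / (8 * (2 * C + 1)) by rewrite divr_gt0.
have e01 : 0 < e <= 1 by rewrite e0.
have [m0 hm0] := far_small mX statX normN rvX a_gt0 a_tail anticluster u0 e01 f0.
pose m := maxn m0 m1; exists m.
have hfar := hm0 m (leq_maxl _ _).
have hgm : EQ (gm m) >= cluster_value Phi D - eta / 8 - eta / 8.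
  have := hm1 m (leq_maxr _ _); rewrite /= (EQ_almost_sure (bgm m) bv vanish1).
  by move: hk; rewrite !ltr_norml => /andP[_ h1] /andP[_ h2]; lra.
have cvj := cvg_level mX statX normN rvX a_tail u0
  (jordan_cvg mX mY statX normN rvX tailXY (jg m)).
have /cvgrPdist_lt /(_ _ e8) hj := cvj.
near=> n => l h /andP[l1 l2] /andP[h1 h2].
have n1 : cond_exp (a n * u) (fun y => ind (far m (r n) e y)) <= eta / (8 * (2 * C + 1)).
  by near: n.
have n2 : `|EQ (gm m) - cond_exp (a n * u) (gm m)| < eta / 8 by near: n.
set x := a n * u in n1 n2 *.
pose F y := ind (far m (r n) e y) : R.
have bF : baire F by exact: bset_far.
have bPhi : baire (fun y => Phi (window l h y) * ind (no_exceed D (window l h y))).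
  apply: baireM; last exact: (baire_comp (@local_lipschitz_window R d l h) bD).
  by apply: (@baire_cylb _ _ _ C); [exact: (cylcont_window normN)|move=> y].
have key : cond_exp x (fun y => gm m y - ((eta / 8) + 2 * C * F y)) <=
    cond_exp x (fun y => Phi (window l h y) * ind (no_exceed D (window l h y))).
  apply: (cond_exp_le mX statX normN rvX) => //.
    apply: baireB => //; apply: baireD; first exact: baire_cst.
    by apply: baireM => //; exact: baire_cst.
  move=> y; rewrite /F; have [hf|hf] := pselect (far m (r n) e y).
    rewrite (indT hf) mulr1.
    have : `|gm m y| <= C.
      rewrite normrM -[leRHS]mulr1 ler_pM ?normr_ind_le1//.
      by apply: gC; exact: vanishing_window.
    have : `|Phi (window l h y) * ind (no_exceed D (window l h y))| <= C.
      by rewrite normrM -[leRHS]mulr1 ler_pM ?normr_ind_le1.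
    rewrite !ler_norml => /andP[p1 p2] /andP[p3 p4]; lra.
  rewrite (indF hf) mulr0 addr0.
  have near0 (t : int) : m%:Z <= `|t| <= (r n)%:Z -> N (y t) <= e.
    by move=> tm; rewrite leNgt; apply/negP => hN; apply: hf; exists t.
  rewrite /gm (_ : ind (no_exceed D (window (- m%:Z) m%:Z y)) =
    ind (no_exceed D (window l h y))); last first.
    apply: ind_eq; apply: (@no_exceed_window_eq D l h m (r n) y).
    - by rewrite l1.
    - by rewrite h1.
    - by move=> t tm; apply: (le_trans _ e1); exact: near0.
  have ec0 : 0 <= e / c by rewrite divr_ge0 ?ltW.
  have close (t : int) : `|window l h y t - window (- m%:Z) m%:Z y t| <= e / c.
    apply: (@window_window_close l h m (r n)); rewrite ?l1 ?h1// => t' tm.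
    by rewrite ler_pdivlMr// mulrC (le_trans (hc _))// near0.
  have p1 := regularize_lipschitz PhiC (k0 k) (vanishing_window normN l h y)
    (vanishing_window normN (- m%:Z) m%:Z y) ec0 close.
  have p2 := regularize_le PhiC (k0 k) (vanishing_window normN l h y).
  have : g k (window (- m%:Z) m%:Z y) - eta / 8 <= Phi (window l h y) by rewrite /g; lra.
  have i0 := @ind_ge0 R (no_exceed D (window l h y)).
  have i1 := @ind_le1 R (no_exceed D (window l h y)).
  by move: (ind _) i0 i1 => i i0 i1 p3; nra.
apply: le_trans key.
have bCF : baire (fun y => 2 * C * F y) by apply: baireM => //; exact: baire_cst.
rewrite (cond_expB P mX normN)//; last by apply: baireD => //; exact: baire_cst.
rewrite (cond_expD P mX normN)//; last exact: baire_cst.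
rewrite (cond_exp_cst mX statX normN rvX) (cond_expZ P mX normN)//.
have q1 : 2 * C * cond_exp x F <= eta / 8.
  apply: (@le_trans _ _ (2 * C * (eta / (8 * (2 * C + 1))))).
    by rewrite ler_wpM2l// mulr_ge0.
  rewrite mulrA ler_pdivrMr//.
  have : 0 < eta / 8 by []. 
  by nra.
by move: n2; rewrite ltr_norml => /andP[_ n2]; lra.
Unshelve. all: by end_near.
Qed.

(** The upper bound is [cluster_lower] applied to [- Phi]. *)
Lemma cluster_window (Phi : path -> R) C D u eta : vanishing_continuous N Phi ->
  0 <= C -> (forall y, `|Phi y| <= C) -> 0 < u -> 0 < eta ->
  exists m : nat, \forall n \near \oo, forall l h : int,
    - (r n)%:Z <= l <= - m%:Z -> m%:Z <= h <= (r n)%:Z ->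
    `|cond_exp (a n * u)
      (fun y => Phi (window l h y) * ind (no_exceed D (window l h y))) -
      cluster_value Phi D| <= eta.
Proof.
move=> Phic C0 PhiC u0 eta0.
have [m1 hm1] := cluster_lower D Phic C0 PhiC u0 eta0.
have Phic' : vanishing_continuous N (fun y => - Phi y).
  move=> y vy e e0; have [dl dl0 hd] := Phic y vy e e0; exists dl => // z vz yz.
  by rewrite (_ : - Phi y - - Phi z = - (Phi y - Phi z)) ?normrN ?hd//; ring.
have PhiC' y : `|- Phi y| <= C by rewrite normrN.
have [m2 hm2] := cluster_lower D Phic' C0 PhiC' u0 eta0.
have Lneg : cluster_value (fun y => - Phi y) D = - cluster_value Phi D.
  rewrite /cluster_value -mulN1r -ExZ.
    by apply: eq_Ex => w; rewrite mulN1r !mulNr.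
  apply: (bm (f := fun y => Phi y * ind (vanishing y) * ind (no_exceed D y))).
  by apply: baireM; [exact: (baire_vanishing normN Phic (fun y _ => PhiC y))|exact: bset_no_exceed].
exists (maxn m1 m2); near=> n => l h hl hh.
have n1 : forall l h : int, - (r n)%:Z <= l <= - m1%:Z -> m1%:Z <= h <= (r n)%:Z ->
    cluster_value Phi D - eta <= cond_exp (a n * u)
      (fun y => Phi (window l h y) * ind (no_exceed D (window l h y))).
  by near: n.
have n2 : forall l h : int, - (r n)%:Z <= l <= - m2%:Z -> m2%:Z <= h <= (r n)%:Z ->
    cluster_value (fun y => - Phi y) D - eta <= cond_exp (a n * u)
      (fun y => - Phi (window l h y) * ind (no_exceed D (window l h y))).
  by near: n.
have k1 := n1 l h ltac:(lia) ltac:(lia); have := n2 l h ltac:(lia) ltac:(lia).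
rewrite Lneg (_ : (fun y => - Phi _ * _) = fun y => -1 * (Phi (window l h y) *
  ind (no_exceed D (window l h y)))); last by apply/funext => y; rewrite mulN1r mulNr.
rewrite (cond_expZ P mX normN); first by move=> k2; rewrite ler_norml; apply/andP; split; lra.
apply: baireM; last exact: (baire_comp (@local_lipschitz_window R d l h) (bset_no_exceed D)).
by apply: (@baire_cylb _ _ _ C); [exact: (cylcont_window normN)|move=> y].
Unshelve. all: by end_near.
Qed.

Definition shift_invariant (Phi : path -> R) : Prop :=
  forall s y, Phi (tshift s y) = Phi y.

(** First-exceedance decomposition of [{M_k > x}], each piece being moved to
    time 0 by stationarity. *)
Lemma block_decomposition (Phi : path -> R) C k x : vanishing_continuous N Phi ->
  (forall y, `|Phi y| <= C) -> shift_invariant Phi -> 0 < x ->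
  Ex P (fun w => ind (x < Mmax X N k w) *
     Phi (window 1 k%:Z (scale x^-1 (sample X w)))) =
  \sum_(i < k) tail N x * cond_exp x (fun y =>
     Phi (window (- (i : nat)%:Z) (k%:Z - i.+1%:Z) y) *
     ind (no_exceed (fun t => t < 0) (window (- (i : nat)%:Z) (k%:Z - i.+1%:Z) y))).
Proof.
move=> Phic PhiC Phis x0.
pose G (i : nat) (y : path) := Phi (window 1 k%:Z (scale x^-1 y)) *
  ind (x < N (y i.+1%:Z) /\ forall t : int, 1 <= t < i.+1%:Z -> N (y t) <= x).
have bG i : baire (G i).
  apply: baireM.
    apply: (baire_comp (@local_lipschitz_scale R d x^-1)
       (f := fun y => Phi (window 1 k%:Z y))).
    by apply: (@baire_cylb _ _ _ C); [exact: (cylcont_window normN)|move=> y].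
  apply: bset_and; first by apply: bset_lt; [exact: cylcont_cst|exact: cylcont_norm].
  apply: bset_forall_int => t; apply: bset_imp; first exact: bset_cst.
  by apply: bset_le; [exact: cylcont_norm|exact: cylcont_cst].
have -> : Ex P (fun w => ind (x < Mmax X N k w) *
     Phi (window 1 k%:Z (scale x^-1 (sample X w)))) =
    Ex P (fun w => \sum_(i < k) G i (sample X w)).
  apply: eq_Ex => w; rewrite -mulr_sumr mulrC; congr (_ * _).
  have [h|h] := pselect (x < Mmax X N k w); last first.
    rewrite (indF h) big1// => i _; rewrite indF// => -[h1 h2].
    by apply: h; apply/(Mmax_gtP X N _ _ (ltW x0)); exists i.
  rewrite (indT h); have [i [h1 h2]] := (Mmax_gtP X N k w (ltW x0)).1 h.
  rewrite (bigD1 i)//= indT// big1 ?addr0// => j ji; rewrite indF// => -[j1 j2].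
  have [ij|ij|ij] := ltngtP i j; last by move/eqP: ji; apply; apply/val_inj; rewrite /= ij.
    by have := j2 i.+1%:Z ltac:(lia); rewrite leNgt h1.
  by have := h2 j.+1%:Z ltac:(lia); rewrite leNgt j1.
rewrite Ex_sum; last by move=> i; exact: bounded_measurable_baire.
apply: eq_bigr => i _.
rewrite -(Ex_stationary mX statX (- i.+1%:Z) (bG i)) /cond_exp mulrC divfK ?gt_eqF//.
apply: eq_Ex => w; rewrite /G.
have -> : scale x^-1 (tshift (- i.+1%:Z) (sample X w)) =
    tshift (- i.+1%:Z) (scale x^-1 (sample X w)) by [].
set z := scale x^-1 (sample X w).
(* Moving time [i + 1] to 0 turns the block [1, k] into [-i, k - i - 1]. *)
have -> : window 1 k%:Z (tshift (- i.+1%:Z) z) =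
    tshift (- i.+1%:Z) (window (- (i : nat)%:Z) (k%:Z - i.+1%:Z) z).
  apply/funext => t; rewrite /window /tshift.
  by congr (if _ then _ else _); apply/idP/idP; lia.
rewrite Phis ind_and [in RHS]mulrCA; congr (_ * (_ * _)).
  by rewrite /tshift subrr.
apply: ind_eq; rewrite no_exceed_window; split=> H t ht.
  move=> t0; have := H (t + i.+1%:Z) ltac:(lia).
  rewrite /tshift addrK /z /scale is_normZ ?invr_ge0 ?(ltW x0)//.
  by rewrite mulrC ler_pdivrMr// mul1r.
have := ltn_ord i => ik.
have := H (t - i.+1%:Z) ltac:(lia) ltac:(lia).
rewrite /tshift /z /scale is_normZ ?invr_ge0 ?(ltW x0)//.
by rewrite mulrC ler_pdivrMr// mul1r.
Qed.

Lemma block_average (Phi : path -> R) C u : vanishing_continuous N Phi ->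
  0 <= C -> (forall y, `|Phi y| <= C) -> shift_invariant Phi -> 0 < u ->
  (fun n => Ex P (fun w => ind (a n * u < Mmax X N (r n) w) *
     Phi (window 1 (r n)%:Z (scale (a n * u)^-1 (sample X w)))) /
     ((r n)%:R * tail N (a n * u))) @ \oo -->
  cluster_value Phi (fun t => t < 0).
Proof.
move=> Phic C0 PhiC Phis u0; apply/cvgrPdist_le => e e0.
have e2 : 0 < e / 2 by rewrite divr_gt0.
pose L := cluster_value Phi (fun t => t < 0).
have [m hm] := cluster_window (fun t => t < 0) Phic C0 PhiC u0 e2.
(* For such [r n] the [2 m] end positions, each off by at most [2 C], contribute at most [e / 2] to
   the average. *)
have hr : \forall n \near \oo, 2 * C * (2 * m%:R) / (e / 2) <= (r n)%:R.
  by move/cvgryPge : r_cvg; exact.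
near=> n.
have hn : forall l h : int, - (r n)%:Z <= l <= - m%:Z -> m%:Z <= h <= (r n)%:Z ->
    `|cond_exp (a n * u) (fun y => Phi (window l h y) *
       ind (no_exceed (fun t => t < 0) (window l h y))) - L| <= e / 2.
  by near: n.
have h1 : 2 * C * (2 * m%:R) / (e / 2) <= (r n)%:R by near: n.
set x := a n * u in hn *; have x0 : 0 < x by rewrite mulr_gt0.
pose c i := cond_exp x (fun y => Phi (window (- (i : nat)%:Z) ((r n)%:Z - i.+1%:Z) y) *
     ind (no_exceed (fun t => t < 0) (window (- (i : nat)%:Z) ((r n)%:Z - i.+1%:Z) y))).
rewrite (block_decomposition (r n) Phic PhiC Phis x0) -mulr_sumr.
rewrite (_ : _ / _ = (\sum_(i < r n) c i) / (r n)%:R); last first.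
  by rewrite [(r n)%:R * _]mulrC -mulf_div divff ?mul1r// gt_eqF.
have LC : `|L| <= C.
  apply: Ex_norm_le.
    apply: (bm (f := fun y => Phi y * ind (vanishing y) * ind (no_exceed _ y))).
    apply: baireM; last exact: bset_no_exceed.
    exact: (baire_vanishing normN Phic (fun y _ => PhiC y)).
  move=> w; rewrite normrM -[leRHS]mulr1 ler_pM ?normr_ind_le1//.
  by rewrite normrM -[leRHS]mulr1 ler_pM ?normr_ind_le1.
have cC i : `|c i| <= C.
  have b : baire (fun y => Phi (window (- (i : nat)%:Z) ((r n)%:Z - i.+1%:Z) y) *
     ind (no_exceed (fun t => t < 0) (window (- (i : nat)%:Z) ((r n)%:Z - i.+1%:Z) y))).
    apply: baireM; last first.
      exact: (baire_comp (@local_lipschitz_window R d _ _) (bset_no_exceed _)).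
    by apply: (@baire_cylb _ _ _ C); [exact: (cylcont_window normN)|move=> y].
  have le y : `|Phi (window (- (i : nat)%:Z) ((r n)%:Z - i.+1%:Z) y) *
     ind (no_exceed (fun t => t < 0) (window (- (i : nat)%:Z) ((r n)%:Z - i.+1%:Z) y))| <= C.
    by rewrite normrM -[leRHS]mulr1 ler_pM ?normr_ind_le1.
  rewrite ler_norml; apply/andP; split.
    rewrite -(cond_exp_cst mX statX normN rvX x (- C)).
    apply: (cond_exp_le mX statX normN rvX) => //; first exact: baire_cst.
    by move=> y; have := le y; rewrite ler_norml => /andP[].
  rewrite -(cond_exp_cst mX statX normN rvX x C).
  apply: (cond_exp_le mX statX normN rvX) => //; first exact: baire_cst.
  by move=> y; rewrite (le_trans (ler_norm _)).
rewrite distrC; have C2 : 0 <= 2 * C by rewrite mulr_ge0.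
apply: (le_trans (average_close (r_gt0 n) C2 (m := m) (e := e / 2) _ _ (ltW e2))).
- move=> i _; rewrite (le_trans (ler_normB _ _))//.
  by have := cC i; have := LC; rewrite /L; lra.
- by move=> i mi ir; apply: hn; clear - mi ir; lia.
- have rn0 : 0 < (r n)%:R :> R by rewrite ltr0n.
  have : 2 * C * (2 * m%:R) / (r n)%:R <= e / 2.
    by rewrite ler_pdivrMr// [leRHS]mulrC -ler_pdivrMr.
  by lra.
Unshelve. all: by end_near.
Qed.

End ClusterConvergence.

(** * Point processes *)

Section AlmostSureIntegral.
Context {R : realType} {dT : measure_display} {T : measurableType dT}.
Variable P : probability T R.

(** The integral of a nonnegative function is a supremum over the simple functions below it, hence
    monotone even without measurability. *)
Lemma ge0_le_integral_any (f g : T -> \bar R) : (forall x, (0 <= f x)%E) ->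
  (forall x, (f x <= g x)%E) -> (\int[P]_x f x <= \int[P]_x g x)%E.
Proof.
move=> f0 fg; have g0 x : (0 <= g x)%E by apply: (le_trans (f0 x)).
rewrite !ge0_integralTE//; apply: ge_ereal_sup => _ [h /= hf <-].
apply: ereal_sup_ubound; exists h => //= x; exact: (le_trans (hf x)).
Qed.

(** [f] lies between [g] cut to 0 off [A] and [g] raised by [C] off [A], both measurable and almost
    everywhere equal to [g]. *)
Let ge0_integral_full_set (f g : T -> R) (C : R) (A : set T) : measurable A ->
  P (~` A) = 0%E -> measurable_fun setT g -> (forall w, 0 <= f w <= C) ->
  (forall w, 0 <= g w <= C) -> (forall w, A w -> f w = g w) ->
  (\int[P]_w (f w)%:E = \int[P]_w (g w)%:E)%E.
Proof.
move=> mA A0 mg f0C g0C fg.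
have f0 w : (0 <= (f w)%:E)%E by rewrite lee_fin; have /andP[] := f0C w.
have g0 w : (0 <= (g w)%:E)%E by rewrite lee_fin; have /andP[] := g0C w.
have mgE : measurable_fun setT (EFin \o g) by exact/measurable_EFinP.
have mAc : measurable (~` A) by exact: measurableC.
have ae_eq (g' : T -> R) : measurable_fun setT g' -> (forall w, 0 <= g' w) ->
    (forall w, A w -> g' w = g w) -> (\int[P]_w (g' w)%:E = \int[P]_w (g w)%:E)%E.
  move=> mg' g'0 gg; apply: ge0_ae_eq_integral => //.
  - exact/measurable_EFinP.
  - by move=> w _; rewrite lee_fin.
  - exists (~` A); split=> // w /= h; apply: contra_not h => hA _.
    by rewrite gg.
apply/eqP; rewrite eq_le; apply/andP; split.
  rewrite -(ae_eq (fun w => g w + C * \1_(~` A) w)).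
  - apply: ge0_le_integral_any => // w; rewrite lee_fin.
    have [wA|wA] := pselect (A w).
      by rewrite fg// lerDl mulr_ge0//; have /andP[h1 h2] := f0C w; exact: (le_trans h1).
    rewrite indicE mem_set// mulr1; have /andP[_ h2] := f0C w.
    by apply: (le_trans h2); rewrite lerDr; have /andP[] := g0C w.
  - by apply: measurable_funD => //; apply: measurable_funM => //; exact: measurable_indic.
  - move=> w; have /andP[h1 h2] := g0C w.
    by rewrite addr_ge0// mulr_ge0//; exact: (le_trans h1).
  - by move=> w wA; rewrite indicE memNset ?mulr0 ?addr0//=; exact.
rewrite -(ae_eq (fun w => g w * \1_A w)).
- apply: ge0_le_integral_any => w.
    by rewrite lee_fin mulr_ge0//; have /andP[] := g0C w.
  rewrite lee_fin indicE; have [wA|wA] := pselect (A w).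
    by rewrite mem_set// mulr1 fg.
  by rewrite memNset// mulr0; have /andP[] := f0C w.
- by apply: measurable_funM => //; exact: measurable_indic.
- by move=> w; rewrite mulr_ge0//; have /andP[] := g0C w.
- by move=> w wA; rewrite indicE mem_set// mulr1.
Qed.

(** [f] may fail to be measurable outside [A]. *)
Lemma Ex_full_set (f g : T -> R) (C : R) (A : set T) : measurable A ->
  P (~` A) = 0%E -> measurable_fun setT g -> (forall w, `|f w| <= C) ->
  (forall w, `|g w| <= C) -> (forall w, A w -> f w = g w) -> Ex P f = Ex P g.
Proof.
move=> mA A0 mg fC gC fg; rewrite /Ex integralE [in RHS]integralE; congr fine.
have pos (h : T -> R) w : ((fun w => (h w)%:E) ^\+ w = (Num.max (h w) 0)%:E)%E.
  by rewrite funeposE EFin_max.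
have neg (h : T -> R) w : ((fun w => (h w)%:E) ^\- w = (Num.max (- h w) 0)%:E)%E.
  by rewrite funenegE -EFinN EFin_max.
under eq_integral do rewrite pos; under [X in (_ - X)%E]eq_integral do rewrite neg.
under [in RHS]eq_integral do rewrite pos.
under [X in _ = (_ - X)%E]eq_integral do rewrite neg.
have bnd (h : T -> R) w : `|h w| <= C -> 0 <= Num.max (h w) 0 <= C.
  move=> hC; rewrite le_max lexx orbT/= ge_max (le_trans (ler_norm _) hC)/=.
  exact: le_trans hC.
congr (_ - _)%E; apply: (@ge0_integral_full_set _ _ C A) => //.
- exact: measurable_funrpos.
- by move=> w; exact: bnd.
- by move=> w; exact: bnd.
- by move=> w wA; rewrite fg.
- by apply: (@measurable_maxr) => //; exact: measurable_funN.
- by move=> w; apply: (bnd (fun w => - f w)); rewrite normrN.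
- by move=> w; apply: (bnd (fun w => - g w)); rewrite normrN.
- by move=> w wA; rewrite fg.
Qed.

End AlmostSureIntegral.

(** * Point measures of vanishing paths *)

Section PointProcess.
Context {R : realType} {d : nat}.
Notation path := (int -> 'rV[R]_d).
Variable N : 'rV[R]_d -> R.
Hypothesis normN : is_norm N.
Local Notation vanishing := (vanishing N).

Lemma emb0 : emb (0 : 'rV[R]_d) = Ezero d.
Proof. by apply/rowP => j; rewrite !mxE. Qed.

Lemma emb_inj (x y : 'rV[R]_d) : emb x = emb y -> x = y.
Proof.
move=> /rowP h; apply/rowP => j; have := h j; rewrite !mxE.
by move=> [].
Qed.

(** The padding of a window sits at 0, outside the state space, and contributes no atom. *)
Lemma pp_window (k : nat) (y : path) :
  pp [set t : int | 1 <= t <= k%:Z] y = pp setT (window 1 k%:Z y).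
Proof.
apply/funext => x; rewrite /pp; apply: eq_fsbigl; apply/seteqP; split=> t /=.
  move=> [tk [x0 e]]; have w : window 1 k%:Z y t = y t by rewrite /window tk.
  by rewrite w.
move=> [_ [x0]]; rewrite /window; case: ifPn => // _ e.
by case: x0; rewrite -e emb0.
Qed.

Lemma pp_tshift s (y : path) : pp setT (tshift s y) = pp setT y.
Proof.
apply/funext => x; rewrite /pp.
rewrite [RHS](@reindex_fsbig _ _ _ _ _ (fun t : int => t + s)
  [set t | [set: int] t /\ x <> Ezero d /\ emb (tshift s y t) = x]) //.
split=> [t //|t t' _ _ /addIr //|t /= [_ [x0 h]]].
by exists (t - s); [split=> //; split=> //; rewrite /tshift subrK|rewrite subrK].
Qed.

Lemma pp_gt0 (y : path) x : (0 < pp setT y x)%N ->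
  x <> Ezero d /\ exists t, emb (y t) = x.
Proof.
move=> h; apply: contrapT => H.
suff : pp setT y x = 0%N by move=> e; rewrite e in h.
rewrite /pp; apply: fsbig1 => t [_ [x0 e]].
by case: H; split=> //; exists t.
Qed.

Lemma pp_count (y : path) x (s : seq int) : uniq s -> x <> Ezero d ->
  (forall t, emb (y t) = x -> t \in s) ->
  pp setT y x = count_mem x [seq emb (y t) | t <- s].
Proof.
move=> us x0 hs; rewrite /pp.
rewrite (_ : [set t | _] = [set` (fun t => emb (y t) == x)]); last first.
  by apply/seteqP; split=> t /=; [move=> [_ [_ h]]; apply/eqP|move=> /eqP].
rewrite -(@bigfs _ _ _ _ s)//; last by move=> t /eqP /hs ->.
by rewrite sum1_count count_map.
Qed.

(** Grouping the times of [s] by their position turns the sum into one over atoms with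
    multiplicities; atoms not met in [s] lie where [g] vanishes. *)
Lemma pm_eval_pp (y : path) (g : Epoint d -> R) (s : seq int) : uniq s ->
  g (Ezero d) = 0 -> (forall t, t \notin s -> g (emb (y t)) = 0) ->
  pm_eval (pp setT y) g = \sum_(t <- s) g (emb (y t)).
Proof.
move=> us g0 hs; pose r := [seq emb (y t) | t <- s].
have gx x : g x != 0 -> pp setT y x = count_mem x r.
  move=> gx; apply: pp_count => //; first by move=> x0; rewrite x0 g0 eqxx in gx.
  by move=> t tx; apply: contraNT gx => /hs; rewrite tx => ->.
have -> : \sum_(t <- s) g (emb (y t)) = \sum_(x <- r) g x by rewrite big_map.
rewrite -[RHS]big_undup_iterop_count /pm_eval.
rewrite (_ : [set x | _] = [set` (fun x => (0 < pp setT y x)%N)])//.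
rewrite -(@bigfs _ _ _ _ (undup r)) ?undup_uniq//; last first.
  move=> x px; rewrite mem_undup => xr.
  have [_ [t tx]] := pp_gt0 px.
  rewrite -tx hs ?mulr0//; apply: contra xr => ts.
  by rewrite -tx; apply/mapP; exists t.
rewrite big_mkcond; apply: eq_bigr => x _.
have [gx0|/gx e] := eqVneq (g x) 0.
  rewrite gx0 mulr0 if_same; elim: (count_mem x r) => [//|[//|n] ih].
  by transitivity (0 + iterop n.+1 +%R (0 : R) 0); [rewrite -[iterop _ _ _ _]ih addr0|].
rewrite e; case: (count_mem x r) => [|n]; first by [].
by rewrite /= -[RHS]/(g x *+ n.+1) mulr_natl.
Qed.

(** The origin is outside the state space; there continuity comes from [g] vanishing on a whole
    box. *)
Lemma CKplus_emb_continuous (g : Epoint d -> R) (x : 'rV[R]_d) e : CKplus g ->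
  0 < e -> exists2 delta : R, 0 < delta &
    forall z, `|x - z| < delta -> `|g (emb x) - g (emb z)| < e.
Proof.
move=> [g0 gc [dg [dg0 gbox]]] e0.
have box (z : 'rV[R]_d) : `|z| < dg -> g (emb z) = 0.
  move=> zd; apply: gbox => j; rewrite mxE /= lte_fin.
  by rewrite (le_lt_trans _ zd)// row_coord_le.
have [->|x0] := eqVneq x 0.
  exists dg => // z; rewrite sub0r normrN => zd.
  by rewrite !box ?subrr ?normr0//; rewrite (_ : `|0| = 0)//; exact: normr0.
have ex0 : emb x <> Ezero d by rewrite -emb0 => /emb_inj/eqP; rewrite (negbTE x0).
have /cvgrPdist_lt /(_ e e0) [B hB sB] := gc _ ex0.
have : nbhs x [set z | `|g (emb x) - g (emb z)| < e].
  exists (fun i j => EFin @^-1` (B i j)).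
    move=> i j; have := hB i j; rewrite mxE.
    by move=> h; exact: h.
  move=> z hz; apply: sB => i j; rewrite mxE; exact: hz.
move=> /nbhs_ballP [delta /= d0 hd]; exists delta => // z xz; apply: hd.
split=> // i j; have := row_coord_le (x - z) j; rewrite !mxE ord1 => h.
exact: le_lt_trans h xz.
Qed.

Lemma finite_common_delta n (A : 'I_n -> R -> Prop) :
  (forall i e e', A i e -> 0 < e' -> e' <= e -> A i e') ->
  (forall i, exists2 e, 0 < e & A i e) -> exists2 e, 0 < e & forall i, A i e.
Proof.
move=> mono hA; have /choice[f hf] : forall i, exists e, 0 < e /\ A i e.
  by move=> i; have [e e0 he] := hA i; exists e.
(* The inverse of [S] is below every [f i] and positive even for an empty index type. *)
pose S := 1 + \sum_i (f i)^-1.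
have S0 : 0 < S.
  by rewrite ltr_pwDl// sumr_ge0// => i _; rewrite invr_ge0 ltW//; have [] := hf i.
exists S^-1; first by rewrite invr_gt0.
move=> i; have [f0 fi] := hf i; apply: mono fi _ _; first by rewrite invr_gt0.
rewrite invf_ple ?posrE// /S (bigD1 i)//= addrCA lerDl addr_ge0// sumr_ge0// => k _.
by rewrite invr_ge0 ltW//; have [] := hf k.
Qed.

(** From [T] on both paths stay in the box where [g] vanishes, half of its size being kept for [y]
    and half for the deviation; finitely many times remain. *)
Lemma pm_eval_continuous (g : Epoint d -> R) (y : path) e : CKplus g ->
  vanishing y -> 0 < e -> exists2 delta : R, 0 < delta &
    forall z : path, (forall t, `|y t - z t| <= delta) ->
      `|pm_eval (pp setT z) g - pm_eval (pp setT y) g| < e.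
Proof.
move=> gK vy e0; have [g0 gc [dg [dg0 gbox]]] := gK.
have gz0 : g (Ezero d) = 0 by apply: gbox => j; rewrite mxE /= normr0 lte_fin.
have box (z : 'rV[R]_d) : `|z| < dg -> g (emb z) = 0.
  move=> zd; apply: gbox => j; rewrite mxE /= lte_fin.
  by rewrite (le_lt_trans _ zd)// row_coord_le.
have [c c0 hc] := is_norm_lower normN.
have dg2 : 0 < dg / 2 by rewrite divr_gt0.
have [T hT] := vy _ (mulr_gt0 c0 dg2).
have yT t : T%:Z <= `|t| -> `|y t| < dg / 2.
  by move=> /hT h; rewrite -(ltr_pM2l c0) (le_lt_trans (hc _)).
pose ti (i : 'I_(T.*2.+1)) : int := (i : nat)%:Z - T%:Z.
pose s := [seq ti i | i <- index_enum 'I_(T.*2.+1)].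
have us : uniq s.
  rewrite map_inj_uniq ?index_enum_uniq// => i j; rewrite /ti => ij; apply/val_inj => /=.
  by lia.
have out t : t \notin s -> T%:Z <= `|t|.
  move=> ts; rewrite leNgt; apply/negP => tT; move/negP: ts; apply.
  have tk : (absz (t + T%:Z)%R < T.*2.+1)%N by lia.
  apply/mapP; exists (Ordinal tk); first exact: mem_index_enum.
  by rewrite /ti/=; lia.
(* One more than the number of terms, for the final strict inequality. *)
pose K : R := T.*2.+2%:R; have K0 : 0 < K by rewrite ltr0n.
have eK : 0 < e / K by rewrite divr_gt0.
have [d1 d10 hd1] := @finite_common_delta _
  (fun i dl => forall z, `|y (ti i) - z| < dl -> `|g (emb (y (ti i))) - g (emb z)| < e / K)
  (fun i a b h b0 ba z hz => h z (lt_le_trans hz ba))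
  (fun i => CKplus_emb_continuous (y (ti i)) gK eK).
exists (Num.min (d1 / 2) (dg / 2)); first by rewrite lt_min !divr_gt0.
move=> z yz.
have zs t : t \notin s -> g (emb (z t)) = 0.
  move=> /out/yT yt; apply: box.
  have := yz t; rewrite le_min => /andP[_ h].
  have -> : z t = y t - (y t - z t) by rewrite subKr.
  by rewrite (le_lt_trans (ler_normB _ _))// [ltRHS]splitr ltr_leD.
have ys t : t \notin s -> g (emb (y t)) = 0.
  by move=> /out/yT yt; apply: box; rewrite (lt_trans yt)// ltr_pdivrMr// ltr_pMr// ltr1n.
rewrite (pm_eval_pp us gz0 zs) (pm_eval_pp us gz0 ys) !big_map -sumrB.
rewrite (le_lt_trans (ler_norm_sum _ _ _))//.
apply: (@le_lt_trans _ _ (\sum_(i < T.*2.+1) e / K)).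
  apply: ler_sum => i _; rewrite distrC ltW//; apply: hd1.
  have := yz (ti i); rewrite le_min => /andP[h _]; apply: (le_lt_trans h).
  by rewrite ltr_pdivrMr// ltr_pMr// ltr1n.
rewrite sumr_const card_ord -mulr_natr mulrAC ltr_pdivrMr// ltr_pM2l//.
by rewrite /K ltr_nat.
Qed.

Lemma is_radon_pp (y : path) : vanishing y -> is_radon (pp setT y).
Proof.
move=> vy; split.
  by apply/eqP; rewrite -leqn0 leqNgt; apply/negP => /pp_gt0[].
move=> dl dl0; have [c c0 hc] := is_norm_lower normN.
have [T hT] := vy _ (mulr_gt0 c0 dl0).
apply: (@sub_finite_set _ _ ((fun i : 'I_(T.*2.+1) => emb (y ((i : nat)%:Z - T%:Z))) @` setT)).
  move=> x /= [/pp_gt0[_ [t <-]] [j]]; rewrite mxE /= lee_fin => h.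
  have tT : `|t| < T%:Z.
    rewrite ltNge; apply/negP => /hT; apply/negP; rewrite -leNgt.
    by apply: le_trans (hc _); rewrite ler_pM2l// (le_trans h)// row_coord_le.
  have tk : (absz (t + T%:Z)%R < T.*2.+1)%N by lia.
  by exists (Ordinal tk) => //=; congr (emb (y _)); lia.
by apply: finite_image; exact: finite_finset.
Qed.

Lemma pp_functional_continuous (F : pmeasure d -> R) :
  bounded_vague_continuous F -> vanishing_continuous N (fun y => F (pp setT y)).
Proof.
move=> [_ Fc] y vy e e0.
have [n [gs [gsK [dl [dl0 hF]]]]] := Fc _ (is_radon_pp vy) e e0.
have [d1 d10 hd1] := @finite_common_delta n
  (fun i dl' => forall z : path, (forall t, `|y t - z t| <= dl') ->
     `|pm_eval (pp setT z) (gs i) - pm_eval (pp setT y) (gs i)| < dl)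
  (fun i a b h b0 ba z hz => h z (fun t => le_trans (hz t) ba))
  (fun i => pm_eval_continuous (gsK i) vy dl0).
exists d1 => // z vz yz; rewrite distrC; apply: hF; first exact: is_radon_pp.
by move=> i; exact: hd1.
Qed.

End PointProcess.

(** * The limiting cluster *)

Section Conclusions.
Context {R : realType} {d : nat} {dX : measure_display} {TX : measurableType dX}.
Context {dY : measure_display} {TY : measurableType dY}.
Notation path := (int -> 'rV[R]_d).
Variables (P : probability TX R) (X : int -> TX -> 'rV[R]_d).
Variables (Q : probability TY R) (Y : int -> TY -> 'rV[R]_d).
Variables (alpha : R) (N : 'rV[R]_d -> R).
Hypothesis mX : forall t j, measurable_fun setT (fun w => X t w 0 j).
Hypothesis mY : forall t j, measurable_fun setT (fun w => Y t w 0 j).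
Hypothesis statX : strictly_stationary P X.
Hypothesis alpha_gt0 : 0 < alpha.
Hypothesis normN : is_norm N.
Hypothesis rvX : jointly_regvar P X alpha.
Hypothesis tailXY : tail_process P X N Q Y.
Variables (a : nat -> R) (r : nat -> nat).
Hypothesis a_gt0 : forall n, 0 < a n.
Hypothesis a_tail : (fun n => n%:R * Pr P [set w | a n < N (X 0 w)]) @ \oo --> (1 : R).
Hypothesis r_gt0 : forall n, (0 < r n)%N.
Hypothesis r_cvg : (fun n => (r n)%:R : R) @ \oo --> +oo.
Hypothesis anticluster : forall u : R, 0 < u ->
  (fun m : nat => limn_sup (fun n =>
     condPr P [set w | exists t : int, m%:Z <= `|t| <= (r n)%:Z /\ a n * u < N (X t w)]
              [set w | a n * u < N (X 0 w)])) @ \oo --> (0 : R).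

Local Notation tail := (tail P X).
Local Notation cond_exp := (cond_exp P X N).
Local Notation EQ f := (Ex Q (fun w => f (sample Y w))).
Local Notation vanishing := (vanishing N).

Let vanish1 : EQ (fun y => ind (vanishing y)) = 1.
Proof.
exact: (tail_vanishing mX mY statX alpha_gt0 normN rvX tailXY a_gt0 a_tail r_cvg anticluster).
Qed.
Let exceed1 : EQ (fun y => ind (1 < N (y 0))) = 1 :=
  tail_process_exceed0 mX mY statX alpha_gt0 normN rvX tailXY.
Let bset_v := bset_vanishing normN.
Let bset_e : bset (fun y : path => 1 < N (y 0)) := baire_exceed normN 0 1.

Let EQ_restrict (f : path -> R) : baire f ->
  EQ (fun y => f y * ind (vanishing y) * ind (1 < N (y 0))) = EQ f.
Proof.
move=> bf; rewrite (EQ_almost_sure mY (baireM bf bset_v) bset_e exceed1).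
exact: (EQ_almost_sure mY bf bset_v vanish1).
Qed.

(** The event [E] of the theorem, with the strict supremum inequality written as
    a countable union so as to be visibly measurable. *)
Definition max_at_0 (y : path) : Prop :=
  (exists k : nat, forall t : int, t < 0 -> N (y t) + k.+1%:R^-1 <= N (y 0)) /\
  forall t : int, N (y t) <= N (y 0).

Lemma bset_max_at_0 : bset max_at_0.
Proof.
apply: bset_and; last first.
  by apply: bset_forall_int => t; apply: bset_le; exact: cylcont_norm.
apply: bset_exists => k; apply: bset_forall_int => t; apply: bset_imp; first exact: bset_cst.
by apply: bset_le; [apply: cylcontD; [exact: cylcont_norm|exact: cylcont_cst]|exact: cylcont_norm].
Qed.

Lemma max_at_0P (y : path) : max_at_0 y <->
  (ereal_sup [set (N (y t))%:E | t in [set t : int | (t < 0)%R]] < (N (y 0))%:E)%E /\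
  (N (y 0))%:E = ereal_sup (range (fun t => (N (y t))%:E)).
Proof.
split=> [[[k hk] hmax]|[hlt heq]]; split.
- apply: (@le_lt_trans _ _ (N (y 0) - k.+1%:R^-1)%:E); last first.
    by rewrite lte_fin ltrBlDr ltrDl invr_gt0.
  apply: ge_ereal_sup => _ [t /= t0 <-]; rewrite lee_fin lerBrDr; exact: hk.
- apply/eqP; rewrite eq_le; apply/andP; split.
    by apply: ereal_sup_ubound; exists 0.
  by apply: ge_ereal_sup => _ [t _ <-]; rewrite lee_fin.
- set S := ereal_sup _ in hlt.
  have le_S t : t < 0 -> ((N (y t))%:E <= S)%E.
    by move=> t0; apply: ereal_sup_ubound; exists t.
  (* The supremum is at least [N (y (- 1))] and below [N (y 0)], hence finite. *)
  have : S \is a fin_num.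
    rewrite fin_numE; apply/andP; split; apply/eqP => e.
      by have := le_S (-1) isT; rewrite e.
    by rewrite e in hlt.
  case: S hlt le_S => [s hlt le_S _|//|//].
  have gap : 0 < N (y 0) - s by rewrite subr_gt0.
  have [k _ /(_ k (leqnn k)) hk] := nbhs_infty_ger (N (y 0) - s)^-1.
  exists k => t /le_S; rewrite lee_fin => h.
  have : k.+1%:R^-1 <= N (y 0) - s.
    by rewrite invf_ple ?posrE ?ltr0Sn//; apply: le_trans hk _; rewrite ler_nat.
  by move: (k.+1%:R^-1) => q hq; lra.
- by move=> t; rewrite -lee_fin heq; apply: ereal_sup_ubound; exists t.
Qed.

(** On a vanishing path strict inequalities at all negative times leave a uniform gap: from [T] on
    the values are below half of [N (y 0)], and only finitely many times remain. *)
Lemma max_at_0_first_max (y : path) : vanishing y -> 1 < N (y 0) ->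
  max_at_0 y <-> first_max N y.
Proof.
move=> vy y0; split=> [[[k hk] hmax]|[_ _ hlt hmax]].
  split=> // t t0; apply: (lt_le_trans _ (hk t t0)).
  by rewrite ltrDl invr_gt0.
split=> //; have N0 : 0 < N (y 0) by apply: lt_trans y0.
have N2 : 0 < N (y 0) / 2 by rewrite divr_gt0.
have [T hT] := vy _ N2.
have [e e0 he] := @finite_common_delta R T
  (fun i e => N (y (- (i : nat).+1%:Z)) + e <= N (y 0))
  (fun i b b' h _ bb => le_trans (lerD (lexx _) bb) h)
  (fun i => ex_intro2 _ _ (N (y 0) - N (y (- (i : nat).+1%:Z)))
     (eq_ind_r is_true (hlt (- (i : nat).+1%:Z) isT) (subr_gt0 _ _))
     (eq_ind_r (fun z => z <= N (y 0)) (lexx _) (subrKC _ _))).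
have m0 : 0 < Num.min e (N (y 0) / 2) by rewrite lt_min e0.
have [k _ /(_ k (leqnn k)) hk] := nbhs_infty_ger (Num.min e (N (y 0) / 2))^-1.
have : k.+1%:R^-1 <= Num.min e (N (y 0) / 2).
  by rewrite invf_ple ?posrE ?ltr0Sn//; apply: le_trans hk _; rewrite ler_nat.
rewrite le_min => /andP[k1 k2]; exists k => t t0; move: (k.+1%:R^-1) k1 k2 => q k1 k2.
have [tT|tT] := leP (T%:Z) `|t|; first by have := hT t tT; lra.
have tk : ((absz t).-1 < T)%N by lia.
have := he (Ordinal tk); rewrite /= (_ : - (absz t).-1.+1%:Z = t); last by lia.
by lra.
Qed.

Lemma EQ_max_at_0 : EQ (fun y => ind (max_at_0 y)) = EQ (fun y => ind (first_max N y)).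
Proof.
rewrite -(EQ_restrict bset_max_at_0); apply: eq_Ex => w; rewrite -mulrA -ind_and -ind_and.
apply: ind_eq; split=> [[h [v e]]|h]; first exact/max_at_0_first_max.
by have [v e _ _] := h; split=> //; apply/max_at_0_first_max.
Qed.

(** The weight in [anchor_exchange] is [Phi] times the vanishing indicator, which is shift-invariant
    too. *)
Lemma cluster_value_first (Phi : path -> R) C : vanishing_continuous N Phi ->
  (forall y, `|Phi y| <= C) -> shift_invariant Phi ->
  cluster_value Q Y N Phi (fun t => t < 0) =
  EQ (fun y => Phi y * ind (vanishing y) * ind (first_max N y)).
Proof.
move=> Phic PhiC Phis.
have bPhi := baire_vanishing normN Phic (fun y _ => PhiC y).
rewrite -(anchor_exchange mX mY statX alpha_gt0 normN rvX tailXY bPhi _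
  (anchor_first_exceed normN) (anchor_first_max normN)); last first.
  move=> s y; rewrite Phis; congr (_ * _); apply: ind_eq; split=> v.
    have := vanishing_tshift (- s) v; congr (vanishing _).
    by apply/funext => t; rewrite /tshift subrK.
  exact: vanishing_tshift.
have bno := bset_no_exceed normN (fun t => t < 0).
rewrite /cluster_value -(EQ_restrict (baireM bPhi bno)).
apply: eq_Ex => w; rewrite -!mulrA; congr (_ * _).
rewrite -!ind_and; apply: ind_eq; split; first by move=> [v [h [_ e]]]; split.
by move=> [v [_ e h]].
Qed.

(** Almost surely the path vanishes and exceeds at 0; then no exceedance from time 1 on means that
    the last one is at 0. *)
Lemma EQ_last : EQ (fun y => ind (no_exceed N (fun t => 1 <= t) y)) =
  EQ (fun y => ind (first_max N y)).
Proof.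
have := anchor_exchange mX mY statX alpha_gt0 normN rvX tailXY (@baire_cst R d 1)
  (fun _ _ => erefl) (anchor_last_exceed normN) (anchor_first_max normN).
under eq_Ex do rewrite mul1r; under [X in _ = X -> _]eq_Ex do rewrite mul1r.
move=> <-; rewrite -(EQ_restrict (bset_no_exceed normN _)).
apply: eq_Ex => w; rewrite -mulrA -!ind_and; apply: ind_eq.
split=> [[h [v e]]|[v e h]]; first by split=> // t t0; apply: h; lia.
by split=> // t t0; apply: h; lia.
Qed.

Let cst1 : vanishing_continuous N (fun _ : path => 1 : R).
Proof. by move=> y _ e e0; exists 1 => // z _ _; rewrite subrr normr0. Qed.
Let cst1C (y : path) : `|(fun _ : path => 1 : R) y| <= 1.
Proof. by rewrite normr1. Qed.

Let cluster_value1 D : cluster_value Q Y N (fun=> 1) D = EQ (fun y => ind (no_exceed N D y)).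
Proof.
rewrite -(EQ_almost_sure mY (bset_no_exceed normN D) bset_v vanish1).
by apply: eq_Ex => w; rewrite mul1r mulrC.
Qed.

Let theta1 : cluster_value Q Y N (fun=> 1) (fun t => t < 0) = EQ (fun y => ind (first_max N y)).
Proof.
rewrite (cluster_value_first cst1 cst1C)//; apply: eq_Ex => w.
rewrite mul1r -ind_and; apply: ind_eq; split=> [[]//|h].
by have [] := h.
Qed.

Lemma measurable_Mmax k x : 0 <= x -> measurable [set w | Mmax X N k w <= x].
Proof.
move=> x0; rewrite (_ : mkset _ = [set w | (fun y : path =>
    forall t : int, 1 <= t <= k%:Z -> N (y t) <= x) (sample X w)]).
  apply: (measurable_bset mX (A := fun y : path => forall t : int, 1 <= t <= k%:Z -> N (y t) <= x)).
  apply: bset_forall_int => t; apply: bset_imp; first exact: bset_cst.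
  by apply: bset_le; [exact: cylcont_norm|exact: cylcont_cst].
by apply/seteqP; split=> w h; apply/(Mmax_leP X N k w x0).
Qed.

Lemma measurable_Mmax_gt k x : 0 <= x -> measurable [set w | x < Mmax X N k w].
Proof.
move=> /(measurable_Mmax k)/measurableC; congr measurable.
by apply/seteqP; split=> w /=; rewrite ltNge => /negP.
Qed.

Lemma block_exceedance u : 0 < u ->
  (fun n => Pr P [set w | a n * u < Mmax X N (r n) w] /
            ((r n)%:R * Pr P [set w | a n * u < N (X 0 w)])) @ \oo -->
  EQ (fun y => ind (first_max N y)).
Proof.
move=> u0; rewrite -theta1.
have := block_average mX mY statX alpha_gt0 normN rvX tailXY a_gt0 a_tail r_gt0 r_cvg
  anticluster cst1 ler01 cst1C (fun _ _ => erefl) u0.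
apply: cvg_ext => n; congr (_ / _); rewrite -Ex_ind.
  by apply: eq_Ex => w; rewrite mulr1.
by apply: measurable_Mmax_gt; rewrite mulr_ge0 ?ltW.
Qed.

(** [cluster_window] with a constant functional and the full window [-r n, r n], of which [D]
    constrains the positive half only. *)
Lemma forward_no_exceedance u : 0 < u ->
  (fun n => condPr P [set w | Mmax X N (r n) w <= a n * u]
                     [set w | a n * u < N (X 0 w)]) @ \oo -->
  EQ (fun y => ind (first_max N y)).
Proof.
move=> u0; rewrite -EQ_last -cluster_value1; apply/cvgrPdist_le => e e0.
have [m hm] := cluster_window mX mY statX alpha_gt0 normN rvX tailXY a_gt0 a_tail r_cvg
  anticluster (fun t => 1 <= t) cst1 ler01 cst1C u0 e0.
have hr := near_r r_cvg m.
near=> n; have mr : (m <= r n)%N by near: n.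
have au0 : 0 < a n * u by rewrite mulr_gt0.
have hn : forall l h : int, - (r n)%:Z <= l <= - m%:Z -> m%:Z <= h <= (r n)%:Z ->
    `|cond_exp (a n * u) (fun y => 1 * ind (no_exceed N (fun t => 1 <= t) (window l h y))) -
      cluster_value Q Y N (fun=> 1) (fun t => 1 <= t)| <= e by near: n.
have := hn (- (r n)%:Z) (r n)%:Z ltac:(clear - mr; lia) ltac:(clear - mr; lia).
rewrite distrC condPrE; [|exact/measurable_Mmax/ltW|exact: (measurable_exceed mX _ _ normN)].
congr (`|_ - _| <= _); rewrite cond_expE; congr (_ / _); apply: eq_Ex => w.
rewrite mul1r; congr (_ * _); apply: ind_eq; rewrite no_exceed_window//= Mmax_leP ?ltW//.
have i0 : 0 <= (a n * u)^-1 by rewrite invr_ge0 ltW.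
split=> H t t1.
  have := H t ltac:(clear - t1; lia) ltac:(clear - t1; lia).
  by rewrite /scale is_normZ// ler_pdivrMl// mulr1.
move=> t2; have := H t ltac:(clear - t1 t2; lia).
by rewrite /scale is_normZ// ler_pdivrMl// mulr1.
Unshelve. all: by end_near.
Qed.

(** A quotient of two block means, for [Phi] and for 1, in which the normalization cancels. *)
Lemma cluster_law u (F : pmeasure d -> R) : 0 < u -> bounded_vague_continuous F ->
  (fun n => condE P [set w | a n * u < Mmax X N (r n) w]
              (fun w => F (pp [set t : int | 1 <= t <= (r n)%:Z]
                              (fun t => (a n * u)^-1 *: X t w)))) @ \oo -->
  condE Q [set w | max_at_0 (sample Y w)] (fun w => F (pp setT (sample Y w))).
Proof.
move=> u0 hF; pose Phi (y : path) := F (pp setT y).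
have Phic : vanishing_continuous N Phi := pp_functional_continuous normN hF.
have [[C FC] _] := hF; have PhiC y : `|Phi y| <= C by exact: FC.
have C0 : 0 <= C by apply: le_trans (PhiC (fun=> 0)).
have Phis : shift_invariant Phi by move=> s y; rewrite /Phi pp_tshift.
have theta_gt0 := anchor_gt0 mX mY statX alpha_gt0 normN rvX tailXY vanish1
  (anchor_first_max normN).
have lim := block_average mX mY statX alpha_gt0 normN rvX tailXY a_gt0 a_tail r_gt0 r_cvg
  anticluster Phic C0 PhiC Phis u0.
have theta_neq0 : EQ (fun y => ind (first_max N y)) != 0 by rewrite gt_eqF.
rewrite (cluster_value_first Phic PhiC Phis) in lim.
have mV := measurable_bset mY bset_v; have mE := measurable_bset mY bset_e.
have bM := bset_max_at_0.
have -> : condE Q [set w | max_at_0 (sample Y w)] (fun w => F (pp setT (sample Y w))) =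
    EQ (fun y => Phi y * ind (vanishing y) * ind (first_max N y)) /
    EQ (fun y => ind (first_max N y)).
  rewrite condEE -EQ_max_at_0 (Ex_bset _ mY bM); congr (_ / _).
  have bPhi := baire_vanishing normN Phic (fun y _ => PhiC y).
  have [bfm _ _ _] := anchor_first_max normN.
  (* [F] of the point process of [Y] may fail to be measurable off the vanishing paths exceeding at
     0; the comparison with a [baire] integrand is made on that set of probability 1. *)
  apply: (@Ex_full_set _ _ _ _ _ _ C [set w | vanishing (sample Y w) /\ 1 < N (sample Y w 0)]).
  - exact: (measurableI _ _ mV mE).
  - have mA := measurable_bset mY (bset_and bset_v bset_e).
    rewrite probability_setC// -(PrE Q mA) -(Ex_bset Q mY (bset_and bset_v bset_e)).
    rewrite (_ : Ex Q _ = EQ (fun y => ind (vanishing y) * ind (1 < N (y 0)))); last first.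
      by apply: eq_Ex => w; rewrite ind_and.
    by rewrite (EQ_almost_sure mY bset_v bset_e exceed1) vanish1 subee.
  - apply: (measurable_baire mY (f := fun y => Phi y * ind (vanishing y) * ind (first_max N y))).
    exact: baireM.
  - by move=> w; rewrite normrM -[leRHS]mul1r ler_pM ?normr_ind_le1// FC.
  - move=> w; rewrite normrM -[leRHS]mulr1 ler_pM ?normr_ind_le1//.
    by rewrite normrM -[leRHS]mulr1 ler_pM ?normr_ind_le1.
  - move=> w [v e]; rewrite (indT v) mulr1 mulrC; congr (_ * _).
    by apply: ind_eq; exact: max_at_0_first_max.
have lim2 := cvgM lim (cvgV theta_neq0 (block_exceedance u0)).
apply: cvg_ext (lim2 _ _) => n.
have au0 : 0 < a n * u by rewrite mulr_gt0.
have k0 : (r n)%:R * tail N (a n * u) != 0.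
  by rewrite mulf_neq0 ?gt_eqF ?ltr0n// (tail_gt0 mX statX normN rvX).
rewrite condEE /= invf_div mulrA divfK//; congr (_ / _); apply: eq_Ex => w; congr (_ * _).
by rewrite /Phi -pp_window.
Qed.

End Conclusions.

Theorem theorem2p5 (R : realType) (d : nat)
  (dX : measure_display) (TX : measurableType dX) (P : probability TX R)
  (X : int -> TX -> 'rV[R]_d)
  (dY : measure_display) (TY : measurableType dY) (Q : probability TY R)
  (Y : int -> TY -> 'rV[R]_d)
  (alpha : R) (N : 'rV[R]_d -> R) (a : nat -> R) (r : nat -> nat) :
  (forall t j, measurable_fun setT (fun w => X t w 0 j)) ->
  (forall t j, measurable_fun setT (fun w => Y t w 0 j)) ->
  strictly_stationary P X ->
  0 < alpha ->
  is_norm N ->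
  jointly_regvar P X alpha ->
  tail_process P X N Q Y ->
  (forall n, 0 < a n) ->
  (fun n => n%:R * Pr P [set w | a n < N (X 0 w)]) @ \oo --> (1 : R) ->
  (forall n, (0 < r n)%N) ->
  (fun n => (r n)%:R : R) @ \oo --> +oo ->
  (fun n => (r n)%:R / n%:R : R) @ \oo --> (0 : R) ->
  (forall u : R, 0 < u ->
     (fun m : nat => limn_sup (fun n =>
        condPr P [set w | exists t : int,
                            m%:Z <= `|t| <= (r n)%:Z /\ a n * u < N (X t w)]
                 [set w | a n * u < N (X 0 w)])) @ \oo --> (0 : R)) ->
  let Theta_ev := [set w | forall i : int, 1 <= i -> N (Y i w) <= 1] in
  let E_ev := [set w | (ereal_sup [set (N (Y t w))%:E | t in [set t : int | (t < 0)%R]]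
                          < (N (Y 0 w))%:E)%E /\
                       (N (Y 0 w))%:E = ereal_sup (range (fun t => (N (Y t w))%:E))] in
  [/\ Q [set w | forall eps : R, 0 < eps ->
                   exists T : nat, forall t : int, T%:Z <= `|t| -> `|N (Y t w)| < eps]
        = 1%E,
      Q Theta_ev = Q E_ev /\ (0 < Q E_ev)%E,
      forall u : R, 0 < u ->
        (fun n => condPr P [set w | Mmax X N (r n) w <= a n * u]
                           [set w | a n * u < N (X 0 w)]
                  - Pr P [set w | a n * u < Mmax X N (r n) w]
                    / ((r n)%:R * Pr P [set w | a n * u < N (X 0 w)])) @ \oo --> (0 : R)
        /\ (fun n => condPr P [set w | Mmax X N (r n) w <= a n * u]
                              [set w | a n * u < N (X 0 w)]) @ \oo --> fine (Q Theta_ev) &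
      forall u : R, 0 < u ->
      forall F : pmeasure d -> R, bounded_vague_continuous F ->
        (fun n => condE P [set w | a n * u < Mmax X N (r n) w]
                    (fun w => F (pp [set t : int | 1 <= t <= (r n)%:Z]
                                    (fun t => (a n * u)^-1 *: X t w))))
        @ \oo --> condE Q E_ev (fun w => F (pp setT (fun t => Y t w)))].
Proof.
move=> mX mY statX alpha_gt0 normN rvX tailXY a_gt0 a_tail r_gt0 r_cvg _ anticluster.
move=> Theta_ev E_ev.
have vanish1 := tail_vanishing mX mY statX alpha_gt0 normN rvX tailXY a_gt0 a_tail r_cvg
  anticluster.
have theta_gt0 := anchor_gt0 mX mY statX alpha_gt0 normN rvX tailXY vanish1
  (anchor_first_max normN).
have E_evE : E_ev = [set w | max_at_0 N (sample Y w)].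
  by apply/seteqP; split=> w h; apply/max_at_0P.
have bM := bset_max_at_0 normN; have bT := bset_no_exceed normN (fun t => 1 <= t).
have QE : Q E_ev = (Ex Q (fun w => ind (first_max N (sample Y w))))%:E.
  rewrite E_evE -(EQ_max_at_0 mX mY statX alpha_gt0 normN rvX tailXY a_gt0 a_tail r_cvg
    anticluster).
  by rewrite (Ex_bset Q mY bM) PrE//; exact: (measurable_bset mY bM).
have QT : Q Theta_ev = (Ex Q (fun w => ind (first_max N (sample Y w))))%:E.
  rewrite -(EQ_last mX mY statX alpha_gt0 normN rvX tailXY a_gt0 a_tail r_cvg anticluster).
  by rewrite (Ex_bset Q mY bT) PrE//; exact: (measurable_bset mY bT).
split.
- rewrite (_ : [set w | _] = [set w | vanishing N (sample Y w)]); last first.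
    apply/seteqP; split=> w h e e0; have [T hT] := h e e0; exists T => t tT.
      by have := hT t tT; rewrite ger0_norm ?is_norm_ge0.
    by rewrite ger0_norm ?is_norm_ge0//; exact: hT.
  have bv := bset_vanishing normN.
  by rewrite -(PrE Q (measurable_bset mY bv)) -(Ex_bset Q mY bv) vanish1.
- by rewrite QT QE lte_fin.
- move=> u u0; rewrite QT.
  have l1 := forward_no_exceedance mX mY statX alpha_gt0 normN rvX tailXY a_gt0 a_tail
    r_cvg anticluster u0.
  have l2 := block_exceedance mX mY statX alpha_gt0 normN rvX tailXY a_gt0 a_tail r_gt0
    r_cvg anticluster u0.
  by split=> //; have := cvgB l1 l2; rewrite subrr; exact.
- move=> u u0 F hF; rewrite E_evE.
  exact: (cluster_law mX mY statX alpha_gt0 normN rvX tailXY a_gt0 a_tail r_gt0 r_cvg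
    anticluster u0 hF).
Qed.
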